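(* Let $(p_n)$ be a sequence of positive integers with $p_n\to\infty$ and $p_n/n\to0$. Let $\pi_n$ be a prior probability density for $\tau$ that is supported inside $[1/n,1]$, and let $t_n=C_u\pi^{3/2}\tau_n(p_n)$. (a) If there exist constants $c\le C_u/2$ and $K>0$ such that $\int_{t_n/2}^{t_n}\pi_n(\tau)\,d\tau\ge K e^{-cp_n}$ for all sufficiently large $n$, then for every sequence $M_n\to\infty$, $$\sup_{\theta_0\in\ell_0[p_n]}\mathrm E_{\theta_0}\,\Pi\big(\theta:\ \|\theta-\theta_0\|_2\ge M_n\sqrt{p_n\log n}\ \big|\ Y^n\big)\to0 .$$ (b) If instead only there exists a constant $K>0$ such that $\int_{t_n/2}^{t_n}\pi_n(\tau)\,d\tau\ge K t_n$ for all sufficiently large $n$, then for every sequence $M_n\to\infty$, $$\sup_{\theta_0\in\ell_0[p_n]}\mathrm E_{\theta_0}\,\Pi\big(\theta:\ \|\theta-\theta_0\|_2\ge M_n\sqrt{p_n}\,\log n\ \big|\ Y^n\big)\to0 .$$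
   Context: Model: under $P_{\theta_0}$ (expectation $\mathrm E_{\theta_0}$), with $\theta_0\in\mathbb R^n$, one observes $Y^n=(Y_1,\dots,Y_n)$ with independent $Y_i\sim N(\theta_{0,i},1)$. $\ell_0[p]=\{\theta\in\mathbb R^n:\ \#\{i:\theta_i\neq0\}\le p\}$, $\tau_n(p)=(p/n)\sqrt{\log(n/p)}$, and $\varphi$ is the standard normal density. In $t_n$, the factor $\pi^{3/2}$ involves the number $\pi$. Hierarchical Bayes model: $\tau$ has density $\pi_n$; given $\tau$, the coordinates $\theta_1,\dots,\theta_n$ are i.i.d. with the horseshoe density $g_\tau(\theta)=\int_0^\infty\varphi\big(\frac{\theta}{\lambda\tau}\big)\frac1{\lambda\tau}\frac{2}{\pi(1+\lambda^2)}\,d\lambda$; given $(\theta,\tau)$ the $Y_i$ are independent $N(\theta_i,1)$. $\Pi(\cdot\mid Y^n)$ is the resulting posterior distribution of $\theta$ given $Y^n$. The constant $C_u$: for $\tau\in(0,1]$ and $k\in\{-1/2,1/2,3/2\}$ let $$I_k(y)=\int_0^1 \frac{z^k}{\tau^2+(1-\tau^2)z}\,e^{y^2z/2}\,dz,\qquad m_\tau(y)=y^2\,\frac{I_{1/2}(y)-I_{3/2}(y)}{I_{-1/2}(y)}-\frac{I_{1/2}(y)}{I_{-1/2}(y)} .$$ The function $m_\tau(y)$ is bounded above uniformly in $y\in\mathbb R$ and $\tau\in(0,1]$; $C_u<\infty$ is a fixed constant with $m_\tau(y)\le C_u$ for all such $y,\tau$. *)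

(* Defs.v *)
From HB Require Import structures.
From mathcomp Require Import all_boot all_order all_algebra.
From mathcomp Require Import all_classical all_reals all_analysis.
Set Implicit Arguments.
Unset Strict Implicit.
Unset Printing Implicit Defensive.
Import Order.TTheory GRing.Theory Num.Theory.
Import numFieldNormedType.Exports.
Local Open Scope classical_set_scope.
Local Open Scope ring_scope.

(** R^n is represented by [n.-tuple R] with the library's product sigma-algebra.
    The library has binary product measures only; [tuple_measure m] is the
    product of the n measures [m i]. *)
Section tuple_measure.
Context d (T : measurableType d) (R : realType).

Definition tuple_cons n (xt : T * n.-tuple T) : n.+1.-tuple T :=
  [tuple of xt.1 :: xt.2].

Lemma measurable_tuple_cons n : measurable_fun setT (@tuple_cons n).
Proof. exact: measurable_cons. Qed.

Section cons_measure.
Context n (m1 : {sigma_finite_measure set T -> \bar R})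
  (m2 : {sigma_finite_measure set (n.-tuple T) -> \bar R}).

Definition cons_measure := pushforward (m1 \x m2)%E (@tuple_cons n).

Let mcons := @measurable_tuple_cons n.

Let cons_measure0 : cons_measure set0 = 0%E.
Proof. exact: measure0. Qed.

Let cons_measure_ge0 A : (0 <= cons_measure A)%E.
Proof. exact: measure_ge0. Qed.

Let cons_measure_sigma_additive : semi_sigma_additive cons_measure.
Proof. exact: measure_semi_sigma_additive. Qed.

HB.instance Definition _ := isMeasure.Build _ _ _ cons_measure
  cons_measure0 cons_measure_ge0 cons_measure_sigma_additive.

(* The library declares [m1 \x m2] sigma-finite, but canonical inference selects
   its later instance restricted to subprobabilities, so sigma-finiteness is
   established here from the factors. *)
Lemma cons_measure_sigma_finite : sigma_finite setT cons_measure.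
Proof.
have /sigma_finiteP[F [UF ndF Foo]] := sigma_finiteT m1.
have /sigma_finiteP[G [UG ndG Goo]] := sigma_finiteT m2.
pose uncons (t : n.+1.-tuple T) := (thead t, [tuple of behead t]).
have muncons : measurable_fun setT uncons.
  by apply: measurable_fun_pair; [exact: measurable_tnth|exact: measurable_behead].
have consK : cancel (@tuple_cons n) uncons.
  by move=> [x t]; rewrite /uncons theadE; congr pair; apply: val_inj.
exists (fun k => uncons @^-1` (F k `*` G k)).
  rewrite -preimage_bigcup (_ : \bigcup_k (F k `*` G k) = setT)//.
  rewrite -setXTT UF UG predeqE => -[x y]; split.
    by move=> [k _ []/= ? ?]; split; exists k.
  move=> [/= [k _ Fkx] [j _ Gjy]]; exists (maxn k j) => //; split.
  - by move: x Fkx; exact/subsetPset/ndF/leq_maxl.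
  - by move: y Gjy; exact/subsetPset/ndG/leq_maxr.
move=> k; have [mF Fk] := Foo k; have [mG Gk] := Goo k; split.
  by rewrite -[X in measurable X]setTI; apply: muncons => //; exact: measurableX.
rewrite /cons_measure /pushforward -comp_preimage.
rewrite (_ : uncons \o _ = id); last by apply/funext => x; exact: consK.
by rewrite product_measure1E// lte_mul_pinfty// ge0_fin_numE.
Qed.

HB.instance Definition _ :=
  Measure_isSigmaFinite.Build _ _ _ cons_measure cons_measure_sigma_finite.

End cons_measure.

Fixpoint tuple_measure n :
    ('I_n -> {sigma_finite_measure set T -> \bar R}) ->
    {sigma_finite_measure set (n.-tuple T) -> \bar R} :=
  match n with
  | 0 => fun _ => (\d_ [tuple])%R
  | n'.+1 => fun m =>
      cons_measure (m ord0) (tuple_measure (fun i => m (lift ord0 i)))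
  end.

Lemma tuple_measure_box n (m : 'I_n -> {sigma_finite_measure set T -> \bar R})
    (A : 'I_n -> set T) : (forall i, measurable (A i)) ->
  tuple_measure m [set t | forall i, A i (tnth t i)] =
  (\big[mule/1]_(i < n) m i (A i))%E.
Proof.
elim: n m A => [|n IH] m A mA.
  rewrite big_ord0/= diracE mem_set//=; by case.
rewrite big_ord_recl/= /cons_measure /pushforward.
have mB : measurable [set t : n.-tuple T | forall i, A (lift ord0 i) (tnth t i)].
  rewrite (_ : mkset _ = \bigcap_(i in [set: 'I_n])
      ((fun t : n.-tuple T => tnth t i) @^-1` A (lift ord0 i))).
    apply: fin_bigcap_measurable => // i _.
    by rewrite -[X in measurable X]setTI; exact: measurable_tnth.
  by apply/seteqP; split => t /= H i; [move=> _|]; exact: H.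
rewrite -IH// -product_measure1E//; congr (_ _).
apply/seteqP; split => -[x t] /=.
  move=> H; split; first by have := H ord0.
  by move=> i; have := H (lift ord0 i); rewrite tnthS.
move=> [Ax At] i; by case: (unliftP ord0 i) => [j|] ->; rewrite ?tnthS.
Qed.

End tuple_measure.

Section horseshoe.
Context {R : realType}.
Local Notation mu := (@lebesgue_measure R).
(* [measurableTypeR R] is [R] with the Borel sigma-algebra, on which
   [lebesgue_measure] and [normal_prob] are defined. *)
Local Notation Rn n := (n.-tuple (measurableTypeR R)).
Local Notation coord theta i := (tnth theta i : R).

Definition lebesgue_tuple n : {sigma_finite_measure set (Rn n) -> \bar R} :=
  tuple_measure (fun _ : 'I_n => mu : {sigma_finite_measure set _ -> \bar R}).

Definition data_law n (theta : Rn n) :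
    {sigma_finite_measure set (Rn n) -> \bar R} :=
  tuple_measure (fun i => normal_prob (coord theta i) 1
    : {sigma_finite_measure set _ -> \bar R}).

Definition ell0 n (p : nat) : set (Rn n) :=
  [set theta | (#|[set i | coord theta i != 0%R]| <= p)%N].

Definition l2dist n (s t : Rn n) : R :=
  Num.sqrt (\sum_(i < n) (coord s i - coord t i) ^+ 2).

Definition tau_seq (n p : nat) : R :=
  (p%:R / n%:R) * Num.sqrt (ln (n%:R / p%:R)).

(** Extended-real-valued because the horseshoe density is [+oo] at [0]. *)
Definition horseshoe_pdf (tau theta : R) : \bar R :=
  (\int[mu]_(l in `]0%R, +oo[)
     (normal_pdf 0 1 (theta / (l * tau)) * (l * tau)^-1
      * (2 / (pi * (1 + l ^+ 2))))%:E)%E.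

(** Joint mass of [theta \in A] and of the observation [y], i.e. the integral
    over [tau] and [theta \in A] of (density of tau) x (prior density of theta
    given tau) x (likelihood). *)
Definition joint_mass n (prior : R -> R) (y : Rn n)
    (A : set (Rn n)) : \bar R :=
  (\int[mu]_tau ((prior tau)%:E *
     \int[lebesgue_tuple n]_(theta in A)
       (\big[mule/1]_(i < n) horseshoe_pdf tau (coord theta i) *
        (\prod_(i < n) normal_pdf (coord theta i) 1 (coord y i))%R%:E)))%E.

Definition posterior n (prior : R -> R) (y : Rn n)
    (A : set (Rn n)) : R :=
  fine (joint_mass prior y A) / fine (joint_mass prior y setT).

Definition max_risk n (p : nat) (prior : R -> R) (r : R) : \bar R :=
  ereal_sup [set (\int[data_law theta0]_y
      (posterior prior y [set theta | (r <= l2dist theta theta0)%R])%:E)%E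
    | theta0 in @ell0 n p].

Definition prob_density_on (a b : R) (f : R -> R) : Prop :=
  [/\ measurable_fun setT f, forall x, 0 <= f x,
      forall x, x \notin `[a, b] -> f x = 0
    & (\int[mu]_x (f x)%:E = 1)%E].

Definition I_int (tau k y : R) : R :=
  (\int[mu]_(z in `[0, 1])
    (z `^ k / (tau ^+ 2 + (1 - tau ^+ 2) * z) * expR (y ^+ 2 * z / 2)))%R.

Definition m_fun (tau y : R) : R :=
  y ^+ 2 * ((I_int tau (1 / 2) y - I_int tau (3 / 2) y)
            / I_int tau (- (1 / 2)) y)
  - I_int tau (1 / 2) y / I_int tau (- (1 / 2)) y.

Definition t_seq (Cu : R) (n p : nat) : R := Cu * pi `^ (3 / 2) * tau_seq n p.

End horseshoe.

(* Main.v *)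
(** Let [psi t] be the marginal density of one observation given [tau = t], and
    let [t_n / 2 <= t <= t_n]. Then [psi t] is so close to the standard normal
    density [phi] that [E_0 (phi / psi t) <= 1 + O(p / n)]; hence the integrated
    likelihood ratio of the null coordinates over the prior mass [nu] of
    [[t_n / 2, t_n]] is at least [nu exp (- O(p))] with high probability.
    On the other hand [psi t] puts mass of order [t / z] beyond
    [z = 3 sqrt (log (n / p))], where the null observations have almost none.
    Counting the exceedances therefore gives a test which shows that [tau > T]
    has negligible posterior probability as soon as [T] is a large multiple of
    [(1 + B) t_n] and [nu >= K exp (- B p)]. The at most [p] nonzero coordinates
    only cost factors [(t / t_n) ^ p], because [psi] is Lipschitz in [log t].
    Given [tau = t <= T], the posterior second moment of [theta_i - theta0_i] is
    [O(log n) + 2 (Y_i - theta0_i)^2] in general, and [O(T exp (Y_i^2 / 2))] for a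
    null coordinate with [|Y_i| <= 3 sqrt (log n)]. By Markov's inequality the risk
    at radius [r] is [O((1 + B) p log n / r^2) + o(1)]; part (a) is the case of a
    constant [B], part (b) that of [B = log n]. That [t_n] is positive comes from
    [C_u >= m_1 (sqrt 6) > 0]. *)

Require Import Defs.
From mathcomp Require Import all_boot all_order all_algebra.
From mathcomp Require Import all_classical all_reals all_analysis.
From mathcomp Require Import measurable_realfun ring lra.
Set Implicit Arguments.
Unset Strict Implicit.
Unset Printing Implicit Defensive.
Import Order.TTheory GRing.Theory Num.Theory.
Import numFieldNormedType.Exports.
Import HBNNSimple.
Local Open Scope classical_set_scope.
Local Open Scope ring_scope.

(** * Integration *)

(** The posterior of tau is never localized: above, a cutoff T suffices, and below, the support
    [1/n, 1] already gives log(1/tau) <= log n. Numerator and evidence are compared with one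
    reference density, [phi] at the null coordinates and [psi] at scale t_n / 2 at the others. It
    cancels, so the sizes of the nonzero means never enter. Under the null, psi / phi has mean 1 but
    infinite second moment, since the tails of [psi] are polynomial. The evidence is therefore
    controlled through phi / psi, which is bounded. To expand its mean to second order, the prior is
    truncated at a small multiple b of sqrt(log(n/p)). The mass lost is of order t_n / b, that is p
    / n: the square root in t_n is exactly what b can compensate. The truncated part costs exp(8
    b^2), which a small multiple keeps below sqrt(n/p). The test acts not through an indicator but
    through the weight exp(- number of exceedances), whose mean factorizes over the coordinates. In
    part (b), t_n >= 1/n >= exp(- p log n) for large n, whence B = log n. *)

Section integral_tools.
Context d (T : measurableType d) (R : realType).
Variable m : {measure set T -> \bar R}.
Local Open Scope ereal_scope.

(* Unlike [ge0_le_integral] this needs no measurability. *)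
Lemma le_integral_ge0 (D : set T) (f g : T -> \bar R) :
  (forall x, D x -> 0 <= f x) -> (forall x, D x -> f x <= g x) ->
  \int[m]_(x in D) f x <= \int[m]_(x in D) g x.
Proof.
move=> f0 fg; have g0 x : D x -> 0 <= g x.
  by move=> Dx; apply: le_trans (fg _ Dx); exact: f0.
rewrite !ge0_integralE//; apply: le_ereal_sup => _ [h hf <-]; exists h => // x.
by apply: le_trans (hf x) _; exact: lee_restrict.
Qed.

(** Holds by hypothesis for indicators, and passes by simple functions and monotone convergence to
    every nonnegative measurable [f], integrable or not. It turns integrals against [normal_prob]
    into Lebesgue integrals. *)
Lemma integral_density (nu : {measure set T -> \bar R}) (p : T -> R) :
  measurable_fun setT p -> (forall x, (0 <= p x)%R) ->
  (forall A, measurable A -> nu A = \int[m]_(x in A) (p x)%:E) ->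
  forall f : T -> \bar R, measurable_fun setT f -> (forall x, 0 <= f x) ->
  \int[nu]_x f x = \int[m]_x (f x * (p x)%:E).
Proof.
move=> mp p0 nuE f mf f0; pose f_ := nnsfun_approx measurableT mf.
have ndf x : nondecreasing_seq (fun n => (f_ n x)%:E).
  by move=> i j ij; rewrite lee_fin; exact/lefP/nd_nnsfun_approx.
have fE x : f x = limn (fun n => (f_ n x)%:E).
  by apply/esym/cvg_lim => //; exact: cvg_nnsfun_approx.
transitivity (limn (fun n => \int[nu]_x (f_ n x)%:E)).
  rewrite -monotone_convergence//=.
  - by apply: eq_integral => x _.
  - by move=> n; exact/measurable_EFinP.
  - by move=> n ? _; rewrite lee_fin.
transitivity (limn (fun n => \int[m]_x ((f_ n x)%:E * (p x)%:E))); last first.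
  rewrite -monotone_convergence//=.
  - apply: eq_integral => x _; rewrite fE muleC -limeMl//; last first.
      exact: ereal_nondecreasing_is_cvgn.
    by apply: congr_lim; apply/funext => n; rewrite muleC.
  - by move=> n; apply: emeasurable_funM; exact/measurable_EFinP.
  - by move=> n ? _; rewrite mule_ge0// lee_fin.
  - by move=> x _ i j ij; rewrite lee_wpmul2r ?lee_fin//; exact: ndf.
apply: congr_lim; apply/funext => n.
transitivity (\int[nu]_x (\sum_(r \in range (f_ n))
    r%:E * (\1_(f_ n @^-1` [set r]) x)%:E)).
  by apply: eq_integral => x _; rewrite fimfunE -fsumEFin//.
transitivity (\int[m]_x (\sum_(r \in range (f_ n))
    r%:E * ((\1_(f_ n @^-1` [set r]) x)%:E * (p x)%:E))); last first.
  apply: eq_integral => x _; rewrite fimfunE -fsumEFin// ge0_mule_fsuml.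
    by apply: eq_fsbigr => r _; rewrite muleA.
  by move=> r; exact: nnfun_muleindic_ge0.
rewrite !ge0_integral_fsum//; last 4 first.
- move=> r; apply: emeasurable_funM => //.
  apply: emeasurable_funM; apply/measurable_EFinP => //.
- move=> r x _; rewrite muleA; apply: mule_ge0; last by rewrite lee_fin.
  exact: nnfun_muleindic_ge0.
- by move=> r; apply/measurable_EFinP/measurableT_comp.
- by move=> r x _; exact: nnfun_muleindic_ge0.
apply: eq_fsbigr => r _.
rewrite integralZl_indic_nnsfun// integral_indic//= setIT.
(* A nonnegative simple function has empty level sets at negative values; for the others the sign
   allows taking [r] out of the integral. *)
have [r0|r0] := ltP r 0%R.
  rewrite preimage_nnfun0// nuE// integral_set0 mule0.
  by rewrite integral0_eq// => x _; rewrite indic0 mul0e mule0.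
rewrite ge0_integralZl//; last 2 first.
- by apply: emeasurable_funM; apply/measurable_EFinP.
- by move=> x _; rewrite mule_ge0// lee_fin.
congr (_ * _); rewrite nuE// integral_mkcond; apply: eq_integral => x _.
rewrite patchE indicE; case: ifPn => xr; last by rewrite mul0e.
by rewrite mul1e.
Qed.

End integral_tools.

Section lebesgue_tools.
Context {R : realType}.
Local Notation mu := (@lebesgue_measure R).
Local Open Scope ereal_scope.

(** By uniqueness of Lebesgue measure: [c] times the pushforward under multiplication by [c] has the
    right value on half-open intervals. *)
Lemma lebesgue_measure_scale (c : R) (A : set R) : (0 < c)%R -> measurable A ->
  pushforward mu ( *%R c : _ -> measurableTypeR R) A = (c^-1)%:E * mu A.
Proof.
move=> c0 mA; have c0' : (0 <= c)%R by exact: ltW.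
pose nu := mscale (NngNum c0') (pushforward mu ( *%R c : _ -> measurableTypeR R)).
have mc : measurable_fun setT ( *%R c : measurableTypeR R -> measurableTypeR R).
  exact: measurable_funM.
have muE : mu A = nu mc A.
  apply: lebesgue_measure_unique => //= _ [[a b]] _ <-.
  rewrite /nu /mscale /= /pushforward.
  have -> : ( *%R c) @^-1` `]a, b] = `](a / c)%R, (b / c)%R]%classic.
    apply/seteqP; split => x /=; rewrite !in_itv/= ltr_pdivrMr// ler_pdivlMr//;
    by rewrite mulrC.
  rewrite !lebesgue_measure_itv/= !lte_fin ltr_pM2r ?invr_gt0//.
  case: ifPn => _; last by rewrite mule0.
  by rewrite -!EFinD -EFinM; congr EFin; field; rewrite gt_eqF.
by rewrite muE /nu /mscale /= muleA -EFinM mulVf ?mul1e// gt_eqF.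
Qed.

Lemma ge0_integral_scale (c : R) (D : set R) (f : R -> \bar R) : (0 < c)%R ->
  measurable D -> measurable_fun setT f -> (forall x, 0 <= f x) ->
  \int[mu]_(x in ( *%R c) @^-1` D) f (c * x)%R =
    (c^-1)%:E * \int[mu]_(x in D) f x.
Proof.
move=> c0 mD mf f0; have c0' : (0 <= c^-1)%R by rewrite invr_ge0 ltW.
have mfD : measurable_fun D f by exact: measurable_funTS.
rewrite -(@ge0_integral_pushforward _ _ (measurableTypeR R) (measurableTypeR R)
  R ( *%R c : _ -> measurableTypeR R))//.
rewrite -(ge0_integral_mscale mu mD (NngNum c0'))//.
by apply: eq_measure_integral => /= A mA AD; exact: lebesgue_measure_scale.
Qed.

End lebesgue_tools.

(** * Integrals of product functions over product measures *)

Section tuple_integral.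
Context d (T : measurableType d) (R : realType).
Local Open Scope ereal_scope.

Lemma measurable_prod_tnth n (h : 'I_n -> T -> \bar R) :
  (forall i, measurable_fun setT (h i)) ->
  measurable_fun setT (fun t : n.-tuple T => \big[mule/1]_(i < n) h i (tnth t i)).
Proof.
move=> mh; elim: (index_enum _) => [|i s IH].
  under eq_fun do rewrite big_nil; exact: measurable_cst.
under eq_fun do rewrite big_cons.
apply: emeasurable_funM => //; apply: measurableT_comp => //.
exact: measurable_tnth.
Qed.

Lemma prode_ge0 (I : Type) (s : seq I) (h : I -> \bar R) :
  (forall i, 0 <= h i) -> 0 <= \big[mule/1]_(i <- s) h i.
Proof. by move=> h0; elim/big_rec : _ => // i x _ x0; exact: mule_ge0. Qed.

(** Tonelli, by induction along the recursive construction of [tuple_measure], which adds the first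
    coordinate last. *)
Lemma integral_tuple_prod n
    (m : 'I_n -> {sigma_finite_measure set T -> \bar R}) (h : 'I_n -> T -> \bar R) :
  (forall i, measurable_fun setT (h i)) -> (forall i x, 0 <= h i x) ->
  \int[tuple_measure m]_t \big[mule/1]_(i < n) h i (tnth t i) =
  \big[mule/1]_(i < n) \int[m i]_x h i x.
Proof.
elim: n m h => [|n IH] m h mh h0.
  rewrite big_ord0 /= integral_dirac//; last exact: measurable_prod_tnth.
  by rewrite diracT mul1e big_ord0.
rewrite /= /cons_measure ge0_integral_pushforward//=; last 3 first.
- exact: measurable_tuple_cons.
- exact: measurable_prod_tnth.
- by move=> t _; exact: prode_ge0.
rewrite preimage_setT.
set F := (X in \int[_]_x X x).
have FE x t : F (x, t) =
    h ord0 x * \big[mule/1]_(i < n) h (lift ord0 i) (tnth t i).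
  rewrite /F /= big_ord_recl/=; congr (_ * _); apply: eq_bigr => i _.
  by rewrite tnthS.
have mF : measurable_fun setT F.
  exact: measurableT_comp (measurable_prod_tnth mh) (@measurable_tuple_cons _ T n).
rewrite fubini_tonelli1//; last by move=> x; exact: prode_ge0.
rewrite /fubini_F.
transitivity (\int[m ord0]_x (h ord0 x *
    \big[mule/1]_(i < n) \int[m (lift ord0 i)]_x h (lift ord0 i) x)).
  apply: eq_integral => x _; rewrite -IH//.
  rewrite (eq_integral (fun t => h ord0 x *
    \big[mule/1]_(i < n) h (lift ord0 i) (tnth t i))); last by move=> t _; exact: FE.
  rewrite ge0_integralZl//.
    exact: (measurable_prod_tnth (fun i => mh (lift ord0 i))).
  by move=> t _; exact: prode_ge0.
rewrite ge0_integralZr//; last first.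
  by apply: prode_ge0 => i; exact: integral_ge0.
by rewrite big_ord_recl.
Qed.

Lemma integral_tuple_coord n
    (m : 'I_n -> {sigma_finite_measure set T -> \bar R}) (i : 'I_n) (h : T -> \bar R) :
  (forall j, m j setT = 1) -> measurable_fun setT h -> (forall x, 0 <= h x) ->
  \int[tuple_measure m]_t h (tnth t i) = \int[m i]_x h x.
Proof.
move=> m1 mh h0; pose h' j := if j == i then h else cst 1.
transitivity (\int[tuple_measure m]_t \big[mule/1]_(j < n) h' j (tnth t j)).
  apply: eq_integral => t _; rewrite (bigD1 i)//= /h' eqxx big1 ?mule1// => j ji.
  by rewrite (negbTE ji).
rewrite integral_tuple_prod; last 2 first.
- by rewrite /h' => j; case: ifPn.
- by rewrite /h' => j x; case: ifPn => //= _; rewrite lee01.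
rewrite (bigD1 i)//= {1}/h' eqxx big1 ?mule1// => j ji.
rewrite /h' (negbTE ji) integral_cst//= mul1e.
exact: m1.
Qed.

End tuple_integral.

Section real_integral_tools.
Context {R : realType}.
Local Notation mu := (@lebesgue_measure R).
Lemma integral_lower (F : R -> R) (a b c : R) : measurable_fun setT F ->
  (forall x, 0 <= F x) -> 0 <= c -> a < b -> (forall x, a <= x <= b -> c <= F x) ->
  ((c * (b - a))%:E <= \int[mu]_x (F x)%:E)%E.
Proof.
move=> mF F0 c0 ab H.
apply: (@le_trans _ _ (\int[mu]_(x in `[a, b]) (F x)%:E)%E).
  apply: (@le_trans _ _ (\int[mu]_(x in `[a, b]) c%:E)%E).
    by rewrite integral_cst//= lebesgue_measure_itv/= lte_fin ab -EFinB -EFinM lee_fin.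
  apply: le_integral_ge0 => x /=; first by rewrite lee_fin.
  by rewrite in_itv/= lee_fin => /H.
apply: ge0_subset_integral => //; first exact/measurable_EFinP.
by move=> x _; rewrite lee_fin.
Qed.

Local Open Scope ereal_scope.

Lemma integral_sqr_inv (b : R) : (0 < b)%R ->
  \int[mu]_(x in `[b, +oo[) (x ^- 2)%:E = (b^-1)%:E.
Proof.
move=> b0.
have dF (x : R) : (0 < x)%R -> is_derive x 1%R (fun x : R => - x^-1)%R (x ^- 2)%R.
  move=> x0; have xn0 : x != 0%R by rewrite gt_eqF.
  rewrite -[(x ^- 2)%R]mulr1 -[(x ^- 2 * 1)%R]opprK -mulNr.
  exact: is_deriveN (is_deriveV xn0 (is_derive_id x 1%R)).
have F0 (x : R) : (0 < x)%R -> {for x, continuous (fun x : R => - x^-1)%R}.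
  move=> x0; apply: cvgN; apply: cvgV; last exact: cvg_id.
  by rewrite gt_eqF.
have cf (x : R) : (0 < x)%R -> {for x, continuous (fun x : R => x ^- 2)%R}.
  move=> x0; apply: cvgV; first by rewrite expf_neq0// gt_eqF.
  exact: exprn_continuous.
rewrite (@ge0_continuous_FTC2y _ _ (fun x => - x^-1)%R _ 0%R).
- by rewrite EFinN oppeK add0e.
- by move=> x bx; rewrite invr_ge0 sqr_ge0.
- apply/continuous_within_itvcyP; split => [x|].
    by rewrite in_itv/= andbT => bx; apply: cf; exact: lt_trans bx.
  by apply: cvg_at_right_filter; exact: cf.
- rewrite -oppr0; apply: cvgN; apply/gtr0_cvgV0; last exact: cvg_id.
  exact: nbhs_pinfty_gt.
- by move=> x bx; have := dF x (lt_trans b0 bx) => -[].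
- by apply: cvg_at_right_filter; exact: F0.
- move=> x; rewrite in_itv/= andbT => bx; rewrite derive1E.
  by have := dF x (lt_trans b0 bx) => -[].
Qed.

End real_integral_tools.

(** * Gaussian estimates *)

Section measurability.
Context d (T : measurableType d) (R : realType).
Implicit Types f : T -> R.

Lemma measurable_fun_inv f : measurable_fun setT f ->
  measurable_fun setT (fun x => (f x)^-1).
Proof.
move=> mf.
(* Real powers are measurable, and inversion is reduced to them by 1/x = x (1/|x|)^2, where both
   sides are 0 at x = 0. *)
rewrite (_ : (fun x => _) = (fun x => f x * (`|f x| `^ (- 1)) ^+ 2)); last first.
  apply/funext => x; have [->|fx] := eqVneq (f x) 0; first by rewrite invr0 mul0r.
  rewrite powR_inv1// exprVn -normrX ger0_norm ?sqr_ge0//.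
  by rewrite expr2 invfM mulrA divff// mul1r.
apply: measurable_funM => //; apply: measurable_funX.
apply: (measurableT_comp (measurable_powR (- 1 : R))).
exact: measurableT_comp.
Qed.

Lemma measurable_fun_expR f : measurable_fun setT f ->
  measurable_fun setT (fun x => expR (f x)).
Proof. by move=> mf; exact: measurableT_comp. Qed.

Lemma measurable_fun_norm f : measurable_fun setT f ->
  measurable_fun setT (fun x => `|f x|).
Proof. by move=> mf; exact: measurableT_comp. Qed.

Lemma measurable_fun_opp f : measurable_fun setT f ->
  measurable_fun setT (fun x => - f x).
Proof. by move=> mf; exact: measurableT_comp. Qed.

Lemma measurable_fun_ind f (i : interval R) : measurable_fun setT f ->
  measurable_fun setT (fun x => \1_[set` i] (f x) : R).
Proof.
by move=> mf; apply: (measurableT_comp (f := (\1_[set` i] : R -> R))).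
Qed.

End measurability.

Lemma measurable_invr (R : realType) : measurable_fun setT (@GRing.inv R).
Proof. exact: (measurable_fun_inv (@measurable_id _ R setT)). Qed.

Section gaussian.
Context {R : realType}.
Local Notation mu := (@lebesgue_measure R).

Definition phi0 : R := normal_peak 1.
(* Locked so that [mulr_ge0] and the like do not unfold it. *)
Definition phi : R -> R := locked (fun u => phi0 * expR (- (u ^+ 2) / 2)).

Lemma phiE u : phi u = phi0 * expR (- (u ^+ 2) / 2).
Proof. by rewrite /phi -lock. Qed.

Lemma phi0_gt0 : 0 < phi0. Proof. exact: normal_peak_gt0. Qed.

Lemma phi0_le1 : phi0 <= 1.
Proof.
have pi2 := pi_ge2 R; rewrite /phi0 /normal_peak expr1n mul1r.
rewrite invf_le1; last by rewrite sqrtr_gt0 -mulr_natr; lra.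
by rewrite -[leLHS]sqrtr1 ler_sqrt -mulr_natr; lra.
Qed.

Lemma normal_pdf_phi m x : normal_pdf m 1 x = phi (x - m).
Proof.
by rewrite normal_pdfE ?oner_eq0// /normal_fun phiE expr1n.
Qed.

Lemma phi_gt0 u : 0 < phi u.
Proof. by rewrite phiE mulr_gt0 ?phi0_gt0 ?expR_gt0. Qed.

Lemma phi_ge0 u : 0 <= phi u. Proof. exact/ltW/phi_gt0. Qed.

Lemma phi_even u : phi (- u) = phi u.
Proof. by rewrite !phiE sqrrN. Qed.

Lemma phi_le u v : `|v| <= `|u| -> phi u <= phi v.
Proof.
move=> uv; rewrite !phiE ler_wpM2l ?(ltW phi0_gt0)// ler_expR ler_pM2r//.
by rewrite lerN2 -(real_normK (num_real v)) -(real_normK (num_real u)) lerXn2r.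
Qed.

Lemma phi_le_phi0 u : phi u <= phi0.
Proof.
rewrite phiE ler_piMr ?(ltW phi0_gt0)// -expR0 ler_expR.
by rewrite mulNr oppr_le0 mulr_ge0 ?sqr_ge0.
Qed.

Lemma measurable_phi : measurable_fun setT phi.
Proof.
rewrite /phi -lock; apply: measurable_funM => //; apply: measurable_fun_expR.
by apply: measurable_funM => //; apply: measurable_fun_opp; exact: measurable_funX.
Qed.

Lemma integral_phi m : (\int[mu]_x (phi (x - m))%:E = 1)%E.
Proof.
by rewrite -(integral_normal_pdf m 1); under [RHS]eq_integral do rewrite normal_pdf_phi.
Qed.

Lemma phi_mgf a x : phi x * expR (a * x) = expR (a ^+ 2 / 2) * phi (x - a).
Proof.
by rewrite !phiE mulrCA -!mulrA -!expRD; congr (_ * expR _); field.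
Qed.

(** The exponential is the likelihood ratio of mean [t] against mean 0; the comparisons of [psi]
    with [phi] go through it. *)
Lemma phi_tilt t x : phi x * expR (t * x - t ^+ 2 / 2) = phi (x - t).
Proof.
by rewrite expRD mulrA phi_mgf mulrAC -expRD subrr expR0 mul1r.
Qed.

(** The integral of exp(- x^2 / 8), equal to sqrt(8 pi). This weight is what remains of a Gaussian
    density once the rest of its exponent has absorbed polynomial and tail factors. *)
Definition gauss8 : R := (normal_peak 2)^-1.

Lemma gauss8_gt0 : 0 < gauss8.
Proof. by rewrite invr_gt0 normal_peak_gt0. Qed.

Lemma integral_gauss8 m :
  (\int[mu]_x (expR (- ((x - m) ^+ 2) / 8))%:E = gauss8%:E)%E.
Proof.
rewrite -[RHS]mule1 -(integral_normal_pdf m 2) -ge0_integralZl//.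
- apply: eq_integral => x _; rewrite -EFinM; congr EFin.
  rewrite normal_pdfE//= mulrA mulVf ?gt_eqF ?normal_peak_gt0// mul1r.
  by rewrite /normal_fun (_ : 2 ^+ 2 *+ 2 = 8 :> R)// -mulr_natr; lra.
- by apply/measurable_EFinP; exact: measurable_normal_pdf.
- by move=> x _; rewrite lee_fin normal_pdf_ge0.
- by rewrite lee_fin ltW// gauss8_gt0.
Qed.

End gaussian.

(* Dispatching on the head symbol avoids costly failing unifications. *)
Ltac meas := lazymatch goal with
  | |- measurable_fun _ (fun x => @GRing.mul _ (@?f x) (@?g x)) =>
      apply: measurable_funM; meas
  | |- measurable_fun _ (fun x => @GRing.inv _ (@?f x)) =>
      apply: measurable_fun_inv; meas
  | |- measurable_fun _ (fun x => @GRing.exp _ (@?f x) _) =>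
      apply: measurable_funX; meas
  | |- measurable_fun _ (fun x => @GRing.opp _ (@?f x)) =>
      apply: measurable_fun_opp; meas
  | |- measurable_fun _ (fun x => @GRing.add _ (@?f x) (@?g x)) =>
      apply: measurable_funD; meas
  | |- measurable_fun _ (fun x => @expR _ (@?f x)) =>
      apply: measurable_fun_expR; meas
  | |- measurable_fun _ (fun x => phi (@?f x)) =>
      apply: (measurableT_comp measurable_phi); meas
  | |- measurable_fun _ (fun x => @Num.norm _ _ (@?f x)) =>
      apply: measurable_fun_norm; meas
  | |- measurable_fun _ (fun x => @indic _ _ _ (@?f x)) =>
      apply: measurable_fun_ind; meas
  | |- measurable_fun _ (fun x => x) => exact: measurable_id
  | |- measurable_fun _ (fun x => fst x) => exact: measurable_fst
  | |- measurable_fun _ (fun x => snd x) => exact: measurable_snd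
  | |- measurable_fun _ (fun x => fst (@?f x)) =>
      apply: (measurableT_comp measurable_fst); meas
  | |- measurable_fun _ (fun x => snd (@?f x)) =>
      apply: (measurableT_comp measurable_snd); meas
  | |- _ => first [ assumption | exact: measurable_cst | exact: measurable_id
      | exact: measurable_fst | exact: measurable_snd
      | exact: measurable_invr | exact: measurable_expR
      | exact: measurable_indic | exact: normr_measurable
      | exact: mulrl_measurable | exact: measurable_phi
      | exact: (measurable_funD (measurable_cst _) (@measurable_id _ _ _)) | idtac ]
  end.

(** * The horseshoe prior and its one-dimensional marginal *)

Section horseshoe_density.
Context {R : realType}.
Local Notation mu := (@lebesgue_measure R).

Lemma integral_restrict_ind (D : interval R) (f : R -> R) :
  (\int[mu]_(x in [set` D]) (f x)%:E = \int[mu]_x (\1_[set` D] x * f x)%:E)%E.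
Proof.
rewrite integral_mkcond; apply: eq_integral => x _.
by rewrite patchE indicE; case: ifPn => _; rewrite ?mul1r ?mul0r.
Qed.

Let hsk (t th l : R) : R := phi (th / (l * t)) * (l * t)^-1 * (2 / (pi * (1 + l ^+ 2))).

Lemma horseshoe_pdf_setT (t th : R) :
  horseshoe_pdf t th = (\int[mu]_l (\1_`]0, +oo[ l * hsk t th l)%:E)%E.
Proof.
rewrite /horseshoe_pdf -integral_restrict_ind; apply: eq_integral => l _.
by rewrite normal_pdf_phi subr0.
Qed.

Let hsk_ge0 (t th l : R) : 0 <= t -> 0 <= \1_`]0, +oo[ l * hsk t th l.
Proof.
move=> t0; rewrite indicE; case: (boolP (l \in _)); last by rewrite mul0r.
rewrite inE/= in_itv/= andbT mul1r => l0.
rewrite /hsk !mulr_ge0 ?phi_ge0 ?invr_ge0 ?mulr_ge0 ?pi_ge0 ?(ltW l0)//.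
by rewrite addr_ge0// sqr_ge0.
Qed.

Lemma horseshoe_pdf_ge0 (t th : R) : 0 <= t -> (0 <= horseshoe_pdf t th)%E.
Proof.
by move=> t0; rewrite horseshoe_pdf_setT integral_ge0// => l _; rewrite lee_fin hsk_ge0.
Qed.

Lemma horseshoe_pdf_even (t th : R) : horseshoe_pdf t (- th) = horseshoe_pdf t th.
Proof.
rewrite !horseshoe_pdf_setT; apply: eq_integral => l _.
by rewrite /hsk mulNr phi_even.
Qed.

(** The absolute value makes the integrand nonnegative for every real scale, so that Tonelli applies
    on the whole plane. *)
Lemma measurable_horseshoe_pdf2 :
  measurable_fun setT (fun x : R * R => horseshoe_pdf `|x.1| x.2).
Proof.
pose f (z : (R * R) * R) : \bar R :=
  (\1_`]0, +oo[ z.2 * hsk `|z.1.1| z.1.2 z.2)%:E.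
have mf : measurable_fun setT f.
  apply/measurable_EFinP; rewrite /hsk; meas.
have f0 z : (0 <= f z)%E by rewrite lee_fin hsk_ge0.
rewrite (_ : (fun x => _) = fubini_F mu f).
  exact: measurable_fun_fubini_tonelli_F.
by apply/funext => z; rewrite horseshoe_pdf_setT.
Qed.

(** Substituting s = t l moves all the dependence on [t] into the half-Cauchy density (2 / pi) t /
    (t^2 + s^2). Different values of [t] can then be compared pointwise in [s]. *)
Lemma horseshoe_pdf_scale (t th : R) : 0 < t ->
  horseshoe_pdf t th = (\int[mu]_(s in `]0%R, +oo[)
    (phi (th / s) * s^-1 * (2 / pi) * (t / (t ^+ 2 + s ^+ 2)))%:E)%E.
Proof.
move=> t0; pose f (s : R) : \bar R :=
  (\1_`]0, +oo[ s * (phi (th / s) * s^-1 * (2 / pi) * (t / (t ^+ 2 + s ^+ 2))))%:E.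
have f0 s : (0 <= f s)%E.
  rewrite /f lee_fin indicE; case: (boolP (s \in _)); last by rewrite mul0r.
  rewrite inE/= in_itv/= andbT mul1r => s0.
  rewrite !mulr_ge0 ?phi_ge0 ?invr_ge0 ?pi_ge0 ?(ltW s0) ?(ltW t0)//.
  by rewrite addr_ge0// sqr_ge0.
have mf : measurable_fun setT f.
  by apply/measurable_EFinP; meas.
rewrite integral_restrict_ind.
transitivity (t%:E * ((t^-1)%:E * \int[mu]_(s in setT) f s))%E; last first.
  by rewrite muleA -EFinM mulfV ?mul1e// gt_eqF.
rewrite -ge0_integral_scale// preimage_setT -ge0_integralZl//; last 2 first.
- by apply: (measurableT_comp mf); meas.
- by rewrite lee_fin ltW.
rewrite horseshoe_pdf_setT; apply: eq_integral => l _.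
rewrite /f -EFinM; congr EFin.
rewrite !indicE !mem_setE !in_itv/= !andbT pmulr_rgt0//.
have [l0|_] := ltP 0 l; last by rewrite !mul0r mulr0.
rewrite !mul1r /hsk (mulrC l t).
have l20 : 0 < 1 + l ^+ 2 by rewrite ltr_pwDl ?sqr_ge0.
have tl0 : 0 < t ^+ 2 + (t * l) ^+ 2 by rewrite addr_gt0 ?exprn_gt0 ?mulr_gt0.
rewrite (_ : t ^+ 2 + (t * l) ^+ 2 = t ^+ 2 * (1 + l ^+ 2)) in tl0 *; last by ring.
by move: (@pi R) (pi_gt0 R) => P P0; field; rewrite !gt_eqF.
Qed.

(** Divided by [t], the factor t / (t^2 + s^2) decreases in [t]. *)
Lemma horseshoe_pdf_ratio_ub (t' t th : R) : 0 < t' -> t' <= t ->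
  (horseshoe_pdf t th <= (t / t')%:E * horseshoe_pdf t' th)%E.
Proof.
move=> t'0 tt'; have t0 : 0 < t by exact: lt_le_trans tt'.
rewrite !horseshoe_pdf_scale// -ge0_integralZl//; last 3 first.
- by apply: measurable_funTS; apply/measurable_EFinP; meas.
- move=> s; rewrite /= in_itv/= andbT => s0; rewrite lee_fin.
  by rewrite !mulr_ge0 ?phi_ge0 ?invr_ge0 ?pi_ge0 ?(ltW s0) ?(ltW t'0)// addr_ge0// sqr_ge0.
- by rewrite lee_fin divr_ge0// ltW.
apply: le_integral_ge0 => s; rewrite /= in_itv/= andbT => s0.
  rewrite lee_fin.
  by rewrite !mulr_ge0 ?phi_ge0 ?invr_ge0 ?pi_ge0 ?(ltW s0) ?(ltW t0)// addr_ge0// sqr_ge0.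
rewrite -EFinM lee_fin [leRHS]mulrCA ler_wpM2l//.
  by rewrite !mulr_ge0 ?phi_ge0 ?invr_ge0 ?pi_ge0 ?(ltW s0).
have p1 : 0 < t ^+ 2 + s ^+ 2 by rewrite addr_gt0 ?exprn_gt0.
have p2 : 0 < t' ^+ 2 + s ^+ 2 by rewrite addr_gt0 ?exprn_gt0.
rewrite -mulrA ler_wpM2l ?(ltW t0)// mulKf ?gt_eqF//.
by rewrite lef_pV2 ?posrE// lerD2r lerXn2r ?nnegrE// ltW.
Qed.

(** Multiplied by [t], the factor t / (t^2 + s^2) increases in [t]. *)
Lemma horseshoe_pdf_ratio_lb (t' t th : R) : 0 < t' -> t' <= t ->
  ((t' / t)%:E * horseshoe_pdf t' th <= horseshoe_pdf t th)%E.
Proof.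
move=> t'0 tt'; have t0 : 0 < t by exact: lt_le_trans tt'.
rewrite !horseshoe_pdf_scale// -ge0_integralZl//; last 3 first.
- by apply: measurable_funTS; apply/measurable_EFinP; meas.
- move=> s; rewrite /= in_itv/= andbT => s0; rewrite lee_fin.
  by rewrite !mulr_ge0 ?phi_ge0 ?invr_ge0 ?pi_ge0 ?(ltW s0) ?(ltW t'0)// addr_ge0// sqr_ge0.
- by rewrite lee_fin divr_ge0// ltW.
apply: le_integral_ge0 => s; rewrite /= in_itv/= andbT => s0.
  rewrite -EFinM lee_fin mulr_ge0 ?divr_ge0 ?(ltW t0) ?(ltW t'0)//.
  by rewrite !mulr_ge0 ?phi_ge0 ?invr_ge0 ?pi_ge0 ?(ltW s0) ?(ltW t'0)// addr_ge0// sqr_ge0.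
rewrite -EFinM lee_fin mulrCA ler_wpM2l//.
  by rewrite !mulr_ge0 ?phi_ge0 ?invr_ge0 ?pi_ge0 ?(ltW s0).
have p1 : 0 < t ^+ 2 + s ^+ 2 by rewrite addr_gt0 ?exprn_gt0.
have p2 : 0 < t' ^+ 2 + s ^+ 2 by rewrite addr_gt0 ?exprn_gt0.
rewrite mulrA ler_pdivrMr// [leRHS]mulrAC ler_pdivlMr//.
rewrite -(ler_pM2l t0) (_ : t * _ = t' ^+ 2 * (t ^+ 2 + s ^+ 2)); last first.
  by field; rewrite gt_eqF.
have : t' ^+ 2 * s ^+ 2 <= t ^+ 2 * s ^+ 2.
  by rewrite ler_wpM2r ?sqr_ge0// lerXn2r ?nnegrE// ltW.
nra.
Qed.

(** The mixture is cut at s = |th|. Below, u = |th| / s satisfies u^3 phi(u) <= 9, because u^3 <= 1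
    + u^4 and u^4 <= 8 exp(u^2 / 2); the integrand is then at most 9 t / |th|^3 on an interval of
    length |th|. Above, it is at most t / (|th| s^2). Together this gives 9 + 1. *)
Lemma horseshoe_pdf_ub (t th : R) : 0 < t -> th != 0 ->
  (horseshoe_pdf t th <= (10 * t / th ^+ 2)%:E)%E.
Proof.
move=> t0 th0; pose a := `|th|.
have a0 : 0 < a by rewrite normr_gt0.
have tha : th ^+ 2 = a ^+ 2 by rewrite /a real_normK ?num_real.
rewrite horseshoe_pdf_scale//.
pose f (s : R) := phi (th / s) * s^-1 * (2 / pi) * (t / (t ^+ 2 + s ^+ 2)).
have f0 s : 0 < s -> 0 <= f s.
  move=> s0; rewrite /f !mulr_ge0 ?phi_ge0 ?invr_ge0 ?pi_ge0 ?(ltW s0) ?(ltW t0)//.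
  by rewrite addr_ge0// sqr_ge0.
have mf : measurable_fun setT f by rewrite /f; meas.
rewrite (@itv_bndbnd_setU _ _ _ (BRight a)) ?bnd_simp ?(ltW a0)//.
rewrite ge0_integral_setU//=; last 3 first.
- by apply: measurable_funTS; apply/measurable_EFinP.
- move=> x [] /=; rewrite in_itv/= => /andP[x0 _]; rewrite lee_fin f0//.
  exact: lt_trans x0.
- apply/disj_setPS => x [] /=; rewrite !in_itv/= andbT => /andP[_ ?].
  by rewrite ltNge => /negP.
have pi2 := pi_ge2 R.
have fle s : 0 < s -> f s <= phi (th / s) * t * s ^- 3.
  move=> s0; rewrite /f -mulrA (_ : _ * t * _ = phi (th / s) * s^-1 * (t * s ^- 2)); last first.
    by field; rewrite gt_eqF.
  apply: ler_wpM2l; first by rewrite mulr_ge0 ?phi_ge0// invr_ge0 ltW.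
  rewrite -[leRHS]mul1r ler_pM//.
  - by rewrite divr_ge0// pi_ge0.
  - by rewrite divr_ge0 ?(ltW t0)// addr_ge0// sqr_ge0.
  - by rewrite ler_pdivrMr ?pi_gt0// mul1r.
  - rewrite ler_wpM2l ?(ltW t0)// lef_pV2 ?posrE ?exprn_gt0//.
      by rewrite lerDr sqr_ge0.
    by rewrite addr_gt0 ?exprn_gt0.
have b1 : (\int[mu]_(s in `]0%R, a]) (f s)%:E <= (9 * t / th ^+ 2)%:E)%E.
  apply: (@le_trans _ _ (\int[mu]_(s in `]0%R, a]) (9 * t / a ^+ 3)%:E)%E).
    apply: le_integral_ge0 => s /=; rewrite in_itv/= => /andP[s0 sa].
      by rewrite lee_fin f0.
    rewrite lee_fin (le_trans (fle _ s0))//.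
    pose u := a / s.
    have u0 : 0 <= u by rewrite divr_ge0// ltW.
    have -> : phi (th / s) = phi u.
      by rewrite !phiE /u !expr_div_n -tha.
    have -> : phi u * t * s ^- 3 = (u ^+ 3 * phi u) * (t / a ^+ 3).
      by rewrite /u; field; rewrite !gt_eqF.
    rewrite -[leRHS]mulrA ler_wpM2r ?divr_ge0 ?(ltW t0) ?exprn_ge0 ?(ltW a0)//.
    have e1 : u ^+ 3 <= 1 + u ^+ 4.
      have := sqr_ge0 (u ^+ 2 - u); have := sqr_ge0 (u - 1); have := sqr_ge0 u.
      nra.
    have e2 : u ^+ 4 <= 8 * expR (u ^+ 2 / 2).
      have := @expR_ge1Dxn R (u ^+ 2 / 2) 1 _; rewrite divr_ge0 ?sqr_ge0//.
      move=> /(_ erefl); rewrite (_ : 2`!%:R = 2 :> R)//; nra.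
    have e3 : 1 <= expR (u ^+ 2 / 2) by rewrite -expR0 ler_expR divr_ge0 ?sqr_ge0.
    rewrite phiE mulrCA -[leRHS]mul1r ler_pM ?(ltW phi0_gt0) ?phi0_le1//.
      by rewrite mulr_ge0 ?exprn_ge0 ?expR_ge0.
    rewrite mulNr expRN ler_pdivrMr ?expR_gt0//; lra.
  rewrite integral_cst//= lebesgue_measure_itv/= lte_fin a0 -EFinB -EFinM lee_fin.
  rewrite subr0 tha.
  by rewrite le_eqVlt; apply/orP; left; apply/eqP; field; rewrite gt_eqF.
have b2 : (\int[mu]_(s in `]a, +oo[) (f s)%:E <= (t / th ^+ 2)%:E)%E.
  apply: (@le_trans _ _ (\int[mu]_(s in `]a, +oo[) ((t / a)%:E * (s ^- 2)%:E))%E).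
    apply: le_integral_ge0 => s /=; rewrite in_itv/= andbT => sa.
      by rewrite lee_fin f0// (lt_trans a0).
    have s0 : 0 < s by exact: lt_trans sa.
    rewrite -EFinM lee_fin (le_trans (fle _ s0))//.
    have -> : phi (th / s) * t * s ^- 3 = t * (phi (th / s) * s^-1) * s ^- 2.
      by field; rewrite gt_eqF.
    rewrite ler_wpM2r ?invr_ge0 ?sqr_ge0// ler_wpM2l ?(ltW t0)//.
    rewrite -[leRHS]mul1r ler_pM ?phi_ge0 ?invr_ge0 ?(ltW s0)//.
      by rewrite (le_trans (phi_le_phi0 _))// phi0_le1.
    by rewrite lef_pV2 ?posrE// ltW.
  rewrite ge0_integralZl//=; last 3 first.
  - by apply: measurable_funTS; apply/measurable_EFinP; meas.
  - by move=> s _; rewrite lee_fin invr_ge0 sqr_ge0.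
  - by rewrite lee_fin divr_ge0 ?(ltW t0) ?(ltW a0).
  rewrite integral_itv_obnd_cbnd; last first.
    by apply: measurable_funTS; apply/measurable_EFinP; meas.
  rewrite integral_sqr_inv// -EFinM lee_fin tha.
  by rewrite le_eqVlt; apply/orP; left; apply/eqP; field; rewrite gt_eqF.
apply: le_trans (leeD b1 b2) _.
by rewrite -EFinD lee_fin -mulrDl; apply: ler_wpM2r; [rewrite invr_ge0 sqr_ge0|lra].
Qed.

Definition hs_lb : R := locked (phi 1 / (10 * pi)).

Lemma hs_lb_gt0 : 0 < hs_lb.
Proof. by rewrite /hs_lb -lock divr_gt0 ?phi_gt0// mulr_gt0// pi_gt0. Qed.

(** Only s in [m, 2 m] with m = t + |th| is kept. There |th| / s <= 1 and t^2 + s^2 <= 5 m^2, while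
    m^2 <= 2 (t^2 + th^2). *)
Lemma horseshoe_pdf_lb (t th : R) : 0 < t ->
  ((hs_lb * t / (t ^+ 2 + th ^+ 2))%:E <= horseshoe_pdf t th)%E.
Proof.
move=> t0; rewrite horseshoe_pdf_scale//; set m := t + `|th|.
have m0 : 0 < m by rewrite ltr_pwDl.
pose f (s : R) := phi (th / s) * s^-1 * (2 / pi) * (t / (t ^+ 2 + s ^+ 2)).
have f0 s : 0 < s -> 0 <= f s.
  move=> s0; rewrite /f !mulr_ge0 ?phi_ge0 ?invr_ge0 ?pi_ge0 ?(ltW s0) ?(ltW t0)//.
  by rewrite addr_ge0// sqr_ge0.
have mf : measurable_fun setT f by rewrite /f; meas.
have pi0 := pi_gt0 R.
apply: (@le_trans _ _ (\int[mu]_(s in `[m, (2 * m)%R]) (f s)%:E)%E); last first.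
  apply: ge0_subset_integral => //=.
  - by apply: measurable_funTS; apply/measurable_EFinP.
  - by move=> x /=; rewrite in_itv/= andbT => x0; rewrite lee_fin f0.
  - move=> x /=; rewrite !in_itv/= andbT => /andP[mx _]; exact: lt_le_trans mx.
pose c := phi 1 * (2 * m)^-1 * (2 / pi) * (t / (5 * m ^+ 2)).
apply: (@le_trans _ _ (\int[mu]_(s in `[m, (2 * m)%R]) c%:E)%E).
  rewrite integral_cst//= lebesgue_measure_itv/= lte_fin.
  rewrite (_ : m < 2 * m); last by lra.
  rewrite -EFinB -EFinM lee_fin /c /hs_lb -lock.
  rewrite (_ : _ * (2 * m - m) = phi 1 * t / (5 * pi * m ^+ 2)); last first.
    by move: (@pi R) pi0 => P P0; field; rewrite !gt_eqF.
  rewrite (_ : phi 1 / _ * _ / _ = phi 1 * t / (5 * pi * (2 * (t ^+ 2 + th ^+ 2)))); last first.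
    move: (@pi R) pi0 => P P0; field; rewrite !gt_eqF//.
    by rewrite ltr_pwDl ?sqr_ge0 ?exprn_gt0.
  apply: ler_wpM2l; first by rewrite mulr_ge0 ?phi_ge0 ?(ltW t0).
  rewrite lef_pV2 ?posrE; last 2 first.
  - by rewrite !mulr_gt0// ltr_pwDl ?sqr_ge0 ?exprn_gt0.
  - by rewrite !mulr_gt0 ?exprn_gt0.
  rewrite ler_wpM2l ?mulr_ge0 ?pi_ge0// /m -(real_normK (num_real th)).
  have := sqr_ge0 (t - `|th|); nra.
apply: le_integral_ge0 => s /=; rewrite in_itv/= => /andP[ms sm].
  rewrite lee_fin /c !mulr_ge0 ?phi_ge0 ?invr_ge0 ?mulr_ge0 ?pi_ge0 ?exprn_ge0 ?(ltW t0)//; exact: ltW.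
have s0 : 0 < s by exact: lt_le_trans ms.
have mt : t <= m by rewrite lerDl.
rewrite lee_fin /c /f ler_pM//.
- by rewrite !mulr_ge0 ?phi_ge0 ?invr_ge0 ?mulr_ge0 ?pi_ge0// ltW.
- by rewrite divr_ge0 ?mulr_ge0 ?exprn_ge0 ?(ltW t0)// ltW.
- rewrite ler_wpM2r ?divr_ge0 ?pi_ge0// ler_pM ?phi_ge0 ?invr_ge0 ?mulr_ge0 ?(ltW m0)//.
    apply: phi_le; rewrite normr1 normrM normfV (gtr0_norm s0) ler_pdivrMr// mul1r.
    by rewrite (le_trans _ ms)// lerDr ltW.
  by rewrite lef_pV2 ?posrE// mulr_gt0.
- rewrite ler_wpM2l ?(ltW t0)// lef_pV2 ?posrE ?mulr_gt0 ?exprn_gt0//; last first.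
    by rewrite addr_gt0 ?exprn_gt0.
  nra.
Qed.

End horseshoe_density.

(** * Marginal density of one observation and its lower bounds *)

Section marginal_density.
Context {R : realType}.
Local Notation mu := (@lebesgue_measure R).

(* [horseshoe_pdf t 0] is [+oo]; setting the real-valued version to [0] there
   makes all the pointwise bounds below hold everywhere. *)
Definition hsd : R -> R -> R :=
  locked (fun t th => (th != 0)%:R * fine (horseshoe_pdf `|t| th)).

Lemma hsdE t th : hsd t th = (th != 0)%:R * fine (horseshoe_pdf `|t| th).
Proof. by rewrite /hsd -lock. Qed.

Lemma hsd_ge0 t th : 0 <= hsd t th.
Proof. by rewrite hsdE mulr_ge0// fine_ge0// horseshoe_pdf_ge0. Qed.

Lemma hsd_even t th : hsd t (- th) = hsd t th.
Proof. by rewrite !hsdE horseshoe_pdf_even oppr_eq0. Qed.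

Lemma horseshoe_pdf_hsd t th : 0 < t -> th != 0 -> horseshoe_pdf t th = (hsd t th)%:E.
Proof.
move=> t0 th0; rewrite hsdE th0 mul1r gtr0_norm// fineK//.
rewrite ge0_fin_numE ?horseshoe_pdf_ge0 ?(ltW t0)//.
exact: le_lt_trans (horseshoe_pdf_ub t0 th0) (ltry _).
Qed.

Lemma hsd0 t : hsd t 0 = 0. Proof. by rewrite hsdE eqxx mul0r. Qed.

Lemma hsd_ub t th : 0 < t -> th ^+ 2 * hsd t th <= 10 * t.
Proof.
move=> t0; have [->|th0] := eqVneq th 0; first by rewrite hsd0 mulr0 mulr_ge0// ltW.
have := horseshoe_pdf_ub t0 th0; rewrite horseshoe_pdf_hsd// lee_fin.
by rewrite ler_pdivlMr ?exprn_even_gt0// mulrC.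
Qed.

Lemma hsd_lb t th : 0 < t -> th != 0 -> hs_lb * t / (t ^+ 2 + th ^+ 2) <= hsd t th.
Proof.
by move=> t0 th0; have := horseshoe_pdf_lb th t0; rewrite horseshoe_pdf_hsd// lee_fin.
Qed.

Lemma hsd_ratio_ub t' t th : 0 < t' -> t' <= t -> hsd t th <= t / t' * hsd t' th.
Proof.
move=> t'0 tt'; have t0 : 0 < t by exact: lt_le_trans tt'.
have [->|th0] := eqVneq th 0; first by rewrite !hsd0 mulr0.
by have := horseshoe_pdf_ratio_ub th t'0 tt'; rewrite !horseshoe_pdf_hsd// lee_fin.
Qed.

Lemma hsd_ratio_lb t' t th : 0 < t' -> t' <= t -> t' / t * hsd t' th <= hsd t th.
Proof.
move=> t'0 tt'; have t0 : 0 < t by exact: lt_le_trans tt'.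
have [->|th0] := eqVneq th 0; first by rewrite !hsd0 mulr0.
by have := horseshoe_pdf_ratio_lb th t'0 tt'; rewrite !horseshoe_pdf_hsd// lee_fin.
Qed.

Lemma measurable_hsd2 : measurable_fun setT (fun x : R * R => hsd x.1 x.2).
Proof.
rewrite /hsd -lock; apply: measurable_funM; last first.
  by apply: (measurableT_comp _ measurable_horseshoe_pdf2).
rewrite (_ : (fun x => _) = (fun x : R * R => \1_(~` [set 0]) x.2)).
  apply: (measurableT_comp (f := (\1_(~` [set 0]) : R -> R))) => //.
  by apply: measurable_indic; exact: measurableC.
apply/funext => x; rewrite indicE in_setC (_ : (x.2 \in _) = (x.2 == 0))//.
by apply/idP/eqP => [/set_mem|->]//; exact: mem_set.
Qed.

Lemma measurable_hsd t : measurable_fun setT (hsd t).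
Proof. exact: (measurableT_comp measurable_hsd2 (pair1_measurable t)). Qed.

(** The two versions of the density differ only at 0, a null set; from here on integrals use the
    real-valued one. *)
Lemma integral_horseshoe_pdf_mul (t : R) (h : R -> R) : 0 < t ->
  measurable_fun setT h -> (forall x, 0 <= h x) ->
  (\int[mu]_x (horseshoe_pdf t x * (h x)%:E) = \int[mu]_x (hsd t x * h x)%:E)%E.
Proof.
move=> t0 mh h0; apply: ge0_ae_eq_integral => //.
- apply: emeasurable_funM; last exact/measurable_EFinP.
  rewrite -(gtr0_norm t0).
  exact: (measurableT_comp measurable_horseshoe_pdf2 (pair1_measurable t)).
- by apply/measurable_EFinP; apply: measurable_funM => //; exact: measurable_hsd.
- by move=> x _; rewrite mule_ge0 ?lee_fin ?horseshoe_pdf_ge0 ?(ltW t0).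
- by move=> x _; rewrite lee_fin mulr_ge0 ?hsd_ge0.
- exists [set 0]; split => //; first exact: lebesgue_measure_set1.
  move=> x /=; apply: contra_notP => /eqP x0 _.
  by rewrite horseshoe_pdf_hsd.
Qed.

(** By Tonelli: for a fixed local scale the normal density integrates to 1, and the half-Cauchy
    density is left. *)
Lemma integral_hsd t : 0 < t -> (\int[mu]_x (hsd t x)%:E = 1)%E.
Proof.
move=> t0.
transitivity (\int[mu]_x (horseshoe_pdf t x * (1 : R)%:E))%E.
  rewrite (@integral_horseshoe_pdf_mul _ (fun=> 1))//.
  by apply: eq_integral => x _; rewrite mulr1.
pose f (z : R * R) : \bar R := (\1_`]0, +oo[ z.2 * (phi (z.1 / (z.2 * t)) *
    (z.2 * t)^-1 * (2 / (pi * (1 + z.2 ^+ 2)))))%:E.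
have f0 z : (0 <= f z)%E.
  rewrite lee_fin indicE mem_setE in_itv/= andbT.
  have [l0|_] := ltP 0 z.2; last by rewrite mul0r.
  rewrite mul1r !mulr_ge0 ?phi_ge0 ?invr_ge0 ?mulr_ge0 ?pi_ge0 ?(ltW l0) ?(ltW t0)//.
  by rewrite addr_ge0// sqr_ge0.
have mf : measurable_fun setT f.
  by apply/measurable_EFinP; meas.
transitivity (\int[mu]_x \int[mu]_l f (x, l))%E.
  by apply: eq_integral => x _; rewrite mule1 horseshoe_pdf_setT.
rewrite (fubini_tonelli (m1 := mu) (m2 := mu) f)//.
transitivity (\int[mu]_(l in `]0%R, +oo[) ((2 / pi)%:E * ((oneDsqr l)^-1)%:E))%E; last first.
  rewrite ge0_integralZl//; last 2 first.
  - by apply: measurable_funTS; apply/measurable_EFinP; rewrite /oneDsqr; meas.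
  - by rewrite lee_fin divr_ge0 ?pi_ge0.
  rewrite integral_itv_obnd_cbnd; last first.
    by apply: measurable_funTS; apply/measurable_EFinP; rewrite /oneDsqr; meas.
  rewrite integral0y_oneDsqr -EFinM; congr EFin.
  by move: (@pi R) (pi_gt0 R) => P P0; field; rewrite gt_eqF.
rewrite [RHS]integral_mkcond; apply: eq_integral => l _.
rewrite patchE mem_setE in_itv/= andbT.
have [l0|l0] := ltP 0 l; last first.
  rewrite integral0_eq// => x _.
  by rewrite /f/= indicE mem_setE in_itv/= andbT ltNge l0 mul0r.
have lt0 : 0 < (l * t)^-1 by rewrite invr_gt0 mulr_gt0.
transitivity (\int[mu]_x ((2 / (pi * (1 + l ^+ 2)) * (l * t)^-1)%:E *
    (phi ((l * t)^-1 * x))%:E))%E.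
  apply: eq_integral => x _; rewrite -EFinM /f/= indicE mem_setE in_itv/= andbT l0.
  by congr EFin; rewrite mul1r mulrC mulrA (mulrC x) mulrAC.
have mphi : measurable_fun setT (fun x : R => (phi x)%:E).
  by apply/measurable_EFinP; exact: measurable_phi.
rewrite ge0_integralZl//; last 3 first.
- by apply: (measurableT_comp mphi); exact: mulrl_measurable.
- by move=> x _; rewrite lee_fin phi_ge0.
- by rewrite lee_fin !mulr_ge0 ?invr_ge0 ?mulr_ge0 ?pi_ge0 ?addr_ge0 ?sqr_ge0 ?(ltW l0) ?(ltW t0).
have := @ge0_integral_scale R _ setT (fun x => (phi x)%:E) lt0 measurableT mphi.
rewrite preimage_setT => -> //; last by move=> x; rewrite lee_fin phi_ge0.
have := @integral_phi R 0; under eq_integral do rewrite subr0.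
move=> ->; rewrite mule1 -!EFinM /oneDsqr; congr EFin.
rewrite invrK; have l20 : 1 + l ^+ 2 != 0 by rewrite gt_eqF// ltr_pwDl ?sqr_ge0.
by move: (@pi R) (pi_gt0 R) => P P0; field; rewrite l20 !gt_eqF.
Qed.

Definition psi (t y : R) : R := fine (\int[mu]_th (hsd t th * phi (y - th))%:E)%E.

Let mphi y : measurable_fun setT (fun th : R => phi (y - th)).
Proof. by apply: (measurableT_comp measurable_phi); meas. Qed.

Let mhsdphi t y : measurable_fun setT (fun th => (hsd t th * phi (y - th))%:E).
Proof.
by apply/measurable_EFinP; apply: measurable_funM => //; exact: measurable_hsd.
Qed.

Lemma integral_hsd_phi_le t y : 0 < t ->
  (\int[mu]_th (hsd t th * phi (y - th))%:E <= phi0%:E)%E.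
Proof.
move=> t0; rewrite -[leRHS]mule1 -(integral_hsd t0) -ge0_integralZl//; last 3 first.
- by apply/measurable_EFinP; exact: measurable_hsd.
- by move=> x _; rewrite lee_fin hsd_ge0.
- by rewrite lee_fin ltW// phi0_gt0.
apply: le_integral_ge0 => x _; first by rewrite lee_fin mulr_ge0 ?hsd_ge0 ?phi_ge0.
by rewrite -EFinM lee_fin mulrC ler_wpM2r ?hsd_ge0 ?phi_le_phi0.
Qed.

Lemma psiE t y : 0 < t -> (\int[mu]_th (hsd t th * phi (y - th))%:E = (psi t y)%:E)%E.
Proof.
move=> t0; rewrite /psi fineK// ge0_fin_numE.
  exact: le_lt_trans (integral_hsd_phi_le y t0) (ltry _).
by apply: integral_ge0 => x _; rewrite lee_fin mulr_ge0 ?hsd_ge0 ?phi_ge0.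
Qed.

Lemma psi_ge0 t y : 0 <= psi t y.
Proof.
rewrite fine_ge0// integral_ge0// => x _.
by rewrite lee_fin mulr_ge0 ?hsd_ge0 ?phi_ge0.
Qed.

Lemma psi_le t y : 0 < t -> psi t y <= phi0.
Proof. by move=> t0; have := integral_hsd_phi_le y t0; rewrite psiE// lee_fin. Qed.

Let mhsdphi3 : measurable_fun setT
  (fun z : (R * R) * R => (hsd z.1.1 z.2 * phi (z.1.2 - z.2))%:E).
Proof.
apply/measurable_EFinP; apply: measurable_funM.
  apply: (measurableT_comp (f := fun x : R * R => hsd x.1 x.2)
    (g := fun z : (R * R) * R => (z.1.1, z.2))); first exact: measurable_hsd2.
  by apply: measurable_fun_pair; meas.
by apply: (measurableT_comp measurable_phi); meas.
Qed.

Lemma measurable_psi2 : measurable_fun setT (fun x : R * R => psi x.1 x.2).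
Proof.
apply: measurableT_comp => //.
rewrite (_ : (fun x => _) = fubini_F mu
  (fun z : (R * R) * R => (hsd z.1.1 z.2 * phi (z.1.2 - z.2))%:E)).
  apply: measurable_fun_fubini_tonelli_F => // z.
  by rewrite lee_fin mulr_ge0 ?hsd_ge0 ?phi_ge0.
by apply/funext => z.
Qed.

Lemma measurable_psi t : measurable_fun setT (psi t).
Proof. exact: (measurableT_comp measurable_psi2 (pair1_measurable t)). Qed.

Lemma psi_ratio_ub t' t y : 0 < t' -> t' <= t -> psi t y <= t / t' * psi t' y.
Proof.
move=> t'0 tt'; have t0 : 0 < t by exact: lt_le_trans tt'.
have k0 : 0 <= t / t' by rewrite divr_ge0// ltW.
have <- : fine ((t / t')%:E * \int[mu]_th (hsd t' th * phi (y - th))%:E) = t / t' * psi t' y.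
  by rewrite psiE.
rewrite -lee_fin -psiE// fineK; last by rewrite psiE.
rewrite -ge0_integralZl//; last 2 first.
- exact: mhsdphi.
- by move=> x _; rewrite lee_fin mulr_ge0 ?hsd_ge0 ?phi_ge0.
apply: le_integral_ge0 => x _; first by rewrite lee_fin mulr_ge0 ?hsd_ge0 ?phi_ge0.
by rewrite -EFinM lee_fin [leRHS]mulrA ler_wpM2r ?phi_ge0 ?hsd_ratio_ub.
Qed.

Lemma psi_ratio_lb t' t y : 0 < t' -> t' <= t -> t' / t * psi t' y <= psi t y.
Proof.
move=> t'0 tt'; have t0 : 0 < t by exact: lt_le_trans tt'.
have k0 : 0 <= t' / t by rewrite divr_ge0// ltW.
have <- : fine ((t' / t)%:E * \int[mu]_th (hsd t' th * phi (y - th))%:E) = t' / t * psi t' y.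
  by rewrite psiE.
rewrite -lee_fin -psiE// fineK; last by rewrite psiE.
rewrite -ge0_integralZl//; last 2 first.
- exact: mhsdphi.
- by move=> x _; rewrite lee_fin mulr_ge0 ?hsd_ge0 ?phi_ge0.
apply: le_integral_ge0 => x _.
  by rewrite -EFinM lee_fin mulr_ge0// mulr_ge0 ?hsd_ge0 ?phi_ge0.
by rewrite -EFinM lee_fin [leLHS]mulrA ler_wpM2r ?phi_ge0 ?hsd_ratio_lb.
Qed.

Lemma psi_lower t y a b c : 0 < t -> 0 <= c -> a < b ->
  (forall th, a <= th <= b -> c <= hsd t th * phi (y - th)) -> c * (b - a) <= psi t y.
Proof.
move=> t0 c0 ab H; rewrite -lee_fin -psiE//; apply: integral_lower => //.
- by apply/measurable_EFinP; exact: mhsdphi.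
- by move=> th; rewrite mulr_ge0 ?hsd_ge0 ?phi_ge0.
Qed.

Definition psi_lbc : R := locked (hs_lb * phi 2 / 9).

Lemma psi_lbc_gt0 : 0 < psi_lbc.
Proof. by rewrite /psi_lbc -lock divr_gt0// mulr_gt0 ?hs_lb_gt0 ?phi_gt0. Qed.

(** Only parameters at distance between 1 and 2 from [y], on the side away from 0, are kept. There
    phi(y - th) >= phi(2) and t^2 + th^2 <= 1 + (|y| + 2)^2 <= 9 (1 + y^2). This polynomial tail
    drives the test and also absorbs the error term of the second moment. *)
Lemma psi_lb t y : 0 < t <= 1 -> psi_lbc * t / (1 + y ^+ 2) <= psi t y.
Proof.
move=> /andP[t0 t1].
have key th : 1 <= `|th - y| <= 2 -> `|y| + 1 <= `|th| ->
    psi_lbc * t / (1 + y ^+ 2) <= hsd t th * phi (y - th).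
  move=> /andP[u1 u2] thy.
  have th0 : th != 0 by rewrite -normr_gt0; have := normr_ge0 y; lra.
  have y2 : 0 < 1 + y ^+ 2 by rewrite ltr_pwDl ?sqr_ge0.
  have p2 : phi 2 <= phi (y - th).
    by apply: phi_le; rewrite distrC (ger0_norm (_ : 0 <= 2)).
  apply: (@le_trans _ _ (hs_lb * t / (t ^+ 2 + th ^+ 2) * phi 2)); last first.
    apply: ler_pM; rewrite ?phi_ge0 ?hsd_lb// divr_ge0 ?addr_ge0 ?sqr_ge0//.
    by rewrite mulr_ge0 ?(ltW hs_lb_gt0) ?(ltW t0).
  have d0 : 0 < t ^+ 2 + th ^+ 2 by rewrite ltr_pwDl ?sqr_ge0 ?exprn_gt0.
  rewrite /psi_lbc -lock.
  rewrite (_ : _ / 9 * t / _ = (hs_lb * phi 2 * t) * (9 * (1 + y ^+ 2))^-1); last first.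
    by field; rewrite gt_eqF.
  rewrite [leRHS](_ : _ = (hs_lb * phi 2 * t) * (t ^+ 2 + th ^+ 2)^-1); last first.
    by field; rewrite gt_eqF.
  apply: ler_wpM2l; first by rewrite !mulr_ge0 ?phi_ge0 ?(ltW hs_lb_gt0) ?(ltW t0).
  rewrite lef_pV2 ?posrE ?mulr_gt0//.
  have : `|th| <= `|y| + 2.
    by rewrite -(subrK y th) addrC (le_trans (ler_normD _ _))// lerD2l.
  have := real_normK (num_real y); have := real_normK (num_real th).
  have := normr_ge0 th; have := normr_ge0 y; move: `|th| `|y| => a b b0 a0 <- <- ab.
  have : a ^+ 2 <= (b + 2) ^+ 2 by apply: lerXn2r; rewrite ?nnegrE; lra.
  have := sqr_ge0 (b - 2); have : t ^+ 2 <= 1 by rewrite expr_le1// ltW.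
  by nra.
have c0 : 0 <= psi_lbc * t / (1 + y ^+ 2).
  by rewrite !mulr_ge0 ?(ltW psi_lbc_gt0) ?(ltW t0)// invr_ge0 addr_ge0 ?sqr_ge0.
have [y0|y0] := leP 0 y.
  rewrite [leLHS](_ : _ = psi_lbc * t / (1 + y ^+ 2) * ((y + 2) - (y + 1))); last by ring.
  apply: psi_lower => //; first by lra.
  move=> th /andP[ha hb]; apply: key.
    by rewrite ger0_norm; lra.
  by rewrite !ger0_norm//; lra.
rewrite [leLHS](_ : _ = psi_lbc * t / (1 + y ^+ 2) * ((y - 1) - (y - 2))); last by ring.
apply: psi_lower => //; first by lra.
move=> th /andP[ha hb]; apply: key.
  by rewrite ler0_norm; lra.
by rewrite !ltr0_norm//; lra.
Qed.

Definition psi_lbc0 : R := locked (hs_lb / 8).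

Lemma psi_lbc0_gt0 : 0 < psi_lbc0.
Proof. by rewrite /psi_lbc0 -lock divr_gt0 ?hs_lb_gt0. Qed.

(** When [th] has the sign of [y], the tilt exp(th y - th^2 / 2) is at least 1 - th^2 / 2 >= 1/2.
    The prior density is at least [hs_lb / (2 * t)] because t^2 + th^2 <= 2 t^2. *)
Lemma hsd_phi_lb t y th : 0 < t <= 1 -> t / 2 <= `|th| <= t -> 0 <= y * th ->
  hs_lb / (4 * t) * phi y <= hsd t th * phi (y - th).
Proof.
move=> /andP[t0 t1] /andP[th1 th2] yth.
have th0 : th != 0 by rewrite -normr_gt0; lra.
have th2t : th ^+ 2 <= t ^+ 2.
  by rewrite -(real_normK (num_real th)); apply: lerXn2r; rewrite ?nnegrE// ltW.
have t21 : t ^+ 2 <= 1 by rewrite expr_le1// ltW.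
have d0 : 0 < t ^+ 2 + th ^+ 2 by rewrite ltr_pwDl ?sqr_ge0 ?exprn_gt0.
have h0 : 0 <= hs_lb / (2 * t) by rewrite divr_ge0 ?mulr_ge0 ?(ltW hs_lb_gt0) ?(ltW t0).
rewrite (_ : hs_lb / (4 * t) * phi y = hs_lb / (2 * t) * (2^-1 * phi y)); last first.
  by field; rewrite gt_eqF.
apply: ler_pM => //; first by rewrite mulr_ge0 ?phi_ge0.
  apply: le_trans (hsd_lb t0 th0).
  rewrite -mulrA; apply: ler_wpM2l; first exact/ltW/hs_lb_gt0.
  rewrite ler_pdivlMr// mulrC ler_pdivrMr ?mulr_gt0//.
  by nra.
rewrite -phi_tilt mulrC; apply: ler_wpM2l; first exact: phi_ge0.
apply: le_trans (expR_ge1Dx _).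
by rewrite mulrC; lra.
Qed.

(** An interval of length t / 2 carries an integrand of order phi(y) / t, so the constant does not
    depend on [t]: phi / psi is uniformly bounded. *)
Lemma psi_lb0 t y : 0 < t <= 1 -> psi_lbc0 * phi y <= psi t y.
Proof.
move=> t01; have /andP[t0 t1] := t01.
have c0 : 0 <= hs_lb / (4 * t) * phi y.
  by rewrite mulr_ge0 ?phi_ge0// divr_ge0 ?mulr_ge0 ?(ltW hs_lb_gt0) ?(ltW t0).
have -> : psi_lbc0 * phi y = hs_lb / (4 * t) * phi y * (t / 2).
  by rewrite /psi_lbc0 -lock; field; rewrite gt_eqF.
have [y0|y0] := leP 0 y.
  rewrite [t / 2](_ : _ = t - t / 2); last by lra.
  apply: psi_lower => //; first by lra.
  move=> th /andP[ha hb].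
  have th0 : 0 <= th by lra.
  by apply: hsd_phi_lb => //; [rewrite ger0_norm ?ha|rewrite mulr_ge0].
rewrite [t / 2](_ : _ = - (t / 2) - - t); last by lra.
apply: psi_lower => //; first by lra.
move=> th /andP[ha hb].
have th0 : th <= 0 by lra.
apply: hsd_phi_lb => //; last by rewrite mulr_le0// ltW.
by rewrite ler0_norm//; apply/andP; split; lra.
Qed.

Lemma psi_gt0 t y : 0 < t <= 1 -> 0 < psi t y.
Proof.
by move=> t01; apply: lt_le_trans (psi_lb0 y t01); rewrite mulr_gt0 ?psi_lbc0_gt0 ?phi_gt0.
Qed.

(** Since th^2 times the prior density is at most 10 t, only the integral of [phi] is left;
    comparing with [psi] through [psi_lb0] costs 1 / phi(y), hence the exponential. The factor [t]
    is what makes null coordinates cheap. *)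
Lemma second_moment_zero t y : 0 < t <= 1 ->
  (\int[mu]_th (hsd t th * phi (y - th) * th ^+ 2)%:E <=
   (10 / (psi_lbc0 * phi0) * t * expR (y ^+ 2 / 2) * psi t y)%:E)%E.
Proof.
move=> t01; have /andP[t0 t1] := t01.
apply: (@le_trans _ _ (10 * t)%:E).
  rewrite -[leRHS]mule1 -(integral_phi y) -ge0_integralZl//; last 3 first.
  - by apply/measurable_EFinP; meas.
  - by move=> x _; rewrite lee_fin phi_ge0.
  - by rewrite lee_fin mulr_ge0// ltW.
  apply: le_integral_ge0 => x _.
    by rewrite lee_fin mulr_ge0 ?sqr_ge0// mulr_ge0 ?phi_ge0 ?hsd_ge0.
  rewrite -EFinM lee_fin mulrC mulrA -opprB phi_even.
  by rewrite ler_wpM2r ?phi_ge0 ?hsd_ub.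
rewrite lee_fin (_ : 10 * t = 10 / (psi_lbc0 * phi0) * t * expR (y ^+ 2 / 2) * (psi_lbc0 * phi y)).
  apply: ler_wpM2l; last exact: psi_lb0.
  rewrite mulr_ge0 ?expR_ge0// mulr_ge0 ?(ltW t0)// divr_ge0 ?mulr_ge0//.
    exact: ltW psi_lbc0_gt0.
  exact: ltW phi0_gt0.
rewrite phiE mulNr expRN; field.
by rewrite !gt_eqF ?expR_gt0 ?phi0_gt0 ?psi_lbc0_gt0.
Qed.

End marginal_density.

(** * Posterior second moment of one coordinate *)

Section moments.
Context {R : realType}.
Local Notation mu := (@lebesgue_measure R).

Definition moment_const : R := locked (128 * (1 + 10 * gauss8) * phi0 / psi_lbc).

Lemma moment_const_ge0 : 0 <= moment_const.
Proof.
rewrite /moment_const -lock divr_ge0 ?(ltW psi_lbc_gt0)// mulr_ge0 ?(ltW phi0_gt0)//.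
by rewrite mulr_ge0// addr_ge0// mulr_ge0// ltW// gauss8_gt0.
Qed.

(* Split according to whether [u ^+ 2] exceeds [8 * ln t^-1]; beyond that
   threshold half of the exponent supplies the factor [t]. *)
Lemma sqr_phi_le (t u : R) : 0 < t <= 1 ->
  u ^+ 2 * phi u <= 8 * ln t^-1 * phi u
    + 64 * phi0 * t * (expR (- u ^+ 2 / 8) / (1 + u ^+ 2)).
Proof.
move=> /andP[t0 t1].
have u2 : 0 < 1 + u ^+ 2 by rewrite ltr_pwDl ?sqr_ge0.
have r0 : 0 <= 64 * phi0 * t * (expR (- u ^+ 2 / 8) / (1 + u ^+ 2)).
  by rewrite mulr_ge0 ?divr_ge0 ?expR_ge0 ?(ltW u2)// mulr_ge0 ?(ltW t0)// mulr_ge0// ltW// phi0_gt0.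
have [uL|uL] := leP (u ^+ 2) (8 * ln t^-1).
  by rewrite -[leLHS]addr0 lerD// ler_wpM2r ?phi_ge0.
apply: (@le_trans _ _ (64 * phi0 * t * (expR (- u ^+ 2 / 8) / (1 + u ^+ 2)))); last first.
  by rewrite lerDr mulr_ge0 ?phi_ge0// mulr_ge0// ln_ge0// invf_ge1.
have e1 : expR (- u ^+ 2 / 8) <= t.
  rewrite -[leRHS]lnK ?posrE// ler_expR.
  by move: uL; rewrite lnV ?posrE//; lra.
have e2 : u ^+ 2 * (1 + u ^+ 2) <= 64 * expR (u ^+ 2 / 4).
  have x0 : 0 <= u ^+ 2 / 4 by rewrite divr_ge0 ?sqr_ge0.
  have h1 := expR_ge1Dx (u ^+ 2 / 4).
  have := @expR_ge1Dxn R (u ^+ 2 / 4) 1 x0; rewrite (_ : 2`!%:R = 2 :> R)// => h2.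
  rewrite (_ : u ^+ 2 = 4 * (u ^+ 2 / 4)); last by lra.
  rewrite (_ : 4 * (u ^+ 2 / 4) / 4 = u ^+ 2 / 4); last by lra.
  by move: (u ^+ 2 / 4) (expR (u ^+ 2 / 4)) x0 h1 h2 => x e x0 h1 h2; nra.
have e3 : phi u = phi0 * (expR (- u ^+ 2 / 8) * expR (- u ^+ 2 / 8) / expR (u ^+ 2 / 4)).
  by rewrite phiE -expRN -!expRD; congr (_ * expR _); field.
rewrite e3.
rewrite [leLHS](_ : _ = (phi0 * (expR (- u ^+ 2 / 8) / (1 + u ^+ 2))) *
  (expR (- u ^+ 2 / 8) * (u ^+ 2 * (1 + u ^+ 2) / expR (u ^+ 2 / 4)))); last first.
  by field; rewrite !gt_eqF ?expR_gt0.
rewrite [leRHS](_ : _ = (phi0 * (expR (- u ^+ 2 / 8) / (1 + u ^+ 2))) * (t * 64)); last by ring.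
apply: ler_wpM2l.
  by rewrite mulr_ge0 ?(ltW phi0_gt0)// divr_ge0 ?expR_ge0 ?(ltW u2).
apply: ler_pM; rewrite ?expR_ge0//.
  by rewrite divr_ge0 ?expR_ge0// mulr_ge0 ?sqr_ge0 ?(ltW u2).
by rewrite ler_pdivrMr ?expR_gt0.
Qed.

(** With u = y - th, [sqr_phi_le] leaves a remainder of order t exp(- u^2 / 8) / (1 + u^2). The
    inequality 1 + y^2 <= 2 (1 + u^2) (1 + th^2) trades 1 + u^2 for 1 + y^2. The factor 1 + th^2 is
    harmless because th^2 times the prior density is at most 10 t, and the resulting t / (1 + y^2)
    is absorbed by [psi_lb]. *)
Lemma second_moment (t y : R) : 0 < t <= 1 ->
  (\int[mu]_th (hsd t th * phi (y - th) * (th - y) ^+ 2)%:E <=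
   ((8 * ln t^-1 + moment_const) * psi t y)%:E)%E.
Proof.
move=> t01; have /andP[t0 t1] := t01.
have y2 : 0 < 1 + y ^+ 2 by rewrite ltr_pwDl ?sqr_ge0.
have l0 : 0 <= 8 * ln t^-1 by rewrite mulr_ge0// ln_ge0// invf_ge1.
have k0 : 0 <= 128 * phi0 * t / (1 + y ^+ 2).
  by rewrite divr_ge0 ?(ltW y2)// mulr_ge0 ?(ltW t0)// mulr_ge0// ltW// phi0_gt0.
apply: (@le_trans _ _ (\int[mu]_th ((8 * ln t^-1)%:E * (hsd t th * phi (y - th))%:E +
   (128 * phi0 * t / (1 + y ^+ 2))%:E *
     ((hsd t th)%:E + (10 * t)%:E * (expR (- (th - y) ^+ 2 / 8))%:E)))%E).
  apply: le_integral_ge0 => th _.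
    by rewrite lee_fin mulr_ge0 ?sqr_ge0// mulr_ge0 ?phi_ge0 ?hsd_ge0.
  rewrite -!EFinM -!EFinD lee_fin.
  have g0 := hsd_ge0 t th; have gub := hsd_ub th t0.
  pose u := y - th; have th2 : 0 < 1 + u ^+ 2 by rewrite ltr_pwDl ?sqr_ge0.
  rewrite (_ : th - y = - u) ?sqrrN; last by rewrite opprB.
  apply: (@le_trans _ _ (hsd t th * (8 * ln t^-1 * phi u
    + 64 * phi0 * t * (expR (- u ^+ 2 / 8) / (1 + u ^+ 2))))).
    by rewrite -mulrA ler_wpM2l// mulrC sqr_phi_le.
  have e1 : expR (- u ^+ 2 / 8) <= 1.
    by rewrite -expR0 ler_expR mulNr oppr_le0 divr_ge0 ?sqr_ge0.
  have e0 := expR_ge0 (- u ^+ 2 / 8).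
  have yu : 1 + y ^+ 2 <= 2 * (1 + u ^+ 2) * (1 + th ^+ 2).
    rewrite (_ : y = u + th); last by rewrite subrK.
    have := sqr_ge0 (u - th); have := sqr_ge0 (u * th); nra.
  move: (expR _) e0 e1 => E e0 e1.
  have h1 : hsd t th * E * (1 + th ^+ 2) <= hsd t th + 10 * t * E.
    have : hsd t th * E <= hsd t th by rewrite ler_piMr.
    have : th ^+ 2 * hsd t th * E <= 10 * t * E by rewrite ler_wpM2r.
    lra.
  have h2 : hsd t th * (E / (1 + u ^+ 2)) <= 2 / (1 + y ^+ 2) * (hsd t th + 10 * t * E).
    rewrite (_ : hsd t th * _ = hsd t th * E * (1 + y ^+ 2) / ((1 + u ^+ 2) * (1 + y ^+ 2))); last first.
      by field; rewrite !gt_eqF.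
    rewrite [leRHS](_ : _ = 2 * (1 + u ^+ 2) * (hsd t th + 10 * t * E)
      / ((1 + u ^+ 2) * (1 + y ^+ 2))); last by field; rewrite !gt_eqF.
    rewrite ler_pM2r ?invr_gt0 ?mulr_gt0//.
    apply: (@le_trans _ _ (hsd t th * E * (2 * (1 + u ^+ 2) * (1 + th ^+ 2)))).
      by rewrite ler_wpM2l// mulr_ge0.
    rewrite (_ : hsd t th * E * _ = 2 * (1 + u ^+ 2) * (hsd t th * E * (1 + th ^+ 2))); last by ring.
    by rewrite ler_wpM2l// mulr_ge0// ltW.
  rewrite mulrDr lerD//.
    by rewrite (_ : hsd t th * _ = 8 * ln t^-1 * (hsd t th * phi u)); last by ring.
  rewrite [leLHS](_ : _ = 64 * phi0 * t * (hsd t th * (E / (1 + u ^+ 2)))); last by ring.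
  rewrite [leRHS](_ : _ = 64 * phi0 * t * (2 / (1 + y ^+ 2) * (hsd t th + 10 * t * E))); last by ring.
  by rewrite ler_wpM2l// mulr_ge0 ?(ltW t0)// mulr_ge0// ltW// phi0_gt0.
have mh : measurable_fun setT (hsd t) by exact: measurable_hsd.
have mp : measurable_fun setT (fun th : R => phi (y - th)) by meas.
have mhp : measurable_fun setT (fun th : R => (hsd t th * phi (y - th))%:E).
  by apply/measurable_EFinP; exact: measurable_funM.
have me : measurable_fun setT (fun th : R => (expR (- (th - y) ^+ 2 / 8))%:E).
  by apply/measurable_EFinP; meas.
have mhE : measurable_fun setT (fun th : R => (hsd t th)%:E) by exact/measurable_EFinP.
have mc (c : R) (f : R -> \bar R) : measurable_fun setT f ->
    measurable_fun setT (fun x => c%:E * f x)%E by move=> mf; exact: emeasurable_funM.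
have t10 : 0 <= 10 * t by rewrite mulr_ge0// ltW.
have hp0 (th : R) : (0 <= (hsd t th * phi (y - th))%:E)%E.
  by rewrite lee_fin mulr_ge0 ?hsd_ge0 ?phi_ge0.
have h0 (th : R) : (0 <= (hsd t th)%:E)%E by rewrite lee_fin hsd_ge0.
have ee0 (th : R) : (0 <= (expR (- (th - y) ^+ 2 / 8))%:E)%E by rewrite lee_fin expR_ge0.
have hq (th : R) : (0 <= (10 * t)%:E * (expR (- (th - y) ^+ 2 / 8))%:E)%E.
  by apply: mule_ge0; rewrite // lee_fin.
have mq : measurable_fun setT (fun th : R =>
  ((10 * t)%:E * (expR (- (th - y) ^+ 2 / 8))%:E)%E) by exact: mc.
have ms := emeasurable_funD mhE mq.
rewrite ge0_integralD//; last 4 first.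
- by move=> th _; apply: mule_ge0; rewrite // lee_fin.
- exact: mc.
- by move=> th _; apply: mule_ge0; [rewrite lee_fin|exact: adde_ge0].
- exact: mc.
rewrite ge0_integralZl// ge0_integralZl//; last first.
  by move=> th _; exact: adde_ge0.
rewrite ge0_integralD//.
rewrite ge0_integralZl// integral_hsd// integral_gauss8 psiE//.
rewrite -[1%E]/(1%:E) -!(EFinM, EFinD) lee_fin [leRHS]mulrDl lerD2l.
rewrite (_ : _ * (1 + _) = (128 * phi0 * (1 + 10 * t * gauss8) / psi_lbc) *
  (psi_lbc * t / (1 + y ^+ 2))); last first.
  by field; rewrite !gt_eqF ?psi_lbc_gt0.
apply: ler_pM; last exact: psi_lb.
- rewrite divr_ge0 ?(ltW psi_lbc_gt0)// mulr_ge0//; first by rewrite mulr_ge0// ltW// phi0_gt0.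
  by rewrite addr_ge0// mulr_ge0// ltW// gauss8_gt0.
- by rewrite divr_ge0 ?(ltW y2)// mulr_ge0 ?(ltW t0)// ltW// psi_lbc_gt0.
rewrite /moment_const -lock ler_wpM2r ?invr_ge0 ?(ltW psi_lbc_gt0)//.
rewrite mulrAC ler_wpM2r ?(ltW phi0_gt0)// ler_wpM2l//.
by rewrite lerD2l ler_wpM2r ?(ltW gauss8_gt0)//; lra.
Qed.

End moments.

(** * Gaussian tails and the exceedance test *)

Section one_dim_means.
Context {R : realType}.
Local Notation mu := (@lebesgue_measure R).
Implicit Types t y z a b m : R.

Lemma ge0_integral_opp (f : R -> \bar R) : measurable_fun setT f ->
  (forall x, 0 <= f x)%E -> (\int[mu]_x f (- x)%R = \int[mu]_x f x)%E.
Proof.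
move=> mf f0.
transitivity (\int[pushforward mu (-%R : _ -> measurableTypeR R)]_x f x)%E.
  by rewrite ge0_integral_pushforward//= preimage_setT.
by apply: eq_measure_integral => //= A mA _; exact: lebesgue_measureN.
Qed.

Lemma integral_psi t : 0 < t -> (\int[mu]_y (psi t y)%:E = 1)%E.
Proof.
move=> t0.
pose f (z : R * R) : \bar R := (hsd t z.2 * phi (z.1 - z.2))%:E.
have mf : measurable_fun setT f.
  apply/measurable_EFinP; apply: measurable_funM; last by meas.
  exact: (measurableT_comp (measurable_hsd t)).
have f0 x : (0 <= f x)%E by rewrite lee_fin mulr_ge0 ?hsd_ge0 ?phi_ge0.
transitivity (\int[mu]_y \int[mu]_th f (y, th))%E.
  by apply: eq_integral => y _; rewrite -psiE.
rewrite (fubini_tonelli (m1 := mu) (m2 := mu) f)// -(integral_hsd t0).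
apply: eq_integral => th _; rewrite -[RHS]mule1 -(integral_phi th).
rewrite -ge0_integralZl//.
- by apply/measurable_EFinP; meas.
- by move=> y _; rewrite lee_fin phi_ge0.
- by rewrite lee_fin hsd_ge0.
Qed.

(** The coefficient 1/2 of the exponent is split as 1/8 + 1/8 + 1/4: one eighth stays as integrable
    weight, the other absorbs 1 + y^2 <= 8 exp(y^2 / 8), and the quarter gives the tail factor. *)
Lemma phi_tail_le z y : 0 <= z -> z <= `|y| ->
  (1 + y ^+ 2) * phi y <= 8 * phi0 * expR (- z ^+ 2 / 4) * expR (- y ^+ 2 / 8).
Proof.
move=> z0 zy.
have z2 : z ^+ 2 <= y ^+ 2.
  by rewrite -(real_normK (num_real y)); apply: lerXn2r; rewrite ?nnegrE.
have -> : phi y = phi0 * expR (- y ^+ 2 / 8) * (expR (- y ^+ 2 / 8) * expR (- y ^+ 2 / 4)).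
  by rewrite phiE -mulrA -!expRD; congr (_ * expR _); field.
rewrite [leRHS](_ : _ = phi0 * expR (- y ^+ 2 / 8) * (8 * expR (- z ^+ 2 / 4))); last by ring.
rewrite mulrCA; apply: ler_wpM2l; first by rewrite mulr_ge0 ?expR_ge0 ?(ltW phi0_gt0).
rewrite mulrA; apply: ler_pM; rewrite ?expR_ge0//.
- by rewrite mulr_ge0 ?expR_ge0// addr_ge0 ?sqr_ge0.
- rewrite mulNr expRN ler_pdivrMr ?expR_gt0//.
  by have := expR_ge1Dx (y ^+ 2 / 8); have := sqr_ge0 y; lra.
- by rewrite ler_expR; lra.
Qed.

Lemma gaussian_tail z : 0 <= z ->
  (\int[mu]_y (phi y * \1_`]z, +oo[ y)%:E <= (8 * gauss8 * expR (- z ^+ 2 / 4))%:E)%E.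
Proof.
move=> z0.
have e0 : 0 <= 8 * expR (- z ^+ 2 / 4) by rewrite mulr_ge0 ?expR_ge0.
rewrite (mulrAC 8) EFinM -(integral_gauss8 0) -ge0_integralZl//; last first.
  by apply/measurable_EFinP; meas.
apply: le_integral_ge0 => y _; first by rewrite lee_fin mulr_ge0 ?phi_ge0.
rewrite -EFinM lee_fin indicE mem_setE in_itv/= andbT subr0.
have [zy|_] := ltP z y; last by rewrite mulr0 mulr_ge0 ?expR_ge0.
rewrite mulr1; have y0 : 0 <= y by rewrite (le_trans z0)// ltW.
have := @phi_tail_le z y z0; rewrite ger0_norm// => /(_ (ltW zy)) h.
apply: (@le_trans _ _ ((1 + y ^+ 2) * phi y)).
  by rewrite ler_peMl ?phi_ge0// lerDl sqr_ge0.
apply: le_trans h _.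
rewrite [leLHS](_ : _ = phi0 * (8 * expR (- z ^+ 2 / 4) * expR (- y ^+ 2 / 8))); last by ring.
by rewrite ler_piMl ?phi0_le1// mulr_ge0 ?expR_ge0.
Qed.

(** Inside the threshold the weight cancels the Gaussian exponent and leaves a constant on an
    interval of length 2 z; outside, [phi_tail_le] applies. *)
Lemma zero_weight_mean a c z : 0 <= a -> 0 <= c -> 0 < z ->
  (\int[mu]_y (phi y * (if `|y| <= z then a * expR (y ^+ 2 / 2) else c * (1 + y ^+ 2)))%:E
   <= (2 * a * z + 8 * c * gauss8 * expR (- z ^+ 2 / 4))%:E)%E.
Proof.
move=> a0 c0 z0.
apply: (@le_trans _ _ (\int[mu]_y (a%:E * (\1_`[-z, z] y)%:E +
   (8 * c * expR (- z ^+ 2 / 4))%:E * (expR (- (y - 0) ^+ 2 / 8))%:E))%E).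
  apply: le_integral_ge0 => y _.
    rewrite lee_fin mulr_ge0 ?phi_ge0//; case: ifP => _.
      by rewrite mulr_ge0 ?expR_ge0.
    by rewrite mulr_ge0// addr_ge0 ?sqr_ge0.
  rewrite -!EFinM -EFinD lee_fin indicE mem_setE in_itv/= -ler_norml subr0.
  have e0 : 0 <= expR (- z ^+ 2 / 4) by exact: expR_ge0.
  have e1 : 0 <= expR (- y ^+ 2 / 8) by exact: expR_ge0.
  case: (leP `|y| z) => yz.
    rewrite mulr1 phiE mulNr expRN.
    rewrite (_ : _ * (a * _) = phi0 * a); last by field; rewrite gt_eqF ?expR_gt0.
    rewrite -[leLHS]addr0 lerD//; first by rewrite ler_piMl ?phi0_le1.
    by rewrite mulr_ge0// mulr_ge0// mulr_ge0.
  rewrite mulr0 add0r mulrCA mulrC (mulrC (phi _)).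
  apply: (@le_trans _ _ (8 * phi0 * expR (- z ^+ 2 / 4) * expR (- y ^+ 2 / 8) * c)).
    by apply: ler_wpM2r => //; apply: phi_tail_le; rewrite ltW.
  rewrite [leLHS](_ : _ = phi0 * (8 * c * expR (- z ^+ 2 / 4) * expR (- y ^+ 2 / 8))); last by ring.
  by rewrite ler_piMl ?phi0_le1// mulr_ge0// mulr_ge0// mulr_ge0.
have k0 : 0 <= 8 * c * expR (- z ^+ 2 / 4) by rewrite mulr_ge0 ?expR_ge0// mulr_ge0.
rewrite ge0_integralD//; last 4 first.
- by move=> y _; rewrite mule_ge0 ?lee_fin.
- by apply: emeasurable_funM => //; apply/measurable_EFinP; meas.
- by move=> y _; rewrite mule_ge0 ?lee_fin ?expR_ge0.
- by apply: emeasurable_funM => //; apply/measurable_EFinP; meas.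
rewrite ge0_integralZl//; try by apply/measurable_EFinP; meas.
rewrite ge0_integralZl//; last first.
  by apply/measurable_EFinP; meas.
rewrite integral_gauss8 integral_indic//= setIT lebesgue_measure_itv/= lte_fin.
rewrite (_ : - z < z); last by lra.
rewrite -EFinB -!EFinM -EFinD lee_fin.
by rewrite le_eqVlt; apply/orP; left; apply/eqP; ring.
Qed.

Lemma gaussian_variance_le m :
  (\int[mu]_y (phi (y - m) * (y - m) ^+ 2)%:E <= (8 * gauss8)%:E)%E.
Proof.
rewrite EFinM -(integral_gauss8 m) -ge0_integralZl//; last first.
  by apply/measurable_EFinP; meas.
apply: le_integral_ge0 => y _; first by rewrite lee_fin mulr_ge0 ?phi_ge0 ?sqr_ge0.
rewrite -EFinM lee_fin mulrC; move: (y - m) => u.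
apply: (@le_trans _ _ ((1 + u ^+ 2) * phi u)).
  by rewrite ler_wpM2r ?phi_ge0// lerDr.
apply: le_trans (@phi_tail_le 0 u _ _) _; rewrite ?normr_ge0//.
rewrite expr0n/= oppr0 mul0r expR0 mulr1 ler_wpM2r ?expR_ge0//.
by rewrite ler_piMr// phi0_le1.
Qed.

Definition test_const : R := locked (psi_lbc / 10).

Lemma test_const_gt0 : 0 < test_const.
Proof. by rewrite /test_const -lock divr_gt0 ?psi_lbc_gt0. Qed.

(** As exp(-1) <= 1/2, the mean is at most 1 - P(Y > z) / 2 <= exp(- P(Y > z) / 2). The probability
    is bounded below on ]z, 2 z], where 1 + y^2 <= 5 z^2 because z >= 1. *)
Lemma test_mgf t z : 0 < t <= 1 -> 1 <= z ->
  (\int[mu]_y (psi t y * expR (- \1_`]z, +oo[ y))%:E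
     <= (expR (- (test_const * t / z)))%:E)%E.
Proof.
move=> t01 z1; have /andP[t0 t1] := t01; have z0 : 0 < z by lra.
have mpsi : measurable_fun setT (psi t) by exact: measurable_psi.
set J := (X in (X <= _)%E).
have J0 : (0 <= J)%E.
  by apply: integral_ge0 => y _; rewrite lee_fin mulr_ge0 ?psi_ge0 ?expR_ge0.
have half : expR (-1) <= 2^-1 :> R.
  rewrite expRN lef_pV2 ?posrE ?expR_gt0//.
  by have := expR_ge1Dx (1 : R); lra.
have q : ((test_const * t / z)%:E <= \int[mu]_y (psi t y * (2^-1 * \1_`]z, +oo[ y))%:E)%E.
  apply: (@le_trans _ _ (\int[mu]_(y in `]z, (2 * z)%R])
      (psi_lbc * t / (10 * z ^+ 2))%:E)%E).
    rewrite integral_cst//= lebesgue_measure_itv/= lte_fin.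
    rewrite (_ : z < 2 * z); last by lra.
    rewrite -EFinB -EFinM lee_fin /test_const -lock.
    by rewrite le_eqVlt; apply/orP; left; apply/eqP; field; rewrite gt_eqF.
  rewrite integral_mkcond; apply: le_integral_ge0 => y _; rewrite patchE.
    by case: ifP => // _; rewrite lee_fin divr_ge0 ?mulr_ge0 ?exprn_ge0 ?(ltW psi_lbc_gt0) ?(ltW t0) ?(ltW z0).
  case: ifPn => [|_]; last by rewrite lee_fin mulr_ge0 ?psi_ge0// mulr_ge0.
  rewrite inE/= in_itv/= => /andP[zy y2z].
  rewrite lee_fin indicE mem_setE in_itv/= andbT zy mulr1.
  apply: (@le_trans _ _ (psi_lbc * t / (1 + y ^+ 2) * 2^-1)); last first.
    by rewrite ler_wpM2r// psi_lb.
  have y20 : 0 < 1 + y ^+ 2 by rewrite ltr_pwDl ?sqr_ge0.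
  rewrite [leRHS](_ : _ = psi_lbc * t * ((1 + y ^+ 2) * 2)^-1); last first.
    by field; rewrite gt_eqF.
  apply: ler_wpM2l; first by rewrite mulr_ge0 ?(ltW t0)// ltW// psi_lbc_gt0.
  rewrite lef_pV2 ?posrE ?mulr_gt0 ?exprn_gt0//.
  have : y ^+ 2 <= (2 * z) ^+ 2 by apply: lerXn2r; rewrite ?nnegrE//; lra.
  by nra.
have JD : (J + (test_const * t / z)%:E <= 1)%E.
  rewrite -(integral_psi t0) (le_trans (leeD2l J q))//.
  rewrite -ge0_integralD//; last 4 first.
  - by move=> y _; rewrite lee_fin mulr_ge0 ?psi_ge0 ?expR_ge0.
  - by apply/measurable_EFinP; meas.
  - by move=> y _; rewrite lee_fin mulr_ge0 ?psi_ge0// mulr_ge0.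
  - by apply/measurable_EFinP; meas.
  apply: le_integral_ge0 => y _.
    by rewrite -EFinD lee_fin addr_ge0// mulr_ge0 ?psi_ge0 ?expR_ge0// mulr_ge0.
  rewrite -EFinD lee_fin -mulrDr ler_piMr ?psi_ge0// indicE.
  case: (y \in _); last by rewrite oppr0 expR0 mulr0 addr0.
  by rewrite mulr1; lra.
apply: (@le_trans _ _ (1 - (test_const * t / z)%:E)%E).
  by rewrite leeBrDr.
by rewrite -EFinB lee_fin (le_trans _ (expR_ge1Dx _))//.
Qed.

End one_dim_means.

(** * Mean of phi / psi under the null *)

Section inverse_likelihood_ratio.
Context {R : realType}.
Local Notation mu := (@lebesgue_measure R).

(** For s >= 0 and E = exp(s), multiplication by E turns the claim into (E - 1)^2 <= (s E)^2. *)
Lemma cosh_le (s : R) : expR s + expR (- s) <= 2 + s ^+ 2 * expR `|s|.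
Proof.
wlog s0 : s / 0 <= s.
  move=> h; have [/h//|s0] := leP 0 s.
  have := h (- s); rewrite oppr_ge0 opprK sqrrN normrN addrC; apply; exact: ltW.
rewrite ger0_norm//.
have E0 := expR_gt0 s; have := expR_ge1Dx (- s); have := expR_ge1Dx s; rewrite expRN.
move: (expR s) E0 => E E0 E1; rewrite -[_^-1]mul1r ler_pdivlMr// => h.
rewrite -(ler_pM2r E0) mul1r mulrDl mulVf ?gt_eqF//.
have h1 : 0 <= s * E - (E - 1) by lra.
have h2 : 0 <= s * E + (E - 1) by rewrite addr_ge0 ?mulr_ge0 ?(ltW E0)//; lra.
by have := mulr_ge0 h1 h2; lra.
Qed.

Section truncated.
Variables t b : R.
Hypotheses (t01 : 0 < t <= 1) (tb : t <= b).

Let t0 : 0 < t. Proof. by have /andP[] := t01. Qed.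
Let b0 : 0 < b. Proof. exact: lt_le_trans tb. Qed.

(** The prior cut at [b]. The ratio of its marginal [psib] to [phi] has a finite Gaussian second
    moment; that of psi / phi is infinite. *)
Let hb (th : R) : R := \1_`[- b, b] th * hsd t th.

Let hbE th : hb th = if `|th| <= b then hsd t th else 0.
Proof.
by rewrite /hb indicE mem_setE in_itv/= -ler_norml; case: ifP; rewrite ?mul1r ?mul0r.
Qed.

Let hb_ge0 th : 0 <= hb th.
Proof. by rewrite hbE; case: ifP => // _; exact: hsd_ge0. Qed.

Let hb_le th : hb th <= hsd t th.
Proof. by rewrite hbE; case: ifP => // _; exact: hsd_ge0. Qed.

Let hb_even th : hb (- th) = hb th.
Proof. by rewrite !hbE normrN hsd_even. Qed.

Let mhsd : measurable_fun setT (hsd t).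
Proof. exact: measurable_hsd. Qed.

Let mhb : measurable_fun setT hb.
Proof. by rewrite /hb; meas. Qed.

Let m : R := fine (\int[mu]_th (hb th)%:E)%E.
Let S : R := fine (\int[mu]_th (th ^+ 2 * hb th)%:E)%E.

Let mE : (\int[mu]_th (hb th)%:E = m%:E)%E.
Proof.
rewrite /m fineK// ge0_fin_numE; last by apply: integral_ge0 => x _; rewrite lee_fin.
apply: (@le_lt_trans _ _ 1%E); last exact: ltry.
rewrite -(integral_hsd t0); apply: le_integral_ge0 => x _; first by rewrite lee_fin.
by rewrite lee_fin.
Qed.

Let m_ge0 : 0 <= m.
Proof. by rewrite -lee_fin -mE; apply: integral_ge0 => x _; rewrite lee_fin. Qed.

Let m_le1 : m <= 1.
Proof.
rewrite -lee_fin -mE -(integral_hsd t0); apply: le_integral_ge0 => x _; first by rewrite lee_fin.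
by rewrite lee_fin.
Qed.

Let S_ub : (\int[mu]_th (th ^+ 2 * hb th)%:E <= (20 * (b * t))%:E)%E.
Proof.
apply: (@le_trans _ _ (\int[mu]_th ((10 * t)%:E * (\1_`[- b, b] th)%:E))%E).
  apply: le_integral_ge0 => x _; first by rewrite lee_fin mulr_ge0 ?sqr_ge0.
  by rewrite -EFinM lee_fin /hb mulrCA [leRHS]mulrC ler_wpM2l ?hsd_ub.
rewrite ge0_integralZl//; last 2 first.
- by apply/measurable_EFinP; meas.
- by rewrite lee_fin mulr_ge0// ltW.
rewrite integral_indic//= setIT lebesgue_measure_itv/= lte_fin.
rewrite (_ : - b < b); last by have := b0; lra.
by rewrite -EFinB -EFinM lee_fin (_ : 10 * t * (b - - b) = 20 * (b * t))//; ring.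
Qed.

Let SE : (\int[mu]_th (th ^+ 2 * hb th)%:E = S%:E)%E.
Proof.
rewrite /S fineK// ge0_fin_numE; last first.
  by apply: integral_ge0 => x _; rewrite lee_fin mulr_ge0 ?sqr_ge0.
exact: le_lt_trans S_ub (ltry _).
Qed.

Let S_ge0 : 0 <= S.
Proof.
by rewrite -lee_fin -SE; apply: integral_ge0 => x _; rewrite lee_fin mulr_ge0 ?sqr_ge0.
Qed.

Let S_le : S <= 20 * (b * t). Proof. by rewrite -lee_fin -SE. Qed.

(** Beyond [b] the density is at most 10 t / th^2, which is integrated over both tails. *)
Let m_lb : 1 - m <= 20 * (t / b).
Proof.
pose r (x : R) : \bar R := (\1_`[b, +oo[ x * x ^- 2)%:E.
have mr : measurable_fun setT r by apply/measurable_EFinP; meas.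
have r0 x : (0 <= r x)%E by rewrite lee_fin mulr_ge0// invr_ge0 sqr_ge0.
have mrN : measurable_fun setT (fun x : R => r (- x)).
  by apply: (measurableT_comp mr); meas.
have ri : (\int[mu]_x r x = (b^-1)%:E)%E.
  by rewrite -(integral_sqr_inv b0) integral_restrict_ind.
have riN : (\int[mu]_x r (- x)%R = (b^-1)%:E)%E by rewrite ge0_integral_opp.
suff : (1 <= m%:E + (10 * t)%:E * (b^-1%:E + b^-1%:E))%E.
  rewrite -[1%E]/(1%:E) -!(EFinM, EFinD) lee_fin => h; rewrite lerBlDl.
  by apply: le_trans h _; rewrite lerD2l; lra.
have k0 : (0 <= (10 * t)%:E)%E by rewrite lee_fin mulr_ge0// ltW.
have mhbE : measurable_fun setT (fun x => (hb x)%:E) by exact/measurable_EFinP.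
have mrr := emeasurable_funD mr mrN.
rewrite -[X in (_ <= _ + _ * (X + _))%E]ri -riN -ge0_integralD//.
rewrite -ge0_integralZl//; last by move=> x _; exact: adde_ge0.
rewrite -mE -ge0_integralD//; last 3 first.
- by move=> x _; rewrite lee_fin.
- by move=> x _; apply: mule_ge0 => //; exact: adde_ge0.
- by apply: emeasurable_funM.
rewrite -(integral_hsd t0); apply: le_integral_ge0 => x _; first by rewrite lee_fin hsd_ge0.
rewrite hbE; case: (leP `|x| b) => [_|bx].
  rewrite -[leLHS]adde0 leeD2l// mule_ge0// adde_ge0//.
rewrite add0e /r -EFinD -EFinM lee_fin sqrrN -mulrDl.
have x2 : 0 < x ^+ 2 by rewrite -(real_normK (num_real x)) exprn_gt0// (lt_trans b0).
apply: (@le_trans _ _ (10 * t * x ^- 2)).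
  by rewrite ler_pdivlMr// mulrC hsd_ub.
apply: ler_wpM2l; first by rewrite mulr_ge0// ltW.
rewrite ler_peMl ?invr_ge0 ?(ltW x2)//.
rewrite !indicE !mem_setE !in_itv/= !andbT.
move: bx; rewrite ltr_normr => /orP[] /ltW ->; by rewrite ?lerDl ?lerDr.
Qed.

Let psib (y : R) : R := fine (\int[mu]_th (hb th * phi (y - th))%:E)%E.

Let mhbphi (y : R) : measurable_fun setT (fun th : R => (hb th * phi (y - th))%:E).
Proof. by apply/measurable_EFinP; meas. Qed.

Let hbphi_ge0 (y th : R) : (0 <= (hb th * phi (y - th))%:E)%E.
Proof. by rewrite lee_fin mulr_ge0 ?phi_ge0. Qed.

Let hbphi_le (y : R) : (\int[mu]_th (hb th * phi (y - th))%:E <= (psi t y)%:E)%E.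
Proof.
rewrite -psiE//; apply: le_integral_ge0 => x _; first exact: hbphi_ge0.
by rewrite lee_fin ler_wpM2r ?phi_ge0.
Qed.

Let psibE (y : R) : (\int[mu]_th (hb th * phi (y - th))%:E = (psib y)%:E)%E.
Proof.
rewrite /psib fineK// ge0_fin_numE; last by apply: integral_ge0.
exact: le_lt_trans (hbphi_le y) (ltry _).
Qed.

Let psib_le (y : R) : psib y <= psi t y. Proof. by rewrite -lee_fin -psibE. Qed.

(** The range t / 2 <= |th| <= t used for [psi_lb0] lies inside [-b, b], so the truncation keeps the
    same constant. *)
Let psib_lb (y : R) : psi_lbc0 * phi y <= psib y.
Proof.
have t0' := t0.
have c0 : 0 <= hs_lb / (4 * t) * phi y.
  by rewrite mulr_ge0 ?phi_ge0// divr_ge0 ?mulr_ge0 ?(ltW hs_lb_gt0) ?(ltW t0).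
have -> : psi_lbc0 * phi y = hs_lb / (4 * t) * phi y * (t / 2).
  by rewrite /psi_lbc0 -lock; field; rewrite gt_eqF.
have F0 (th : R) : 0 <= hb th * phi (y - th) by rewrite mulr_ge0 ?phi_ge0.
have mF : measurable_fun setT (fun th : R => hb th * phi (y - th)) by meas.
rewrite -lee_fin -psibE; have [y0|y0] := leP 0 y.
  rewrite [t / 2](_ : _ = t - t / 2); last by lra.
  apply: integral_lower => //; first by lra.
  move=> th /andP[ha hb']; have th0 : 0 <= th by lra.
  rewrite hbE ger0_norm// (le_trans hb' tb).
  by apply: hsd_phi_lb => //; [rewrite ger0_norm ?ha|rewrite mulr_ge0].
rewrite [t / 2](_ : _ = - (t / 2) - - t); last by lra.
apply: integral_lower => //; first by lra.
move=> th /andP[ha hb']; have th0 : th <= 0 by lra.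
have th1 : `|th| <= t by rewrite ler0_norm//; lra.
rewrite hbE (le_trans th1 tb); apply: hsd_phi_lb => //; last by rewrite mulr_le0// ltW.
by rewrite th1 andbT ler0_norm//; lra.
Qed.

Let mpsib : measurable_fun setT psib.
Proof.
apply: measurableT_comp => //.
pose f (z : R * R) : \bar R := (hb z.2 * phi (z.1 - z.2))%:E.
rewrite (_ : (fun y => _) = fubini_F mu f)//.
apply: measurable_fun_fubini_tonelli_F; last by move=> z; exact: hbphi_ge0.
apply/measurable_EFinP; apply: measurable_funM; last by meas.
exact: (measurableT_comp mhb).
Qed.

Let integral_psib : (\int[mu]_y (psib y)%:E = m%:E)%E.
Proof.
pose f (z : R * R) : \bar R := (hb z.2 * phi (z.1 - z.2))%:E.
have mf : measurable_fun setT f.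
  apply/measurable_EFinP; apply: measurable_funM; last by meas.
  exact: (measurableT_comp mhb).
have f0 x : (0 <= f x)%E by exact: hbphi_ge0.
transitivity (\int[mu]_y \int[mu]_th f (y, th))%E.
  by apply: eq_integral => y _; rewrite -psibE.
rewrite (fubini_tonelli (m1 := mu) (m2 := mu) f)// -mE.
apply: eq_integral => th _; rewrite -[RHS]mule1 -(integral_phi th).
rewrite -ge0_integralZl//.
- by apply/measurable_EFinP; meas.
- by move=> y _; rewrite lee_fin phi_ge0.
- by rewrite lee_fin.
Qed.

(** Pairing [th] with [- th] removes the linear term from the expansion of the likelihood ratio, so
    that only the second moment [S] enters. *)
Let sym (y : R) :
  (\int[mu]_th (hb th * (phi (y - th) + phi (y + th)))%:E = (2 * psib y)%:E)%E.
Proof.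
have sE : (\int[mu]_th (hb th * phi (y + th))%:E = (psib y)%:E)%E.
  rewrite -psibE -[RHS]ge0_integral_opp//.
  by apply: eq_integral => th _; rewrite hb_even opprK.
have mp : measurable_fun setT (fun th : R => (hb th * phi (y + th))%:E).
  by apply/measurable_EFinP; meas.
have p0 (th : R) : (0 <= (hb th * phi (y + th))%:E)%E.
  by rewrite lee_fin mulr_ge0 ?phi_ge0.
have mq := mhbphi y; have q0 := hbphi_ge0 y.
rewrite mulr_natl mulr2n EFinD -{2}sE -psibE -ge0_integralD//.
by apply: eq_integral => th _; rewrite -EFinD mulrDr.
Qed.

(** Dominates y^2 exp(b |y|), the coefficient of th^2 that [cosh_le] gives for |th| <= b, and is
    never below 2. *)
Let H (y : R) : R := (1 + y ^+ 2) * (expR (b * y) + expR (- (b * y))).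

Let H_ge2 y : 2 <= H y.
Proof.
have h1 := expR_ge1Dx (b * y); have h2 := expR_ge1Dx (- (b * y)).
apply: (@le_trans _ _ (1 * (expR (b * y) + expR (- (b * y))))); first by lra.
by rewrite /H ler_wpM2r ?addr_ge0 ?expR_ge0// lerDl sqr_ge0.
Qed.

Let pairE (y th : R) : phi (y - th) + phi (y + th) =
  phi y * (expR (th * y - th ^+ 2 / 2) + expR (- (th * y) - th ^+ 2 / 2)).
Proof.
rewrite mulrDr phi_tilt; congr (_ + _).
by have := phi_tilt (- th) y; rewrite sqrrN mulNr opprK.
Qed.

Let mhbE : measurable_fun setT (fun th : R => (hb th)%:E).
Proof. exact/measurable_EFinP. Qed.

Let mhb2E : measurable_fun setT (fun th : R => (th ^+ 2 * hb th)%:E).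
Proof. by apply/measurable_EFinP; meas. Qed.

Let hbE_ge0 (th : R) : (0 <= (hb th)%:E)%E. Proof. by rewrite lee_fin. Qed.

Let hb2E_ge0 (th : R) : (0 <= (th ^+ 2 * hb th)%:E)%E.
Proof. by rewrite lee_fin mulr_ge0 ?sqr_ge0. Qed.

Let psib_ub_m (y : R) : psib y <= phi y * (m + S * H y).
Proof.
have p0 : 0 <= 2 * phi y by rewrite mulr_ge0 ?phi_ge0.
have H0 : 0 <= H y by apply: le_trans (H_ge2 y).
suff : ((2 * psib y)%:E <= (2 * phi y)%:E * (m%:E + (H y)%:E * S%:E))%E.
  by rewrite -!(EFinM, EFinD) lee_fin; lra.
have H0E : (0 <= (H y)%:E)%E by rewrite lee_fin.
have p0E : (0 <= (2 * phi y)%:E)%E by rewrite lee_fin.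
have mHs : measurable_fun setT (fun th : R => ((H y)%:E * (th ^+ 2 * hb th)%:E)%E).
  exact: emeasurable_funM.
have Hs0 (th : R) : (0 <= (H y)%:E * (th ^+ 2 * hb th)%:E)%E by exact: mule_ge0.
have mD := emeasurable_funD mhbE mHs.
have D0 (th : R) : (0 <= (hb th)%:E + (H y)%:E * (th ^+ 2 * hb th)%:E)%E by exact: adde_ge0.
rewrite -sym -mE -SE -ge0_integralZl// -ge0_integralD// -ge0_integralZl//.
apply: le_integral_ge0 => th _; first by rewrite lee_fin mulr_ge0 ?addr_ge0 ?phi_ge0.
rewrite -!(EFinM, EFinD) lee_fin.
rewrite [leRHS](_ : _ = hb th * (phi y * (2 + 2 * (th ^+ 2 * H y)))); last by ring.
rewrite hbE; case: (leP `|th| b) => thb; last by rewrite !mul0r.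
rewrite ler_wpM2l ?hsd_ge0// pairE ler_wpM2l ?phi_ge0//.
have q0 := sqr_ge0 th.
apply: (@le_trans _ _ (expR (th * y) + expR (- (th * y)))).
  by apply: lerD; rewrite ler_expR; lra.
apply: le_trans (cosh_le _) _; rewrite lerD2l.
have eb : expR `|th * y| <= expR (b * y) + expR (- (b * y)).
  apply: (@le_trans _ _ (expR (b * `|y|))).
    by rewrite ler_expR normrM ler_wpM2r.
  have := expR_ge0 (b * y); have := expR_ge0 (- (b * y)).
  by case: (ger0P y) => _; rewrite ?mulrN; lra.
have e0 : 0 <= expR (b * y) + expR (- (b * y)) by rewrite addr_ge0 ?expR_ge0.
apply: (@le_trans _ _ (th ^+ 2 * (y ^+ 2 * (expR (b * y) + expR (- (b * y)))))).
  by rewrite exprMn -mulrA ler_wpM2l// ler_wpM2l ?sqr_ge0.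
rewrite [leRHS]mulrCA ler_wpM2l// /H.
have := sqr_ge0 y; move: (y ^+ 2) (_ + expR _) e0 => z e e0 z0.
by have := mulr_ge0 z0 e0; lra.
Qed.

Let psib_lb_m (y : R) : phi y * m <= psib y + phi y * S.
Proof.
have p0 : 0 <= 2 * phi y by rewrite mulr_ge0 ?phi_ge0.
suff : ((2 * phi y)%:E * m%:E <= (2 * psib y)%:E + (2 * phi y)%:E * S%:E)%E.
  by rewrite -!EFinM -EFinD lee_fin; lra.
have p0E : (0 <= (2 * phi y)%:E)%E by rewrite lee_fin.
have mp : measurable_fun setT (fun th : R => (hb th * (phi (y - th) + phi (y + th)))%:E).
  by apply/measurable_EFinP; meas.
have hp0 (th : R) : (0 <= (hb th * (phi (y - th) + phi (y + th)))%:E)%E.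
  by rewrite lee_fin mulr_ge0// addr_ge0 ?phi_ge0.
have mHs : measurable_fun setT (fun th : R => ((2 * phi y)%:E * (th ^+ 2 * hb th)%:E)%E).
  exact: emeasurable_funM.
have Hs0 (th : R) : (0 <= (2 * phi y)%:E * (th ^+ 2 * hb th)%:E)%E by exact: mule_ge0.
rewrite -sym -mE -SE -ge0_integralZl// -ge0_integralZl// -ge0_integralD//.
apply: le_integral_ge0 => th _; first by rewrite -EFinM lee_fin mulr_ge0.
rewrite -!(EFinM, EFinD) lee_fin pairE.
rewrite [leLHS](_ : _ = hb th * phi y * 2); last by ring.
rewrite [leRHS](_ : _ = hb th * phi y * (2 * th ^+ 2 +
  (expR (th * y - th ^+ 2 / 2) + expR (- (th * y) - th ^+ 2 / 2)))); last by ring.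
apply: ler_wpM2l; first by apply: mulr_ge0 => //; exact: phi_ge0.
have h1 := expR_ge1Dx (th * y - th ^+ 2 / 2).
have h2 := expR_ge1Dx (- (th * y) - th ^+ 2 / 2).
by have := sqr_ge0 th; lra.
Qed.

(** Completing the square, y^2 / 4 + 2 b |y| <= 8 b^2 + 3 y^2 / 8; this is the origin of exp(8 b^2).
    The term y^2 / 4 pays for (1 + y^2)^2. *)
Let H2_le (y : R) : phi y * H y ^+ 2 <=
  256 * expR (8 * b ^+ 2) * expR (- (y - 0) ^+ 2 / 8).
Proof.
rewrite subr0; have [u2 v2] : expR (b * y) ^+ 2 = expR (2 * b * y) /\
    expR (- (b * y)) ^+ 2 = expR (- (2 * b * y)).
  by split; rewrite -expRM_natl; congr expR; ring.
have h1 : H y ^+ 2 <= (1 + y ^+ 2) ^+ 2 * (2 * (expR (2 * b * y) + expR (- (2 * b * y)))).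
  rewrite /H exprMn -u2 -v2 ler_wpM2l ?sqr_ge0//.
  by have := sqr_ge0 (expR (b * y) - expR (- (b * y))); lra.
have h2 : (1 + y ^+ 2) ^+ 2 <= 64 * expR (y ^+ 2 / 4).
  have e : 1 + y ^+ 2 <= 8 * expR (y ^+ 2 / 8).
    by have := expR_ge1Dx (y ^+ 2 / 8); have := sqr_ge0 y; lra.
  have -> : expR (y ^+ 2 / 4) = expR (y ^+ 2 / 8) ^+ 2.
    by rewrite -expRM_natl; congr expR; field.
  rewrite (_ : 64 * _ = (8 * expR (y ^+ 2 / 8)) ^+ 2); last by ring.
  by apply: lerXn2r; rewrite // nnegrE ?mulr_ge0 ?expR_ge0 ?addr_ge0 ?sqr_ge0.
have h3 (c : R) : (c = 2 * b * y) \/ (c = - (2 * b * y)) ->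
    expR (y ^+ 2 / 4) * expR c <= expR (8 * b ^+ 2) * expR (y ^+ 2 / 2) * expR (- y ^+ 2 / 8).
  move=> ce; rewrite -!expRD ler_expR.
  case: ce => ->.
    by have := sqr_ge0 (y - 8 * b); lra.
  by have := sqr_ge0 (y + 8 * b); lra.
have h4 := h3 _ (or_introl erefl); have h5 := h3 _ (or_intror erefl).
have e0 : 0 <= 2 * (expR (2 * b * y) + expR (- (2 * b * y))).
  by rewrite mulr_ge0// addr_ge0 ?expR_ge0.
have h6 : H y ^+ 2 <= 256 * (expR (8 * b ^+ 2) * expR (y ^+ 2 / 2) * expR (- y ^+ 2 / 8)).
  apply: le_trans h1 _; apply: le_trans (ler_wpM2r e0 h2) _.
  by lra.
apply: le_trans (ler_wpM2l (phi_ge0 y) h6) _.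
rewrite phiE mulNr expRN.
rewrite [leLHS](_ : _ = phi0 * (256 * expR (8 * b ^+ 2) * expR (- y ^+ 2 / 8))); last first.
  by field; rewrite gt_eqF ?expR_gt0.
apply: ler_piMl; last exact: phi0_le1.
by apply: mulr_ge0; [apply: mulr_ge0; [exact: ler0n|exact: expR_ge0]|exact: expR_ge0].
Qed.

(** For x = psib / phi, the identity 1/x + x = 2 + (x - 1)^2 / x has no linear term, and x >=
    [psi_lbc0] bounds the quotient. Adding [psib] on the left loses nothing, its integral [m] being
    known exactly; bounding |x - 1| instead would leave an error of order b t, not its square. *)
Let pointwise (y : R) : phi y * (phi y / psi t y) + psib y <= 2 * phi y +
  (2 * S ^+ 2 * (256 * expR (8 * b ^+ 2) * expR (- (y - 0) ^+ 2 / 8)) +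
   2 * (1 - m) ^+ 2 * phi y) / psi_lbc0.
Proof.
have c0 := psi_lbc0_gt0 (R := R); have p0 := phi_gt0 y.
pose x := psib y / phi y.
have xlb : psi_lbc0 <= x by rewrite ler_pdivlMr// psib_lb.
have x0 : 0 < x by exact: lt_le_trans xlb.
have px : psib y = x * phi y by rewrite /x divfK// gt_eqF.
have H2 := H_ge2 y.
have xub : x <= m + S * H y by rewrite ler_pdivrMr// mulrC psib_ub_m.
have xlb' : m <= x + S.
  by rewrite -(ler_pM2l p0) mulrDr (mulrC _ x) -px psib_lb_m.
have SH : S <= S * H y by rewrite ler_peMr//; lra.
have xm : (x - m) ^+ 2 <= (S * H y) ^+ 2.
  rewrite -(real_normK (num_real (x - m))); apply: lerXn2r; rewrite ?nnegrE//.
    by rewrite mulr_ge0//; lra.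
  by rewrite ler_norml; apply/andP; split; lra.
have i1 : phi y / psi t y <= x^-1.
  rewrite /x invf_div ler_pM2l// lef_pV2 ?posrE ?psi_gt0//.
  by rewrite px mulr_gt0.
have i2 : x^-1 + x <= 2 + (x - 1) ^+ 2 / psi_lbc0.
  apply: (@le_trans _ _ (2 + (x - 1) ^+ 2 / x)).
    by rewrite le_eqVlt; apply/orP; left; apply/eqP; field; rewrite gt_eqF.
  by rewrite lerD2l ler_wpM2l ?sqr_ge0// lef_pV2.
have i3 : (x - 1) ^+ 2 <= 2 * (S ^+ 2 * H y ^+ 2) + 2 * (1 - m) ^+ 2.
  rewrite -exprMn; apply: (@le_trans _ _ (2 * (x - m) ^+ 2 + 2 * (1 - m) ^+ 2)).
    by have := sqr_ge0 ((x - m) + (1 - m)); lra.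
  by lra.
rewrite px; apply: (@le_trans _ _ (phi y * (2 + (x - 1) ^+ 2 / psi_lbc0))).
  rewrite (mulrC x) -mulrDr ler_wpM2l ?(ltW p0)//.
  by apply: le_trans i2; rewrite lerD2r.
rewrite mulrDr (mulrC _ 2) lerD2l mulrA ler_pM2r ?invr_gt0//.
apply: le_trans (ler_wpM2l (ltW p0) i3) _.
have := ler_wpM2l (sqr_ge0 S) (H2_le y); lra.
Qed.

Definition inv_const : R := locked (20 * (1 + 2 / psi_lbc0) + 400 * (512 * (gauss8 / psi_lbc0))).

(** The term t / b comes from the truncated mass 1 - m, the other from S^2 times the Gaussian mean
    of H^2; [b] is chosen later to balance them. *)
Lemma inverse_ratio_mean :
  (\int[mu]_y (phi y * (phi y / psi t y))%:E <=
    (1 + inv_const * (t / b + b ^+ 2 * t ^+ 2 * expR (8 * b ^+ 2)))%:E)%E.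
Proof.
have c0 := psi_lbc0_gt0 (R := R); have g0 := gauss8_gt0 (R := R).
set J := (X in (X <= _)%E).
have mpsi : measurable_fun setT (psi t) by exact: measurable_psi.
have J0 : (0 <= J)%E.
  by apply: integral_ge0 => y _; rewrite lee_fin mulr_ge0 ?divr_ge0 ?phi_ge0 ?psi_ge0.
pose k := 2 * S ^+ 2 * (256 * expR (8 * b ^+ 2)) / psi_lbc0.
pose l := 2 + 2 * (1 - m) ^+ 2 / psi_lbc0.
have k0 : 0 <= k.
  apply: divr_ge0; last exact: ltW.
  apply: mulr_ge0; first by rewrite mulr_ge0 ?sqr_ge0.
  by apply: mulr_ge0; [exact: ler0n|exact: expR_ge0].
have l0 : 0 <= l by rewrite addr_ge0// divr_ge0 ?(ltW c0)// mulr_ge0 ?sqr_ge0.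
have JD : (J + m%:E <= (k * gauss8 + l)%:E)%E.
  have mphiE : measurable_fun setT (fun y : R => (phi y)%:E).
    by apply/measurable_EFinP; meas.
  have mgE : measurable_fun setT (fun y : R => (expR (- (y - 0) ^+ 2 / 8))%:E).
    by apply/measurable_EFinP; meas.
  have phiE1 : (\int[mu]_y (phi y)%:E = 1)%E.
    by rewrite -(integral_phi 0); apply: eq_integral => y _; rewrite subr0.
  rewrite -integral_psib -ge0_integralD//; last 4 first.
  - by move=> y _; rewrite lee_fin mulr_ge0 ?divr_ge0 ?phi_ge0 ?psi_ge0.
  - by apply/measurable_EFinP; meas.
  - by move=> y _; rewrite -psibE; apply: integral_ge0.
  - exact/measurable_EFinP.
  apply: (@le_trans _ _ (\int[mu]_y (k%:E * (expR (- (y - 0) ^+ 2 / 8))%:E +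
      l%:E * (phi y)%:E))%E).
    apply: le_integral_ge0 => y _.
      rewrite -EFinD lee_fin addr_ge0//.
        by rewrite mulr_ge0 ?divr_ge0 ?phi_ge0 ?psi_ge0.
      by rewrite -lee_fin -psibE; apply: integral_ge0.
    rewrite -!(EFinM, EFinD) lee_fin (le_trans (pointwise y))//.
    by rewrite le_eqVlt; apply/orP; left; apply/eqP; rewrite /k /l; ring.
  rewrite ge0_integralD//; last 4 first.
  - by move=> y _; rewrite mule_ge0 ?lee_fin ?expR_ge0.
  - exact: emeasurable_funM.
  - by move=> y _; rewrite mule_ge0 ?lee_fin ?phi_ge0.
  - exact: emeasurable_funM.
  rewrite ge0_integralZl// ge0_integralZl//; last by move=> y _; rewrite lee_fin phi_ge0.
  by rewrite integral_gauss8 phiE1 mule1 -!(EFinM, EFinD).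
apply: (@le_trans _ _ ((k * gauss8 + l)%:E - m%:E)%E); first by rewrite leeBrDr.
rewrite -EFinB lee_fin /inv_const -lock.
have d0 : 0 <= 1 - m by rewrite subr_ge0.
have d1 : (1 - m) ^+ 2 <= 1 - m by rewrite expr2 ler_piMl//; have := m_ge0; lra.
have S2 : S ^+ 2 <= 400 * (b ^+ 2 * t ^+ 2).
  rewrite (_ : 400 * _ = (20 * (b * t)) ^+ 2); last by ring.
  by apply: lerXn2r; rewrite // nnegrE ?mulr_ge0 ?(ltW b0) ?(ltW t0).
have ci : 0 <= psi_lbc0^-1 :> R by rewrite invr_ge0 ltW.
have k1 : k * gauss8 <= 400 * (512 * (gauss8 / psi_lbc0)) * (b ^+ 2 * t ^+ 2 * expR (8 * b ^+ 2)).
  rewrite /k [leLHS](_ : _ = S ^+ 2 * (512 * expR (8 * b ^+ 2) * gauss8 / psi_lbc0)); last by ring.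
  rewrite [leRHS](_ : _ = 400 * (b ^+ 2 * t ^+ 2) *
    (512 * expR (8 * b ^+ 2) * gauss8 / psi_lbc0)); last by ring.
  apply: ler_wpM2r S2; apply: divr_ge0; last exact: ltW.
  by apply: mulr_ge0; [apply: mulr_ge0; [exact: ler0n|exact: expR_ge0]|exact: ltW].
have l1 : l - m <= 1 + 20 * (1 + 2 / psi_lbc0) * (t / b).
  rewrite /l; have := ler_wpM2r ci d1; have := ler_wpM2r ci m_lb; have := m_lb.
  by lra.
have tb0 : 0 <= t / b by rewrite divr_ge0// ltW.
have e0 : 0 <= b ^+ 2 * t ^+ 2 * expR (8 * b ^+ 2).
  by rewrite mulr_ge0 ?expR_ge0// mulr_ge0 ?sqr_ge0.
have A0 : 0 <= 20 * (1 + 2 / psi_lbc0) :> R by rewrite mulr_ge0// addr_ge0// mulr_ge0.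
have B0 : 0 <= 400 * (512 * (gauss8 / psi_lbc0)) :> R by do 2 (apply: mulr_ge0; first exact: ler0n); apply: divr_ge0; exact: ltW.
move: (20 * (1 + 2 / psi_lbc0)) (400 * (512 * (gauss8 / psi_lbc0))) A0 B0 k1 l1 => A B A0 B0 k1 l1.
have := mulr_ge0 A0 e0; have := mulr_ge0 B0 tb0; lra.
Qed.

End truncated.

End inverse_likelihood_ratio.

(** * The posterior in n dimensions *)

Section product_model.
Context {R : realType}.
Local Notation mu := (@lebesgue_measure R).
Local Notation Rn n := (n.-tuple (measurableTypeR R)).

Lemma integral_normal_prob m (h : R -> \bar R) :
  measurable_fun setT h -> (forall x, 0 <= h x)%E ->
  (\int[normal_prob m 1]_x h x = \int[mu]_x (h x * (phi (x - m))%:E))%E.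
Proof.
move=> mh h0; rewrite (@integral_density _ _ R mu (normal_prob m 1) (normal_pdf m 1))//.
- by apply: eq_integral => x _; rewrite normal_pdf_phi.
- exact: measurable_normal_pdf.
- by move=> x; exact: normal_pdf_ge0.
Qed.

Lemma integral_data_law n (th0 : Rn n) (h : 'I_n -> R -> R) :
  (forall i, measurable_fun setT (h i)) -> (forall i x, 0 <= h i x) ->
  (\int[data_law th0]_y (\prod_(i < n) h i (tnth y i))%:E =
   \big[mule/1]_(i < n) \int[mu]_x (phi (x - tnth th0 i) * h i x)%:E)%E.
Proof.
move=> mh h0.
transitivity (\big[mule/1]_(i < n) \int[normal_prob (tnth th0 i) 1]_x (h i x)%:E)%E.
  rewrite -(integral_tuple_prod (T := measurableTypeR R)
    (fun i => normal_prob (tnth th0 i) 1) (h := fun i x => (h i x)%:E)); last 2 first.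
  - by move=> i; apply/measurable_EFinP; exact: mh.
  - by move=> i x; rewrite lee_fin; exact: h0.
  by apply: eq_integral => y _; rewrite -prodEFin.
apply: eq_bigr => i _; rewrite integral_normal_prob; last 2 first.
- exact/measurable_EFinP.
- by move=> x; rewrite lee_fin.
by apply: eq_integral => x _; rewrite -EFinM mulrC.
Qed.

Lemma integral_data_law_coord n (th0 : Rn n) (i : 'I_n) (h : R -> R) :
  measurable_fun setT h -> (forall x, 0 <= h x) ->
  (\int[data_law th0]_y (h (tnth y i))%:E =
   \int[mu]_x (phi (x - tnth th0 i) * h x)%:E)%E.
Proof.
move=> mh h0.
transitivity (\int[normal_prob (tnth th0 i) 1]_x (h x)%:E)%E.
  rewrite -(@integral_tuple_coord _ (measurableTypeR R) R n
    (fun i => normal_prob (tnth th0 i) 1) i (fun x => (h x)%:E))//.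
  - by move=> j; exact: probability_setT.
  - by apply/measurable_EFinP; exact: mh.
rewrite integral_normal_prob; last 2 first.
- exact/measurable_EFinP.
- by move=> x; rewrite lee_fin.
by apply: eq_integral => x _; rewrite -EFinM mulrC.
Qed.

(** The factors [h i] let one factorization serve twice: all equal to 1 for the evidence, a square
    at a single index for the second moment of that coordinate. *)
Lemma integral_likelihood n (t : R) (y : Rn n) (h : 'I_n -> R -> R) : 0 < t ->
  (forall i, measurable_fun setT (h i)) -> (forall i x, 0 <= h i x) ->
  (\int[lebesgue_tuple n]_th
     (\big[mule/1]_(i < n) horseshoe_pdf t (tnth th i) *
      (\prod_(i < n) normal_pdf (tnth th i) 1 (tnth y i))%:E *
      (\prod_(i < n) h i (tnth th i))%:E) =
   \big[mule/1]_(i < n) \int[mu]_x (hsd t x * phi (tnth y i - x) * h i x)%:E)%E.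
Proof.
move=> t0 mh h0.
have mhs : measurable_fun setT (horseshoe_pdf t).
  rewrite -(gtr0_norm t0).
  exact: (measurableT_comp measurable_horseshoe_pdf2 (pair1_measurable t)).
pose q i x : R := phi (tnth y i - x) * h i x.
have mq i : measurable_fun setT (q i).
  by apply: measurable_funM => //; meas.
have q0 i x : 0 <= q i x by rewrite mulr_ge0 ?phi_ge0.
pose k i x : \bar R := (horseshoe_pdf t x * (q i x)%:E)%E.
transitivity (\int[lebesgue_tuple n]_th \big[mule/1]_(i < n) k i (tnth th i))%E.
  apply: eq_integral => th _; rewrite -muleA -EFinM -big_split/= -prodEFin -big_split/=.
  by apply: eq_bigr => i _; rewrite normal_pdf_phi.
have mk i : measurable_fun setT (k i).
  by apply: emeasurable_funM => //; exact/measurable_EFinP.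
have k0 i x : (0 <= k i x)%E by rewrite mule_ge0 ?lee_fin// horseshoe_pdf_ge0// ltW.
transitivity (\big[mule/1]_(i < n) \int[mu]_x k i x)%E.
  exact: (@integral_tuple_prod _ (measurableTypeR R) R n (fun=> mu) k mk k0).
apply: eq_bigr => i _; rewrite integral_horseshoe_pdf_mul//.
by apply: eq_integral => x _; rewrite mulrA.
Qed.

Definition margin n (t : R) (y : Rn n) : R := \prod_(i < n) psi t (tnth y i).

Let inner n t (y : Rn n) (A : set (Rn n)) : \bar R :=
  (\int[lebesgue_tuple n]_(theta in A)
       (\big[mule/1]_(i < n) horseshoe_pdf t (tnth theta i) *
        (\prod_(i < n) normal_pdf (tnth theta i) 1 (tnth y i))%R%:E))%E.

Let integrand_ge0 n t (y th : Rn n) : 0 < t ->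
  (0 <= \big[mule/1]_(i < n) horseshoe_pdf t (tnth th i) *
        (\prod_(i < n) normal_pdf (tnth th i) 1 (tnth y i))%R%:E)%E.
Proof.
move=> t0; apply: mule_ge0; first by apply: prode_ge0 => i; rewrite horseshoe_pdf_ge0// ltW.
by rewrite lee_fin prodr_ge0// => i _; exact: normal_pdf_ge0.
Qed.

Let inner_setT n t (y : Rn n) : 0 < t -> inner t y setT = (margin t y)%:E.
Proof.
move=> t0; have := @integral_likelihood n t y (fun _ _ => 1) t0.
move=> /(_ (fun=> measurable_cst _) (fun _ _ => ler01)) h.
rewrite /inner; transitivity (\big[mule/1]_(i < n) \int[mu]_x (hsd t x * phi (tnth y i - x) * 1)%:E)%E.
  rewrite -h; apply: eq_integral => th _.
  by rewrite (_ : (\prod_(i < n) (1 : R))%:E = 1%E) ?mule1// big1.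
rewrite /margin -prodEFin; apply: eq_bigr => i _; rewrite -psiE//.
by apply: eq_integral => x _; rewrite mulr1.
Qed.

Let inner_subset n t (y : Rn n) A : 0 < t -> (inner t y A <= (margin t y)%:E)%E.
Proof.
move=> t0; rewrite -inner_setT// /inner integral_mkcond.
apply: le_integral_ge0 => th _; rewrite patchE; case: ifP => // _; exact: integrand_ge0.
Qed.

Lemma margin_ge0 n t (y : Rn n) : 0 <= margin t y.
Proof. by apply: prodr_ge0 => i _; exact: psi_ge0. Qed.

(** Markov's inequality for the squared distance, written as a sum over [i] of products whose only
    nonconstant factor sits at [i]. Each product factorizes, and the other coordinates reproduce
    their marginals. *)
Let inner_far n t (y th0 : Rn n) (r : R) (w : 'I_n -> R) : 0 < t -> 0 < r ->
  (forall i, 0 <= w i) ->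
  (forall i, (\int[mu]_x (hsd t x * phi (tnth y i - x) * (x - tnth th0 i) ^+ 2)%:E
     <= (w i * psi t (tnth y i))%:E)%E) ->
  (inner t y [set th : Rn n | (r <= l2dist th th0)%R] <=
   (r ^- 2 * (\sum_(i < n) w i) * margin t y)%:E)%E.
Proof.
move=> t0 r0 w0 hw.
pose h i j (x : R) : R := if j == i then (x - tnth th0 i) ^+ 2 else 1.
have mh i j : measurable_fun setT (h i j).
  by rewrite /h; case: (j == i); meas.
have h0 i j x : 0 <= h i j x by rewrite /h; case: ifP => _; rewrite ?sqr_ge0.
pose f (th : Rn n) := (\big[mule/1]_(i < n) horseshoe_pdf t (tnth th i) *
        (\prod_(i < n) normal_pdf (tnth th i) 1 (tnth y i))%R%:E)%E.
have f0 th : (0 <= f th)%E by exact: integrand_ge0.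
have mf : measurable_fun setT f.
  apply: emeasurable_funM.
    apply: (measurable_prod_tnth (h := fun=> horseshoe_pdf t)) => _.
    rewrite -(gtr0_norm t0).
    exact: (measurableT_comp measurable_horseshoe_pdf2 (pair1_measurable t)).
  apply/measurable_EFinP; apply: measurable_prod => i _.
  under eq_fun do rewrite normal_pdf_phi.
  apply: (measurableT_comp measurable_phi); apply: measurable_funB => //.
  exact: measurable_tnth.
have mhp i : measurable_fun setT (fun th : Rn n => (\prod_(j < n) h i j (tnth th j))%:E).
  apply/measurable_EFinP; apply: measurable_prod => j _.
  by apply: (measurableT_comp (mh i j)); exact: measurable_tnth.
have hp0 i (th : Rn n) : 0 <= \prod_(j < n) h i j (tnth th j) by exact: prodr_ge0.
have hpE i (th : Rn n) : \prod_(j < n) h i j (tnth th j) = (tnth th i - tnth th0 i) ^+ 2.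
  rewrite (bigD1 i)//= /h eqxx big1 ?mulr1// => j ji.
  by rewrite (negbTE ji).
have r20 : 0 <= r ^- 2 by rewrite invr_ge0 sqr_ge0.
apply: (@le_trans _ _ (\int[lebesgue_tuple n]_th ((r ^- 2)%:E *
   (\sum_(i < n) (f th * (\prod_(j < n) h i j (tnth th j))%:E))))%E).
  rewrite /inner integral_mkcond; apply: le_integral_ge0 => th _; rewrite patchE.
    by case: ifP => // _; exact: f0.
  case: ifPn => [|_]; last first.
    by rewrite mule_ge0 ?lee_fin// sume_ge0// => i _; rewrite mule_ge0 ?lee_fin.
  rewrite inE/= => rth; rewrite -/(f th) -ge0_sume_distrr; last first.
    by move=> i _; rewrite lee_fin.
  rewrite muleCA -[leLHS]mule1; apply: lee_wpmul2l; first exact: f0.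
  rewrite sumEFin -EFinM lee_fin; under eq_bigr do rewrite hpE.
  rewrite ler_pdivlMl ?exprn_gt0// mulr1.
  rewrite -[leRHS]sqr_sqrtr; last by apply: sumr_ge0 => i _; exact: sqr_ge0.
  by apply: lerXn2r; rewrite // nnegrE ?sqrtr_ge0// ltW.
have mfh i : measurable_fun setT (fun th : Rn n => (f th * (\prod_(j < n) h i j (tnth th j))%:E)%E).
  by apply: emeasurable_funM => //; exact: mhp.
have fh0 i (th : Rn n) : (0 <= f th * (\prod_(j < n) h i j (tnth th j))%:E)%E.
  by rewrite mule_ge0 ?lee_fin.
rewrite ge0_integralZl//; last 2 first.
- by apply: emeasurable_sum => i; exact: mfh.
- by move=> th _; apply: sume_ge0 => i _; exact: fh0.
rewrite ge0_integral_sum//.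
rewrite -mulrA EFinM; apply: lee_wpmul2l; first by rewrite lee_fin.
rewrite mulr_suml -sumEFin; apply: lee_sum => i _.
rewrite integral_likelihood//.
rewrite (bigD1 i)//= /margin [in leRHS](bigD1 i)//= mulrA EFinM.
apply: lee_pmul.
- by apply: integral_ge0 => x _; rewrite lee_fin mulr_ge0// mulr_ge0 ?hsd_ge0 ?phi_ge0.
- elim/big_rec : _ => [|j u _ u0]; first exact: lee01.
  apply: mule_ge0 => //; apply: integral_ge0 => x _.
  by rewrite lee_fin mulr_ge0// mulr_ge0 ?hsd_ge0 ?phi_ge0.
- by rewrite /h eqxx; exact: hw.
rewrite -prodEFin big_mkcond [leRHS]big_mkcond/=.
rewrite (_ : \big[mule/1%E]_(j < n) _ = \big[mule/1%E]_(j < n) if j != i then (psi t (tnth y j))%:E else 1%E)//.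
apply: eq_bigr => j _; case: ifP => // /negbTE ji.
by rewrite -psiE//; apply: eq_integral => x _; rewrite /h ji mulr1.
Qed.

Lemma joint_mass_setT n (prior : R -> R) (y : Rn n) : (forall t, t <= 0 -> prior t = 0) ->
  joint_mass prior y setT = (\int[mu]_t (prior t * margin t y)%:E)%E.
Proof.
move=> prior0; apply: eq_integral => t _.
have [t0|t0] := leP t 0; first by rewrite prior0// mul0e mul0r.
by rewrite -/(inner t y setT) inner_setT.
Qed.

Lemma joint_mass_ge0 n (prior : R -> R) (y : Rn n) A :
  (forall t, 0 <= prior t) -> (forall t, t <= 0 -> prior t = 0) ->
  (0 <= joint_mass prior y A)%E.
Proof.
move=> prior_ge0 prior0; apply: integral_ge0 => t _.
have [t0|t0] := leP t 0; first by rewrite prior0// mul0e.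
by rewrite mule_ge0 ?lee_fin// integral_ge0// => th _; exact: integrand_ge0.
Qed.

Lemma joint_mass_le n (prior : R -> R) (y : Rn n) A :
  (forall t, 0 <= prior t) -> (forall t, t <= 0 -> prior t = 0) ->
  (joint_mass prior y A <= \int[mu]_t (prior t * margin t y)%:E)%E.
Proof.
move=> prior_ge0 prior0; apply: le_integral_ge0 => t _.
  have [t0|t0] := leP t 0; first by rewrite prior0// mul0e.
  rewrite mule_ge0 ?lee_fin// integral_ge0// => th _; exact: integrand_ge0.
have [t0|t0] := leP t 0; first by rewrite prior0// mul0e mul0r.
by rewrite EFinM; apply: lee_wpmul2l; [rewrite lee_fin|exact: inner_subset].
Qed.

Lemma joint_mass_far n (prior : R -> R) (y th0 : Rn n) (r T : R) (w : 'I_n -> R) :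
  (forall t, 0 <= prior t) -> (forall t, t <= 0 -> prior t = 0) -> 0 < r ->
  (forall i, 0 <= w i) ->
  (forall t i, prior t != 0 -> 0 < t <= T ->
     (\int[mu]_x (hsd t x * phi (tnth y i - x) * (x - tnth th0 i) ^+ 2)%:E
     <= (w i * psi t (tnth y i))%:E)%E) ->
  (joint_mass prior y [set th : Rn n | (r <= l2dist th th0)%R] <=
   \int[mu]_t (prior t * margin t y *
     (if t <= T then r ^- 2 * (\sum_(i < n) w i) else 1))%:E)%E.
Proof.
move=> prior_ge0 prior0 r0 w0 hw; apply: le_integral_ge0 => t _.
  have [t0|t0] := leP t 0; first by rewrite prior0// mul0e.
  rewrite mule_ge0 ?lee_fin// integral_ge0// => th _; exact: integrand_ge0.
have [t0|t0] := leP t 0; first by rewrite prior0// mul0e !mul0r.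
have [->|pt] := eqVneq (prior t) 0; first by rewrite mul0e !mul0r.
rewrite -mulrA EFinM; apply: lee_wpmul2l; first by rewrite lee_fin.
case: ifP => tT; last by rewrite mulr1; exact: inner_subset.
rewrite mulrC; apply: inner_far => // i; apply: hw => //.
by rewrite t0.
Qed.

End product_model.

(** * Posterior bound for a fixed observation *)

Section posterior_bound.
Context {R : realType}.
Local Notation mu := (@lebesgue_measure R).
Local Notation Rn n := (n.-tuple (measurableTypeR R)).

Definition null_ratio n (th0 : Rn n) (t : R) (y : Rn n) : R :=
  \prod_(i < n) (if tnth th0 i == 0 then psi t (tnth y i) / phi (tnth y i) else 1).

Lemma null_ratio_gt0 n (th0 : Rn n) (t : R) (y : Rn n) : 0 < t <= 1 ->
  0 < null_ratio th0 t y.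
Proof.
move=> t01; apply: prodr_gt0 => i _; case: ifP => // _.
by rewrite divr_gt0 ?psi_gt0 ?phi_gt0.
Qed.

Lemma null_ratio_ge0 n (th0 : Rn n) (t : R) (y : Rn n) : 0 <= null_ratio th0 t y.
Proof.
apply: prodr_ge0 => i _; case: ifP => // _.
by rewrite divr_ge0 ?psi_ge0 ?phi_ge0.
Qed.

(** Common reference for all [t]. With [psi t'] at the nonzero coordinates, their means drop out of
    every estimate at the price of powers of t / t'. *)
Let base n (th0 : Rn n) (t' : R) (y : Rn n) : R :=
  \prod_(i < n) (if tnth th0 i == 0 then phi (tnth y i) else psi t' (tnth y i)).

Let base_gt0 n (th0 : Rn n) (t' : R) (y : Rn n) : 0 < t' <= 1 -> 0 < base th0 t' y.
Proof.
by move=> t01; apply: prodr_gt0 => i _; case: ifP => // _; rewrite ?psi_gt0 ?phi_gt0.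
Qed.

Lemma prod_nonzero n p (th0 : Rn n) (c : R) : ell0 p th0 ->
  exists2 k, (k <= p)%N & \prod_(i < n) (if tnth th0 i == 0 then 1 else c) = c ^+ k.
Proof.
move=> h; exists #|[pred i : 'I_n | tnth th0 i != 0 :> R]|.
  apply: leq_trans h; rewrite leq_eqVlt; apply/orP; left; apply/eqP/eq_card => i.
  by rewrite inE; apply/idP/idP => [/mem_set|/set_mem].
rewrite -prodr_const [RHS]big_mkcond/=; apply: eq_bigr => i _.
by rewrite inE/=; case: (tnth th0 i == 0).
Qed.

Lemma margin_le n p (th0 : Rn n) (t' t : R) (y : Rn n) : ell0 p th0 ->
  0 < t' <= t -> t <= 1 ->
  margin t y <= (t / t') ^+ p * (null_ratio th0 t y * base th0 t' y).
Proof.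
move=> h /andP[t'0 t't] t1; have t0 : 0 < t by exact: lt_le_trans t't.
have t'1 : t' <= 1 by exact: le_trans t1.
have [k kp kE] := prod_nonzero (t / t') h.
have c1 : 1 <= t / t' by rewrite ler_pdivlMr ?mul1r.
have b0 : 0 < base th0 t' y by apply: base_gt0; rewrite t'0.
apply: (@le_trans _ _ ((t / t') ^+ k * (null_ratio th0 t y * base th0 t' y))); last first.
  by rewrite ler_wpM2r ?mulr_ge0 ?null_ratio_ge0 ?(ltW b0)// ler_weXn2l.
rewrite -kE -!big_split/=; apply: ler_prod => i _; rewrite psi_ge0/=.
case: ifP => _; first by rewrite mul1r divfK// gt_eqF// phi_gt0.
by rewrite mul1r psi_ratio_ub.
Qed.

Lemma margin_ge n p (th0 : Rn n) (t' t : R) (y : Rn n) : ell0 p th0 ->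
  0 < t' <= t -> t <= 2 * t' -> t <= 1 ->
  (2 ^+ p)^-1 * (null_ratio th0 t y * base th0 t' y) <= margin t y.
Proof.
move=> h /andP[t'0 t't] t2 t1; have t0 : 0 < t by exact: lt_le_trans t't.
have t'1 : t' <= 1 by exact: le_trans t1.
have [k kp kE] := prod_nonzero (2^-1 : R) h.
have b0 : 0 < base th0 t' y by apply: base_gt0; rewrite t'0.
apply: (@le_trans _ _ (2^-1 ^+ k * (null_ratio th0 t y * base th0 t' y))).
  apply: ler_wpM2r; first by rewrite mulr_ge0 ?null_ratio_ge0 ?(ltW b0).
  by rewrite -exprVn; apply: ler_wiXn2l => //; lra.
rewrite -kE -!big_split/=; apply: ler_prod => i _; case: ifP => _.
  by rewrite mul1r divfK ?lexx ?psi_ge0// gt_eqF// phi_gt0.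
rewrite mul1r mulr_ge0 ?psi_ge0//=; apply: le_trans (psi_ratio_lb _ t'0 t't).
by rewrite ler_wpM2r ?psi_ge0// ler_pdivlMr//; lra.
Qed.

Lemma measurable_margin n (y : Rn n) : measurable_fun setT (fun t : R => margin t y).
Proof.
apply: measurable_prod => i _.
exact: (measurableT_comp measurable_psi2 (pair2_measurable (tnth y i : R))).
Qed.

Lemma measurable_null_ratio2 n (th0 : Rn n) :
  measurable_fun setT (fun x : Rn n * R => null_ratio th0 x.2 x.1).
Proof.
apply: measurable_prod => i _; case: (tnth th0 i == 0); last exact: measurable_cst.
have mi : measurable_fun setT (fun x : Rn n * R => tnth x.1 i : R).
  apply: (measurableT_comp (f := fun y : Rn n => tnth y i : R)) => //.
  exact: measurable_tnth.
apply: measurable_funM.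
  apply: (measurableT_comp (f := fun x : R * R => psi x.1 x.2)
     (g := fun x : Rn n * R => (x.2, tnth x.1 i : R))); first exact: measurable_psi2.
  exact: measurable_fun_pair.
by apply: measurable_fun_inv; exact: (measurableT_comp measurable_phi).
Qed.

Lemma measurable_null_ratio n (th0 y : Rn n) :
  measurable_fun setT (fun t : R => null_ratio th0 t y).
Proof. exact: (measurableT_comp (measurable_null_ratio2 th0) (pair1_measurable y)). Qed.

Variables (n p : nat) (th0 : Rn n) (prior : R -> R) (a t' T r nu g : R) (w : 'I_n -> R).
Hypotheses (hth0 : ell0 p th0) (a0 : 0 < a) (hprior : prob_density_on a 1 prior).
Hypotheses (t'0 : 0 < t') (t'T : t' <= T) (t'1 : 2 * t' <= 1) (r0 : 0 < r).
Hypotheses (nu0 : 0 < nu)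
  (hnu : (nu%:E <= \int[mu]_(t in `[t', (2 * t')%R]) (prior t)%:E)%E).
Hypothesis w0 : forall i, 0 <= w i.
Variable y : Rn n.
Hypothesis hw : forall t i, a <= t <= 1 -> t <= T ->
     (\int[mu]_x (hsd t x * phi (tnth y i - x) * (x - tnth th0 i) ^+ 2)%:E
     <= (w i * psi t (tnth y i))%:E)%E.

Let mprior : measurable_fun setT prior. Proof. by case: hprior. Qed.
Let prior_ge0 t : 0 <= prior t. Proof. by case: hprior. Qed.
Let prior_supp t : prior t != 0 -> a <= t <= 1.
Proof.
case: hprior => _ _ h _; apply: contra_neqT => ht; apply: h.
by rewrite in_itv/=.
Qed.
Let prior0 t : t <= 0 -> prior t = 0.
Proof.
move=> t0; apply/eqP; apply: contraT => /prior_supp /andP[at' _].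
by have := lt_le_trans a0 (le_trans at' t0); rewrite ltxx.
Qed.
Let int_prior : (\int[mu]_t (prior t)%:E = 1)%E. Proof. by case: hprior. Qed.

Let D : R := fine (\int[mu]_t (prior t * margin t y)%:E)%E.

Let prior_cases t : prior t = 0 \/ (0 < t <= 1 /\ a <= t <= 1).
Proof.
have [->|/prior_supp h] := eqVneq (prior t) 0; [by left|right; split=> //].
by have /andP[h1 ->] := h; rewrite (lt_le_trans a0 h1).
Qed.

Let DE : (\int[mu]_t (prior t * margin t y)%:E = D%:E)%E.
Proof.
rewrite /D fineK// ge0_fin_numE; last first.
  by apply: integral_ge0 => t _; rewrite lee_fin mulr_ge0 ?margin_ge0.
apply: (@le_lt_trans _ _ 1%E); last exact: ltry.
rewrite -int_prior; apply: le_integral_ge0 => t _; rewrite lee_fin.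
  by rewrite mulr_ge0 ?margin_ge0.
have [->|[/andP[t0 t1] _]] := prior_cases t; first by rewrite mul0r.
rewrite ler_piMr// /margin; apply: prodr_ile1 => i _.
by rewrite psi_ge0 (le_trans (psi_le _ t0))// phi0_le1.
Qed.

Let D_ge0 : 0 <= D.
Proof. by rewrite /D fine_ge0// integral_ge0// => t _; rewrite lee_fin mulr_ge0 ?margin_ge0. Qed.

(** Divided by [base], the joint mass of tau > T is at most this. *)
Definition far_num : \bar R :=
  (\int[mu]_t (prior t * (\1_`]T, +oo[ t * (t / t') ^+ p * null_ratio th0 t y))%:E)%E.

(** Small values force a large evidence. The inverse is taken inside the integral over [t] because
    its mean over the data then factorizes over coordinates, unlike that of the inverse evidence. *)
Definition inv_den : \bar R :=
  (\int[mu]_t (prior t * (\1_`[t', (2 * t')%R] t / null_ratio th0 t y))%:E)%E.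

Let posteriorE A : posterior prior y A = fine (joint_mass prior y A) / D.
Proof. by rewrite /posterior joint_mass_setT// DE. Qed.

Let fine_le_EFin (x : \bar R) (c : R) : (x <= c%:E)%E -> 0 <= c -> fine x <= c.
Proof. by case: x. Qed.

Lemma posterior_ge0 A : 0 <= posterior prior y A.
Proof. by rewrite posteriorE divr_ge0// fine_ge0// joint_mass_ge0. Qed.

Lemma posterior_le1 A : posterior prior y A <= 1.
Proof.
(* With zero evidence [posterior] is 0, the inverse of 0 being 0. *)
rewrite posteriorE; have [D0|D0] := eqVneq D 0; first by rewrite D0 invr0 mulr0.
have Dgt : 0 < D by rewrite lt_neqAle eq_sym D0.
rewrite ler_pdivrMr// mul1r; apply: fine_le_EFin => //.
by rewrite -DE; exact: joint_mass_le.
Qed.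

Lemma far_num_ge0 : (0 <= far_num)%E.
Proof.
apply: integral_ge0 => t _; rewrite lee_fin mulr_ge0// mulr_ge0 ?null_ratio_ge0//.
rewrite indicE mem_setE in_itv/= andbT; case: (ltP T t) => h; last by rewrite mul0r.
rewrite mul1r exprn_ge0// divr_ge0 ?(ltW t'0)//.
by rewrite (le_trans _ (ltW h))// (le_trans _ t'T)// ltW.
Qed.

(* AM-GM, [2 c <= F + c ^+ 2 / F], integrated over the prior with [c = nu / g]. *)
Let evidence_lb : (inv_den <= g%:E)%E -> 0 < g ->
  base th0 t' y * nu ^+ 2 <= 2 ^+ p * g * D.
Proof.
move=> hg g0.
have t'11 : t' <= 1 by have := t'1; have := t'0; lra.
have b0 : 0 < base th0 t' y by apply: base_gt0; rewrite t'0.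
pose c := nu / g; have c0 : 0 <= c by rewrite divr_ge0 ?ltW.
have p2 : 0 < 2 ^+ p :> R by rewrite exprn_gt0.
pose k := 2 ^+ p / base th0 t' y; have k0 : 0 <= k by rewrite divr_ge0 ?ltW.
pose F t := null_ratio th0 t y.
have mF : measurable_fun setT F by exact: measurable_null_ratio.
have mm : measurable_fun setT (fun t => margin t y) by exact: measurable_margin.
have i1 : ((2 * c)%:E * \int[mu]_(t in `[t', (2 * t')%R]) (prior t)%:E <=
    k%:E * D%:E + (c ^+ 2)%:E * inv_den)%E.
  have mi : measurable_fun setT (fun t : R => (prior t * (\1_`[t', (2 * t')%R] t / F t))%:E).
    by apply/measurable_EFinP; meas.
  have i0 (t : R) : (0 <= (prior t * (\1_`[t', (2 * t')%R] t / F t))%:E)%E.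
    by rewrite lee_fin mulr_ge0// divr_ge0// null_ratio_ge0.
  have mD : measurable_fun setT (fun t : R => (prior t * margin t y)%:E).
    by apply/measurable_EFinP; meas.
  have D0 (t : R) : (0 <= (prior t * margin t y)%:E)%E.
    by rewrite lee_fin mulr_ge0// margin_ge0.
  have c2 : (0 <= (c ^+ 2)%:E)%E by rewrite lee_fin sqr_ge0.
  have kE : (0 <= k%:E)%E by rewrite lee_fin.
  rewrite -DE -ge0_integralZl//; last 3 first.
  - by apply: measurable_funTS; exact/measurable_EFinP.
  - by move=> t _; rewrite lee_fin.
  - by rewrite lee_fin mulr_ge0.
  rewrite -ge0_integralZl// -ge0_integralZl// -ge0_integralD//; last 4 first.
  - by move=> t _; exact: mule_ge0.
  - exact: emeasurable_funM.
  - by move=> t _; exact: mule_ge0.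
  - exact: emeasurable_funM.
  rewrite integral_mkcond; apply: le_integral_ge0 => t _; rewrite patchE.
    by case: ifP => // _; rewrite -EFinM lee_fin mulr_ge0// mulr_ge0.
  case: ifPn => [|_]; last by rewrite adde_ge0// mule_ge0.
  rewrite inE/= in_itv/= => tI; rewrite -!(EFinM, EFinD) lee_fin indicE mem_setE in_itv/= tI mul1r.
  have [->|[t01 _]] := prior_cases t; first by rewrite !(mul0r, mulr0) addr0.
  have F0 : 0 < F t by exact: null_ratio_gt0.
  have /andP[tt' t2] := tI; have /andP[t0 t1] := t01.
  have mg : F t <= k * margin t y.
    have h : 0 < t' <= t by rewrite t'0.
    have := margin_ge y hth0 h t2 t1; rewrite ler_pdivrMl// => h'.
    by rewrite /k mulrAC ler_pdivlMr.
  rewrite [leRHS](_ : _ = prior t * (k * margin t y + c ^+ 2 / F t)); last by ring.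
  rewrite mulrC ler_wpM2l//; apply: (@le_trans _ _ (F t + c ^+ 2 / F t)); last by rewrite lerD2r.
  rewrite -(ler_pM2r F0) [leRHS]mulrDl divfK ?gt_eqF//.
  by have := sqr_ge0 (F t - c); lra.
have i2 : 2 * c * nu <= k * D + c ^+ 2 * g.
  rewrite -lee_fin; apply: (@le_trans _ _ ((2 * c)%:E * \int[mu]_(t in `[t', (2 * t')%R]) (prior t)%:E)%E).
    by rewrite EFinM; apply: lee_wpmul2l => //; rewrite lee_fin mulr_ge0.
  apply: le_trans i1 _; rewrite EFinD !EFinM leeD2l//.
  by apply: lee_wpmul2l => //; rewrite lee_fin sqr_ge0.
have i3 : nu ^+ 2 / g <= k * D.
  have e1 : c * nu = nu ^+ 2 / g by rewrite /c expr2 mulrAC.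
  have e2 : c ^+ 2 * g = nu ^+ 2 / g by rewrite /c; field; rewrite gt_eqF.
  by lra.
move: i3; rewrite ler_pdivrMr// => i3; have := ler_wpM2l (ltW b0) i3.
rewrite (_ : base th0 t' y * (k * D * g) = 2 ^+ p * g * D)//.
by rewrite /k; field; rewrite gt_eqF.
Qed.

(** For tau <= T Markov's inequality gives the first term. For tau > T the numerator is at most
    [base] times [far_num], the evidence at least [base] times nu^2 / (2^p g), and [base]
    cancels. *)
Lemma posterior_le : (inv_den <= g%:E)%E -> 0 < g ->
  ((posterior prior y [set th : Rn n | (r <= l2dist th th0)%R])%:E <=
   (r ^- 2 * \sum_(i < n) w i)%:E + (2 ^+ p * g / nu ^+ 2)%:E * far_num)%E.
Proof.
move=> hg g0; set W := r ^- 2 * _.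
have W0 : 0 <= W by rewrite mulr_ge0 ?invr_ge0 ?sqr_ge0// sumr_ge0.
have k0 : 0 <= 2 ^+ p * g / nu ^+ 2.
  by rewrite divr_ge0 ?sqr_ge0// mulr_ge0 ?exprn_ge0// ltW.
have t'11 : t' <= 1 by have := t'1; have := t'0; lra.
have b0 : 0 < base th0 t' y by apply: base_gt0; rewrite t'0.
rewrite posteriorE; have [D0|D0] := eqVneq D 0.
  by rewrite D0 invr0 mulr0 adde_ge0 ?lee_fin// mule_ge0 ?lee_fin ?far_num_ge0.
have Dgt : 0 < D by rewrite lt_neqAle eq_sym D0.
have mm : measurable_fun setT (fun t => margin t y) by exact: measurable_margin.
have mF : measurable_fun setT (fun t => null_ratio th0 t y) by exact: measurable_null_ratio.
pose N := (\int[mu]_t (prior t * margin t y * \1_`]T, +oo[ t)%:E)%E.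
have N0 : (0 <= N)%E.
  by apply: integral_ge0 => t _; rewrite lee_fin mulr_ge0// mulr_ge0// margin_ge0.
have NE : N = (fine N)%:E.
  rewrite fineK// ge0_fin_numE//; apply: (@le_lt_trans _ _ D%:E); last exact: ltry.
  rewrite -DE; apply: le_integral_ge0 => t _; rewrite lee_fin.
    by rewrite mulr_ge0// mulr_ge0// margin_ge0.
  apply: ler_piMr; first by rewrite mulr_ge0// margin_ge0.
  by rewrite indicE; case: (t \in _).
have JA : (joint_mass prior y [set th : Rn n | (r <= l2dist th th0)%R] <=
    (W * D + fine N)%:E)%E.
  apply: le_trans (joint_mass_far (T := T) (w := w) prior_ge0 prior0 r0 w0 _) _.
    move=> t i pt /andP[_ tT]; apply: hw => //; exact: prior_supp.
  rewrite EFinD EFinM -DE -NE -ge0_integralZl ?lee_fin//; last 2 first.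
  - by apply/measurable_EFinP; meas.
  - by move=> t _; rewrite lee_fin mulr_ge0// margin_ge0.
  rewrite -ge0_integralD//; last 4 first.
  - by move=> t _; rewrite mule_ge0 ?lee_fin// mulr_ge0// margin_ge0.
  - by apply: emeasurable_funM => //; apply/measurable_EFinP; meas.
  - by move=> t _; rewrite lee_fin mulr_ge0// mulr_ge0// margin_ge0.
  - by apply/measurable_EFinP; meas.
  apply: le_integral_ge0 => t _.
    rewrite lee_fin mulr_ge0//; first by rewrite mulr_ge0// margin_ge0.
    by case: ifP.
  rewrite -!(EFinM, EFinD) lee_fin indicE mem_setE in_itv/= andbT -/W.
  have pm0 : 0 <= prior t * margin t y by rewrite mulr_ge0// margin_ge0.
  case: (leP t T) => _; first by rewrite mulr0 addr0 mulrC.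
  by rewrite !mulr1 lerDr mulr_ge0.
have Nle : (N <= (base th0 t' y)%:E * far_num)%E.
  rewrite -ge0_integralZl//; last 3 first.
  - by apply/measurable_EFinP; meas.
  - move=> t _; rewrite lee_fin mulr_ge0// mulr_ge0 ?null_ratio_ge0//.
    rewrite indicE mem_setE in_itv/= andbT; case: (ltP T t) => h; last by rewrite mul0r.
    rewrite mul1r exprn_ge0// divr_ge0 ?(ltW t'0)//.
    by rewrite (le_trans _ (ltW h))// (le_trans _ t'T)// ltW.
  - by rewrite lee_fin ltW.
  apply: le_integral_ge0 => t _.
    by rewrite lee_fin mulr_ge0// mulr_ge0// margin_ge0.
  rewrite -EFinM lee_fin indicE mem_setE in_itv/= andbT.
  case: (ltP T t) => h; last by rewrite !(mul0r, mulr0).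
  have [->|[/andP[t0 t1] _]] := prior_cases t; first by rewrite !(mul0r, mulr0).
  rewrite mulr1 mul1r mulrCA ler_wpM2l//.
  have h' : 0 < t' <= t by rewrite t'0 (le_trans t'T)// ltW.
  by have := margin_le y hth0 h' t1; rewrite [leRHS]mulrA [leRHS]mulrC.
apply: (@le_trans _ _ (W%:E + (fine N / D)%:E)%E).
  rewrite -EFinD lee_fin ler_pdivrMr// mulrDl divfK ?gt_eqF//.
  apply: fine_le_EFin => //; rewrite addr_ge0 ?fine_ge0// mulr_ge0//.
rewrite leeD2l// EFinM -NE.
apply: (@le_trans _ _ ((base th0 t' y)%:E * far_num * (D^-1)%:E)%E).
  by apply: lee_wpmul2r => //; rewrite lee_fin invr_ge0.
rewrite muleAC -EFinM; apply: lee_wpmul2r; first exact: far_num_ge0.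
rewrite lee_fin ler_pdivrMr// mulrAC ler_pdivlMr ?exprn_gt0//.
exact: evidence_lb.
Qed.

End posterior_bound.

(** * Risk at a fixed parameter *)

Section risk_bound.
Context {R : realType}.
Local Notation mu := (@lebesgue_measure R).
Local Notation Rn n := (n.-tuple (measurableTypeR R)).

Lemma lee_prod_EFin (I : Type) (s : seq I) (e : I -> \bar R) (c : I -> R) :
  (forall i, 0 <= e i)%E -> (forall i, e i <= (c i)%:E)%E ->
  (\big[mule/1]_(i <- s) e i <= (\prod_(i <- s) c i)%:E)%E.
Proof.
move=> e0 ec; elim: s => [|i s IH]; first by rewrite !big_nil.
by rewrite !big_cons EFinM lee_pmul//; exact: prode_ge0.
Qed.

Variables (n p : nat) (th0 : Rn n) (prior : R -> R) (a t' T r nu g z d X : R).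
Variable W : 'I_n -> R -> R.
Hypotheses (p_gt0 : (0 < p)%N) (hth0 : ell0 p th0) (a0 : 0 < a)
  (hprior : prob_density_on a 1 prior).
Hypotheses (t'0 : 0 < t') (t'T : t' <= T) (t'1 : 2 * t' <= 1) (r0 : 0 < r).
Hypotheses (nu0 : 0 < nu)
  (hnu : (\int[mu]_(t in `[t', (2 * t')%R]) (prior t)%:E = nu%:E)%E).
Hypotheses (g0 : 0 < g) (z1 : 1 <= z) (d0 : 0 <= d).
Hypothesis hd : forall t, t' <= t <= 2 * t' ->
  (\int[mu]_y (phi y * (phi y / psi t y))%:E <= (1 + d)%:E)%E.
Hypothesis hX : forall t, T < t -> t <= 1 ->
  (t / t') ^+ p * expR (- (test_const * t / z) * (n%:R - p%:R)) <= X.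
Hypotheses (W0 : forall i x, 0 <= W i x) (mW : forall i, measurable_fun setT (W i)).
Hypothesis hW : forall t i y, a <= t <= 1 -> t <= T ->
     (\int[mu]_x (hsd t x * phi (y - x) * (x - tnth th0 i) ^+ 2)%:E
     <= (W i y * psi t y)%:E)%E.

Let mprior : measurable_fun setT prior. Proof. by case: hprior. Qed.
Let prior_ge0 t : 0 <= prior t. Proof. by case: hprior. Qed.
Let int_prior : (\int[mu]_t (prior t)%:E = 1)%E. Proof. by case: hprior. Qed.
Let prior_cases t : prior t = 0 \/ 0 < t <= 1.
Proof.
have [->|pt] := eqVneq (prior t) 0; [by left|right].
case: hprior => _ _ h _.
have : t \in `[a, 1] by apply: contraT => /h /eqP; rewrite (negbTE pt).
by rewrite in_itv/= => /andP[at' ->]; rewrite (lt_le_trans a0).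
Qed.

Let B (x : R) : R := \1_`]z, +oo[ x.
Let Bsum (y : Rn n) : R := \sum_(i < n) (if tnth th0 i == 0 then B (tnth y i) else 0).

(** Undamped, each null factor psi / phi has mean 1 and nothing is gained. The damping still
    factorizes and brings each mean down to the bound of [test_mgf]; undoing it costs only exp(p) as
    long as the count [Bsum] is at most [p]. *)
Let damped (t : R) (y : Rn n) : R := \prod_(i < n)
  (if tnth th0 i == 0 then psi t (tnth y i) / phi (tnth y i) * expR (- B (tnth y i)) else 1).

Let dampedE t y : damped t y = null_ratio th0 t y * expR (- Bsum y).
Proof.
rewrite /Bsum -sumrN expR_sum /null_ratio -big_split/=; apply: eq_bigr => i _.
by case: ifP => // _; rewrite oppr0 expR0 mulr1.
Qed.

Let damped_ge0 t y : 0 <= damped t y.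
Proof. by rewrite dampedE mulr_ge0 ?null_ratio_ge0 ?expR_ge0. Qed.

Let c_ge0 t : 0 <= \1_`]T, +oo[ t * (t / t') ^+ p.
Proof.
rewrite indicE mem_setE in_itv/= andbT; case: (ltP T t) => h; last by rewrite mul0r.
rewrite mul1r exprn_ge0// divr_ge0 ?(ltW t'0)//.
by rewrite (le_trans _ (ltW h))// (le_trans _ t'T)// ltW.
Qed.

Let damped_num (y : Rn n) : \bar R :=
  (\int[mu]_t (prior t * (\1_`]T, +oo[ t * (t / t') ^+ p * damped t y))%:E)%E.

Let damped_num_ge0 y : (0 <= damped_num y)%E.
Proof.
by apply: integral_ge0 => t _; rewrite lee_fin mulr_ge0// mulr_ge0.
Qed.

Let far_num_damped y :
  far_num p th0 prior t' T y = ((expR (Bsum y))%:E * damped_num y)%E.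
Proof.
rewrite /damped_num -ge0_integralZl//.
- apply: eq_integral => t _; rewrite -EFinM dampedE expRN; congr EFin.
  by field; rewrite gt_eqF ?expR_gt0// gt_eqF.
- apply/measurable_EFinP; apply: measurable_funM => //; apply: measurable_funM; first by meas.
  rewrite (_ : damped^~ y = fun t => null_ratio th0 t y * expR (- Bsum y)).
    by apply: measurable_funM => //; exact: measurable_null_ratio.
  by apply/funext => t; exact: dampedE.
- by move=> t _; rewrite lee_fin mulr_ge0// mulr_ge0.
Qed.

Let u1 (y : Rn n) : R := r ^- 2 * \sum_(i < n) W i (tnth y i).
Let u3 (y : Rn n) : R := p%:R^-1 * Bsum y.
Let K : R := 2 ^+ p * g / nu ^+ 2 * expR p%:R.

Let inv_den_ge0 y : (0 <= inv_den th0 prior t' y)%E.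
Proof.
apply: integral_ge0 => t _; rewrite lee_fin mulr_ge0//.
by rewrite divr_ge0 ?null_ratio_ge0// indicE.
Qed.

Let Bsum_ge0 y : 0 <= Bsum y.
Proof. by apply: sumr_ge0 => i _; case: ifP. Qed.

Let K_ge0 : 0 <= K.
Proof.
rewrite mulr_ge0 ?expR_ge0// divr_ge0 ?sqr_ge0// mulr_ge0 ?exprn_ge0//; exact: ltW.
Qed.

Let u1_ge0 y : 0 <= u1 y.
Proof. by rewrite mulr_ge0 ?invr_ge0 ?sqr_ge0 ?sumr_ge0. Qed.

Let u3_ge0 y : 0 <= u3 y.
Proof. by rewrite mulr_ge0 ?invr_ge0. Qed.

(** The posterior is at most 1, so each exceptional event is charged to a variable exceeding 1 on
    it: [inv_den] over [g], or [Bsum] over [p]. Off both events [posterior_le] applies. *)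
Let pointwise y :
  ((posterior prior y [set th : Rn n | (r <= l2dist th th0)%R])%:E <=
   (u1 y)%:E + ((g^-1)%:E * inv_den th0 prior t' y +
     ((u3 y)%:E + K%:E * damped_num y)))%E.
Proof.
have le1 : ((posterior prior y [set th : Rn n | (r <= l2dist th th0)%R])%:E <= 1)%E.
  by rewrite lee_fin; apply: (posterior_le1 a0 hprior).
have g10 : (0 <= (g^-1)%:E)%E by rewrite lee_fin invr_ge0 ltW.
have s4 : (0 <= K%:E * damped_num y)%E by rewrite mule_ge0 ?lee_fin.
have s3 : (0 <= (u3 y)%:E)%E by rewrite lee_fin.
have s1 : (0 <= (u1 y)%:E)%E by rewrite lee_fin.
have s2 : (0 <= (g^-1)%:E * inv_den th0 prior t' y)%E by exact: mule_ge0.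
have s34 := adde_ge0 s3 s4; have s234 := adde_ge0 s2 s34.
have [hg|hg] := leP (inv_den th0 prior t' y) g%:E; last first.
  apply: le_trans le1 _; apply: le_trans (leeDr _ s1).
  apply: le_trans (leeDl _ s34).
  by rewrite -(mulVf (lt0r_neq0 g0)) EFinM; apply: lee_wpmul2l => //; exact: ltW.
have [hB|hB] := leP (Bsum y) p%:R; last first.
  apply: le_trans le1 _; apply: le_trans (leeDr _ s1).
  apply: le_trans (leeDr _ s2); apply: le_trans (leeDl _ s4).
  by rewrite lee_fin /u3 ler_pdivlMl ?ltr0n// mulr1 ltW.
have hnu' : (nu%:E <= \int[mu]_(t in `[t', (2 * t')%R]) (prior t)%:E)%E by rewrite hnu.
have := @posterior_le R n p th0 prior a t' T r nu g (fun i => W i (tnth y i))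
  hth0 a0 hprior t'0 t'T t'1 r0 nu0 hnu' (fun i => W0 _ _) y _ hg g0.
move=> /(_ (fun t i => @hW t i (tnth y i))) h; apply: le_trans h _.
rewrite leeD2l//; apply: le_trans (leeDr _ s2); apply: le_trans (leeDr _ s3).
rewrite far_num_damped muleA -EFinM; apply: lee_wpmul2r => //.
rewrite lee_fin /K ler_wpM2l//; last by rewrite ler_expR.
rewrite divr_ge0 ?sqr_ge0// mulr_ge0 ?exprn_ge0//; exact: ltW.
Qed.

Let mtnth i : measurable_fun setT (fun y : Rn n => tnth y i : R).
Proof. exact: measurable_tnth. Qed.

Let mu1 : measurable_fun setT (fun y => (u1 y)%:E).
Proof.
apply/measurable_EFinP; apply: measurable_funM => //; apply: measurable_sum => i.
exact: (measurableT_comp (mW i)).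
Qed.

Let mBsum : measurable_fun setT Bsum.
Proof.
apply: measurable_sum => i; case: (tnth th0 i == 0) => //.
by apply: (measurableT_comp (f := B)); [rewrite /B; meas|exact: mtnth].
Qed.

Let mu3 : measurable_fun setT (fun y => (u3 y)%:E).
Proof. by apply/measurable_EFinP; exact: measurable_funM. Qed.

Let G2 (x : Rn n * R) : \bar R :=
  (prior x.2 * (\1_`[t', (2 * t')%R] x.2 / null_ratio th0 x.2 x.1))%:E.
Let N2 (x : Rn n * R) : \bar R :=
  (prior x.2 * (\1_`]T, +oo[ x.2 * (x.2 / t') ^+ p * damped x.2 x.1))%:E.

Let mG2 : measurable_fun setT G2.
Proof.
apply/measurable_EFinP; apply: measurable_funM.
  exact: (measurableT_comp mprior).
apply: measurable_funM; first by meas.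
by apply: measurable_fun_inv; exact: measurable_null_ratio2.
Qed.

Let mN2 : measurable_fun setT N2.
Proof.
apply/measurable_EFinP; apply: measurable_funM.
  exact: (measurableT_comp mprior).
apply: measurable_funM; first by meas.
rewrite (_ : (fun x => _) =
    (fun x : Rn n * R => null_ratio th0 x.2 x.1 * expR (- Bsum x.1))); last first.
  by apply/funext => x; exact: dampedE.
apply: measurable_funM; first exact: measurable_null_ratio2.
apply: measurable_fun_expR; apply: measurable_fun_opp.
exact: (measurableT_comp mBsum).
Qed.

Let G2_ge0 x : (0 <= G2 x)%E.
Proof. by rewrite lee_fin mulr_ge0// divr_ge0 ?null_ratio_ge0// indicE. Qed.

Let N2_ge0 x : (0 <= N2 x)%E.
Proof. by rewrite lee_fin mulr_ge0// mulr_ge0. Qed.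

Let mG : measurable_fun setT (inv_den th0 prior t').
Proof. exact: (measurable_fun_fubini_tonelli_F (m2 := mu) G2). Qed.

Let mN : measurable_fun setT damped_num.
Proof. exact: (measurable_fun_fubini_tonelli_F (m2 := mu) N2). Qed.

(** After Tonelli, the data integral for fixed [t] is a product with factors at most 1 + d at null
    coordinates and 1 elsewhere, and (1 + d)^n <= exp(n d). *)
Let mean_inv_den :
  (\int[data_law th0]_y inv_den th0 prior t' y <= (nu * expR (n%:R * d))%:E)%E.
Proof.
pose h t i (x : R) : R := if tnth th0 i == 0 then phi x / psi t x else 1.
have hE t y : (null_ratio th0 t y)^-1 = \prod_(i < n) h t i (tnth y i).
  rewrite /null_ratio -prodfV; apply: eq_bigr => i _; rewrite /h.
  by case: ifP => _; rewrite ?invf_div ?invr1.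
have h0 t i x : 0 <= h t i x.
  by rewrite /h; case: ifP => // _; rewrite divr_ge0 ?phi_ge0 ?psi_ge0.
have mh t i : measurable_fun setT (h t i).
  rewrite /h; case: (tnth th0 i == 0); last exact: measurable_cst.
  have mpsi : measurable_fun setT (psi t) by exact: measurable_psi.
  by meas.
rewrite (_ : \int[_]_y _ = \int[data_law th0]_y \int[mu]_t G2 (y, t))%E//.
rewrite (fubini_tonelli (m1 := data_law th0) (m2 := mu) G2)//.
rewrite mulrC EFinM -hnu -ge0_integralZl//; last 2 first.
- by apply: measurable_funTS; exact/measurable_EFinP.
- by move=> t _; rewrite lee_fin.
rewrite [leRHS]integral_mkcond; apply: le_integral_ge0 => t _.
  by apply: integral_ge0 => y _; exact: G2_ge0.
rewrite patchE; case: ifPn => tI; last first.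
  by rewrite integral0_eq// => y _; rewrite /G2/= indicE (negbTE tI) mul0r mulr0.
have [pt|/andP[t0 t1]] := prior_cases t.
  by rewrite integral0_eq ?pt ?mule0// => y _; rewrite /G2/= pt mul0r.
move: tI (tI); rewrite {1}inE/= in_itv/= => tI tI'.
rewrite muleC (_ : \int[_]_y _ =
    (prior t)%:E * \int[data_law th0]_y (\prod_(i < n) h t i (tnth y i))%:E)%E; last first.
  rewrite -ge0_integralZl//.
  - by apply: eq_integral => y _; rewrite /G2/= indicE tI' mul1r hE -EFinM.
  - apply/measurable_EFinP; apply: measurable_prod => i _.
    exact: (measurableT_comp (mh t i)).
  - by move=> y _; rewrite lee_fin prodr_ge0.
  - by rewrite lee_fin.
apply: lee_wpmul2l; first by rewrite lee_fin.
rewrite integral_data_law//.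
apply: le_trans (lee_prod_EFin _ (c := fun=> 1 + d) _ _) _.
- by move=> i; apply: integral_ge0 => x _; rewrite lee_fin mulr_ge0 ?phi_ge0.
- move=> i; rewrite /h; case: eqP => [->|_].
    apply: le_trans (hd tI); apply: le_integral_ge0 => x _; rewrite subr0 lee_fin//.
    by rewrite mulr_ge0 ?divr_ge0 ?phi_ge0 ?psi_ge0.
  under eq_integral do rewrite mulr1.
  by rewrite integral_phi lee_fin lerDl.
rewrite lee_fin prodr_const cardT size_enum_ord expRM_natl.
by apply: lerXn2r; rewrite ?nnegrE ?addr_ge0 ?expR_ge0// expR_ge1Dx.
Qed.

(** For fixed [t] the null data density cancels the denominator of the ratio. Each null factor thus
    becomes the mean of exp(- B) under [psi t], bounded by [test_mgf], and at least n - p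
    coordinates are null. *)
Let mean_damped_num : 0 <= X -> (\int[data_law th0]_y damped_num y <= X%:E)%E.
Proof.
move=> X0.
pose h t i (x : R) : R := if tnth th0 i == 0 then psi t x / phi x * expR (- B x) else 1.
have h0 t i x : 0 <= h t i x.
  by rewrite /h; case: ifP => // _; rewrite mulr_ge0 ?divr_ge0 ?phi_ge0 ?psi_ge0 ?expR_ge0.
have mh t i : measurable_fun setT (h t i).
  rewrite /h; case: (tnth th0 i == 0); last exact: measurable_cst.
  have mpsi : measurable_fun setT (psi t) by exact: measurable_psi.
  have mB : measurable_fun setT B by rewrite /B; meas.
  by meas.
rewrite (_ : \int[_]_y _ = \int[data_law th0]_y \int[mu]_t N2 (y, t))%E//.
rewrite (fubini_tonelli (m1 := data_law th0) (m2 := mu) N2)//.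
rewrite -[leRHS]mule1 -int_prior -ge0_integralZl//; last 2 first.
- exact/measurable_EFinP.
- by move=> t _; rewrite lee_fin.
apply: le_integral_ge0 => t _.
  by apply: integral_ge0 => y _; exact: N2_ge0.
have [pt|/andP[t0 t1]] := prior_cases t.
  by rewrite integral0_eq ?pt ?mule0// => y _; rewrite /N2/= pt mul0r.
have [tT|Tt] := leP t T.
  rewrite integral0_eq; first by rewrite mule_ge0 ?lee_fin.
  move=> y _; rewrite /N2/= indicE mem_setE in_itv/= andbT ltNge tT.
  by rewrite !mul0r mulr0.
have tt0 : 0 <= t / t' by rewrite divr_ge0// ltW.
rewrite muleC (_ : \int[_]_y _ = (prior t)%:E * ((t / t') ^+ p)%:E *
    \int[data_law th0]_y (\prod_(i < n) h t i (tnth y i))%:E)%E; last first.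
  rewrite -EFinM -ge0_integralZl//.
  - apply: eq_integral => y _; rewrite /N2/= indicE mem_setE in_itv/= andbT Tt mul1r.
    by rewrite -EFinM mulrA.
  - apply/measurable_EFinP; apply: measurable_prod => i _.
    exact: (measurableT_comp (mh t i)).
  - by move=> y _; rewrite lee_fin prodr_ge0.
  - by rewrite lee_fin mulr_ge0// exprn_ge0.
rewrite -muleA; apply: lee_wpmul2l; first by rewrite lee_fin.
pose q := test_const * t / z.
have q0 : 0 <= q.
  rewrite divr_ge0 ?(le_trans ler01 z1)// mulr_ge0 ?(ltW t0)//.
  exact: ltW test_const_gt0.
apply: (@le_trans _ _ (((t / t') ^+ p)%:E * (expR (- q * (n%:R - p%:R)))%:E)%E); last first.
  by rewrite -EFinM lee_fin mulNr -mulNr; have := hX Tt t1; rewrite mulNr.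
apply: lee_wpmul2l; first by rewrite lee_fin exprn_ge0.
rewrite integral_data_law//.
apply: le_trans (lee_prod_EFin _ (c := fun i => if tnth th0 i == 0 then expR (- q) else 1) _ _) _.
- by move=> i; apply: integral_ge0 => x _; rewrite lee_fin mulr_ge0 ?phi_ge0.
- move=> i; rewrite /h; case: eqP => [->|_].
    apply: le_trans (test_mgf (t := t) (z := z) _ z1); last by rewrite t0.
    apply: le_integral_ge0 => x _; rewrite subr0 lee_fin.
      by rewrite mulr_ge0 ?phi_ge0// mulr_ge0 ?divr_ge0 ?phi_ge0 ?psi_ge0 ?expR_ge0.
    by rewrite mulrA mulrCA divff ?gt_eqF ?phi_gt0// mulr1.
  under eq_integral do rewrite mulr1.
  by rewrite integral_phi.
(* The product is rewritten as exp(- q n) times one factor exp(q) for each of the [k] nonzero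
   coordinates. *)
have [k kp kE] := prod_nonzero (expR q) hth0.
rewrite lee_fin (_ : \prod_(i < n) _ = expR (- q) ^+ n * expR q ^+ k); last first.
  rewrite -kE -[in X in _ = X * _](card_ord n) -prodr_const -big_split/=.
  apply: eq_bigr => i _; case: ifP => _; first by rewrite mulr1.
  by rewrite -expRD addNr expR0.
rewrite -!expRM_natl -expRD ler_expR.
have : k%:R <= p%:R :> R by rewrite ler_nat.
by move=> kp'; have := ler_wpM2r q0 kp'; lra.
Qed.

Let mean_u3 : (\int[data_law th0]_y (u3 y)%:E <=
  (p%:R^-1 * (n%:R * (8 * gauss8 * expR (- z ^+ 2 / 4))))%:E)%E.
Proof.
have mB : measurable_fun setT B by rewrite /B; meas.
have p0 : (0 <= (p%:R^-1 : R)%:E)%E by rewrite lee_fin invr_ge0.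
under eq_integral do rewrite EFinM.
rewrite ge0_integralZl//; last 2 first.
- exact/measurable_EFinP.
- by move=> y _; rewrite lee_fin.
rewrite EFinM; apply: lee_wpmul2l => //.
under eq_integral do rewrite /Bsum -sumEFin.
rewrite ge0_integral_sum//; last 2 first.
- move=> i; apply/measurable_EFinP; case: (tnth th0 i == 0) => //.
  exact: (measurableT_comp mB).
- by move=> i y _; rewrite lee_fin; case: ifP.
rewrite mulr_natl -[X in _ *+ X](card_ord n) -sumr_const -sumEFin.
apply: lee_sum => i _; case: eqP => [e|_].
  rewrite integral_data_law_coord// e.
  under eq_integral do rewrite subr0.
  by apply: gaussian_tail; rewrite (le_trans ler01).
rewrite integral0_eq// lee_fin mulr_ge0 ?expR_ge0// mulr_ge0// ltW//.
exact: gauss8_gt0.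
Qed.

Let mean_u1 (e : 'I_n -> R) :
  (forall i, (\int[mu]_x (phi (x - tnth th0 i) * W i x)%:E <= (e i)%:E)%E) ->
  (\int[data_law th0]_y (u1 y)%:E <= (r ^- 2 * \sum_(i < n) e i)%:E)%E.
Proof.
move=> he; have p0 : (0 <= (r ^- 2 : R)%:E)%E by rewrite lee_fin invr_ge0 sqr_ge0.
have mWi i : measurable_fun setT (fun y : Rn n => (W i (tnth y i))%:E).
  by apply/measurable_EFinP; exact: (measurableT_comp (mW i)).
have Wi0 i (y : Rn n) : (0 <= (W i (tnth y i))%:E)%E by rewrite lee_fin.
under eq_integral do rewrite EFinM -sumEFin.
rewrite ge0_integralZl//; last 2 first.
- by apply: emeasurable_sum => i; exact: mWi.
- by move=> y _; exact: sume_ge0.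
rewrite EFinM; apply: lee_wpmul2l => //.
rewrite ge0_integral_sum// -sumEFin; apply: lee_sum => i _.
by rewrite integral_data_law_coord.
Qed.

Lemma risk_le (e : 'I_n -> R) : 0 <= X ->
  (forall i, (\int[mu]_x (phi (x - tnth th0 i) * W i x)%:E <= (e i)%:E)%E) ->
  (\int[data_law th0]_y
     (posterior prior y [set th : Rn n | (r <= l2dist th th0)%R])%:E <=
   (r ^- 2 * (\sum_(i < n) e i) + (g^-1 * (nu * expR (n%:R * d)) +
     (p%:R^-1 * (n%:R * (8 * gauss8 * expR (- z ^+ 2 / 4))) +
      2 ^+ p * g / nu ^+ 2 * expR p%:R * X)))%:E)%E.
Proof.
move=> X0 he.
have g10 : (0 <= (g^-1)%:E)%E by rewrite lee_fin invr_ge0 ltW.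
have KE : (0 <= K%:E)%E by rewrite lee_fin.
have u10 y : (0 <= (u1 y)%:E)%E by rewrite lee_fin.
have u30 y : (0 <= (u3 y)%:E)%E by rewrite lee_fin.
have u20 y : (0 <= (g^-1)%:E * inv_den th0 prior t' y)%E by exact: mule_ge0.
have u40 y : (0 <= K%:E * damped_num y)%E by exact: mule_ge0.
have mu2 : measurable_fun setT (fun y => (g^-1)%:E * inv_den th0 prior t' y)%E.
  exact: emeasurable_funM.
have mu4 : measurable_fun setT (fun y => K%:E * damped_num y)%E.
  exact: emeasurable_funM.
have mu34 := emeasurable_funD mu3 mu4; have mu234 := emeasurable_funD mu2 mu34.
apply: (@le_trans _ _ (\int[data_law th0]_y ((u1 y)%:E +
    ((g^-1)%:E * inv_den th0 prior t' y + ((u3 y)%:E + K%:E * damped_num y))))%E).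
  apply: le_integral_ge0 => y _; last exact: pointwise.
  by rewrite lee_fin (posterior_ge0 a0 hprior).
rewrite ge0_integralD//; last by move=> y _; exact: adde_ge0 (u20 y) (adde_ge0 (u30 y) (u40 y)).
rewrite ge0_integralD//; last by move=> y _; exact: adde_ge0.
rewrite ge0_integralD// ge0_integralZl// ge0_integralZl//.
rewrite !EFinD; apply: leeD; first exact: mean_u1.
apply: leeD.
  by rewrite EFinM; apply: lee_wpmul2l => //; exact: mean_inv_den.
apply: leeD; first exact: mean_u3.
by rewrite [leRHS]EFinM; apply: lee_wpmul2l => //; exact: mean_damped_num.
Qed.

End risk_bound.

(** * Positivity of the constant C_u *)

Section Cu_positive.
Context {R : realType}.
Local Notation mu := (@lebesgue_measure R).

Lemma integral_derive (F f : R -> R) (a b : R) : a < b ->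
  (forall x, a <= x <= b -> is_derive x 1 F (f x)) ->
  (forall x, a <= x <= b -> {for x, continuous f}) ->
  (\int[mu]_(x in `[a, b]) (f x)%:E = (F b - F a)%:E)%E.
Proof.
move=> ab dF cf.
have cF x : a <= x <= b -> {for x, continuous F}.
  move=> /dF [dFx _].
  by apply/differentiable_continuous; rewrite -derivable1_diffP.
have sub x : x \in `]a, b[ -> a <= x <= b.
  by rewrite in_itv/= => /andP[/ltW -> /ltW ->].
rewrite (@continuous_FTC2 _ f F)//.
- apply/continuous_within_itvP => //; split.
  + by move=> x /sub; exact: cf.
  + by apply: cvg_at_right_filter; apply: cf; rewrite lexx ltW.
  + by apply: cvg_at_left_filter; apply: cf; rewrite lexx ltW.
- split.
  + by move=> x /sub /dF [].
  + by apply: cvg_at_right_filter; apply: cF; rewrite lexx ltW.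
  + by apply: cvg_at_left_filter; apply: cF; rewrite lexx ltW.
- by move=> x /sub /dF h; rewrite derive1E; apply: (@derive_val _ _ _ _ _ _ _ h).
Qed.

(** The integrand is singular at 0, so ]0, 1] is exhausted by the intervals [1/(n+1), 1], on which
    the antiderivative sqrt(z) increases by at most 1. *)
Lemma integral_sqrt_inv :
  (\int[mu]_(z in `]0%R, 1%R]) (2 * Num.sqrt z)^-1%:E <= 1)%E.
Proof.
pose F (n : nat) := [set` `[(n.+1%:R^-1 : R), 1]].
have FU : \bigcup_n F n = [set` `]0%R, 1%R]].
  apply/seteqP; split => x; rewrite /F /=.
    move=> [n _] /=; rewrite !in_itv/= => /andP[h ->]; rewrite andbT.
    by apply: lt_le_trans h; rewrite invr_gt0 ltr0n.
  rewrite !in_itv/= => /andP[x0 x1].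
  have [N _ /(_ N)/(_ (leqnn _)) h] := near_infty_natSinv_lt (PosNum x0).
  by exists N => //=; rewrite in_itv/= x1 andbT ltW.
have nd : nondecreasing_seq F.
  move=> m n mn; apply/subsetPset => x; rewrite /F/= !in_itv/= => /andP[h ->].
  by rewrite andbT; apply: le_trans h; rewrite lef_pV2 ?posrE ?ltr0n// ler_nat ltnS.
have mf : measurable_fun setT (fun z : R => (2 * Num.sqrt z)^-1).
  apply: (@measurableT_comp _ _ _ _ _ _ (fun x : R => x^-1)); first exact: measurable_invr.
  by apply: measurable_funM => //; apply: continuous_measurable_fun; exact: sqrt_continuous.
have mF i : measurable (F i : set (measurableTypeR R)) by exact: measurable_itv.
have mfF i : measurable_fun (F i : set (measurableTypeR R))
    (fun z : measurableTypeR R => ((2 * Num.sqrt (z : R))^-1)%:E).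
  by apply: measurable_funTS; apply/measurable_EFinP.
have fF0 i x : F i x -> (0 <= ((2 * Num.sqrt x)^-1)%:E)%E.
  by move=> _; rewrite lee_fin invr_ge0 mulr_ge0 ?sqrtr_ge0.
have := @ge0_nondecreasing_set_cvg_integral _ (measurableTypeR R) R F _ mu nd mF mfF fF0.
rewrite FU => cv; rewrite -(cvg_lim _ cv)//.
apply: lime_le; first by apply/cvg_ex; eexists; exact: cv.
near=> n; rewrite /F.
have n0 : (0 < n)%N by near: n; exists 1%N.
have x0 (x : R) : n.+1%:R^-1 <= x <= 1 -> 0 < x.
  by move=> /andP[h _]; apply: lt_le_trans h; rewrite invr_gt0 ltr0n.
have n1 : n.+1%:R^-1 < 1 :> R by rewrite invf_lt1 ?ltr0n// ltr1n ltnS.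
have dF (x : R) : n.+1%:R^-1 <= x <= 1 -> is_derive x 1 Num.sqrt ((2 * Num.sqrt x)^-1).
  by move=> /x0; exact: is_derive1_sqrt.
have cf (x : R) : n.+1%:R^-1 <= x <= 1 -> {for x, continuous (fun z : R => (2 * Num.sqrt z)^-1)}.
  move=> /x0 xp; apply: cvgV; first by rewrite mulf_neq0// gt_eqF// sqrtr_gt0.
  by apply: cvgM; [exact: cvg_cst|exact: sqrt_continuous].
rewrite (integral_derive n1 dF cf).
by rewrite lee_fin sqrtr1 lerBlDr lerDl sqrtr_ge0.
Unshelve. all: by end_near.
Qed.

Section m_fun_one_sqrt6.
Local Definition exp3 (z : R) : R := expR (3 * z).

Local Lemma continuous_exp3 z : {for z, continuous exp3}.
Proof.
apply: (continuous_comp (f := fun z : R => 3 * z)); last exact: continuous_expR.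
by apply: cvgM; [exact: cvg_cst|exact: cvg_id].
Qed.

Local Lemma integrable_cont (f : R -> R) : (forall z, {for z, continuous f}) ->
  mu.-integrable `[0, 1] (EFin \o f).
Proof.
move=> cf; apply: continuous_compact_integrable; first exact: segment_compact.
by apply: continuous_subspaceT => z; exact: cf.
Qed.

(** At tau = 1 the denominator is 1, and y^2 = 6 turns the exponential into exp(3 z). *)
Local Lemma I_intE k (f : R -> R) : (forall z, 0 <= z <= 1 -> z `^ k = f z) ->
  I_int 1 k (Num.sqrt 6) = (\int[mu]_(z in `[0%R, 1%R]) (f z * exp3 z))%R.
Proof.
move=> kf; apply: eq_Rintegral => z; rewrite inE/= in_itv/= => z01.
rewrite expr1n subrr mul0r addr0 divr1 kf// /exp3 sqr_sqrtr//.
by congr (_ * expR _); field.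
Qed.

Local Definition inv_sqrt (z : R) := (Num.sqrt z)^-1.
Local Definition pow32 (z : R) := z * Num.sqrt z.
Local Definition weight (z : R) := z * (5 - 6 * z) * exp3 z.

Local Lemma I_int_inv_sqrt : I_int 1 (- (1 / 2)) (Num.sqrt 6) = (\int[mu]_(z in `[0%R, 1%R]) (inv_sqrt z * exp3 z))%R.
Proof.
apply: I_intE => z /andP[z0 _].
by rewrite powRN div1r powR12_sqrt.
Qed.

Local Lemma I_int_sqrt : I_int 1 (1 / 2) (Num.sqrt 6) = (\int[mu]_(z in `[0%R, 1%R]) (Num.sqrt z * exp3 z))%R.
Proof. by apply: I_intE => z /andP[z0 _]; rewrite div1r powR12_sqrt. Qed.

Local Lemma I_int_pow32 : I_int 1 (3 / 2) (Num.sqrt 6) = (\int[mu]_(z in `[0%R, 1%R]) (pow32 z * exp3 z))%R.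
Proof.
apply: I_intE => z /andP[z0 _]; rewrite /pow32.
have -> : 3 / 2 = 1 + 2^-1 :> R by field.
rewrite powRD; last by apply/implyP; rewrite gt_eqF.
by rewrite powRr1// powR12_sqrt.
Qed.

Local Lemma continuous_sqrt_exp3 z : {for z, continuous (fun z => Num.sqrt z * exp3 z)}.
Proof. by apply: cvgM; [exact: sqrt_continuous|exact: continuous_exp3]. Qed.

Local Lemma continuous_pow32_exp3 z : {for z, continuous (fun z => pow32 z * exp3 z)}.
Proof.
apply: cvgM; last exact: continuous_exp3.
by apply: cvgM; [exact: cvg_id|exact: sqrt_continuous].
Qed.

Local Lemma continuous_weight z : {for z, continuous weight}.
Proof.
apply: cvgM; last exact: continuous_exp3.
apply: cvgM; first exact: cvg_id.
apply: cvgB; first exact: cvg_cst.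
by apply: cvgM; [exact: cvg_cst|exact: cvg_id].
Qed.

(** The antiderivative (- 2 z^2 + 3 z - 1) exp(3 z) is -1 at 0 and 0 at 1. *)
Local Lemma integral_weight : (\int[mu]_(z in `[0%R, 1%R]) weight z = 1)%R.
Proof.
have dF (x : R) : 0 <= x <= 1 ->
    is_derive x 1 (fun z => (- 2 * z ^+ 2 + 3 * z - 1) * exp3 z) (weight x).
  move=> _; rewrite /exp3; apply: is_derive_eq.
  by rewrite /weight /exp3 /GRing.scale/=; ring.
have cJ (x : R) : 0 <= x <= 1 -> {for x, continuous weight} by move=> _; exact: continuous_weight.
rewrite /Rintegral (integral_derive ltr01 dF cJ) /= /exp3 mulr0 expR0 mulr1 mulr1.
by rewrite !expr1n; lra.
Qed.

Local Lemma integrableZ k (f : R -> R) : mu.-integrable `[0, 1] (EFin \o f) ->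
  mu.-integrable `[0, 1] (EFin \o (fun z => k * f z)).
Proof.
move=> fi.
have h := @integrableZl _ (measurableTypeR R) R mu `[0, 1]%classic (measurable_itv _) k _ fi.
exact: h.
Qed.

Local Lemma integrable_sqrt : mu.-integrable `[0, 1] (EFin \o (fun z => Num.sqrt z * exp3 z)).
Proof. exact: integrable_cont continuous_sqrt_exp3. Qed.

Local Lemma integrable_pow32 : mu.-integrable `[0, 1] (EFin \o (fun z => pow32 z * exp3 z)).
Proof. exact: integrable_cont continuous_pow32_exp3. Qed.

Local Lemma integrable_weight : mu.-integrable `[0, 1] (EFin \o weight).
Proof. exact: integrable_cont continuous_weight. Qed.

Local Lemma integrable_inv_sqrt : mu.-integrable `[0, 1] (EFin \o (fun z => inv_sqrt z * exp3 z)).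
Proof.
have mfE : measurable_fun setT (fun z => inv_sqrt z * exp3 z).
  apply: measurable_funM.
    apply: (@measurableT_comp _ _ _ _ _ _ (fun x : R => x^-1)); first exact: measurable_invr.
    by apply: continuous_measurable_fun; exact: sqrt_continuous.
  by apply: continuous_measurable_fun => z; exact: continuous_exp3.
apply/integrableP; split.
  by apply/measurable_EFinP; apply: measurable_funTS; exact: mfE.
have m0 : measurable_fun setT (fun z : R => (2 * Num.sqrt z)^-1).
  apply: (@measurableT_comp _ _ _ _ _ _ (fun x : R => x^-1)); first exact: measurable_invr.
  apply: measurable_funM => //.
  by apply: continuous_measurable_fun; exact: sqrt_continuous.
apply: (@le_lt_trans _ _ ((2 * expR 3)%:E * 1)%E); last by rewrite mule1 ltry.
rewrite -integral_itv_obnd_cbnd; last first.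
  apply: measurable_funTS; apply: measurableT_comp => //; apply/measurable_EFinP.
  by exact: mfE.
apply: (@le_trans _ _ ((2 * expR 3)%:E *
   \int[mu]_(z in `]0%R, 1%R]) (2 * Num.sqrt z)^-1%:E)%E); last first.
  by rewrite lee_pmul2l ?integral_sqrt_inv// lte_fin mulr_gt0// expR_gt0.
have m01 : measurable_fun ([set` `]0%R, 1%R]] : set (measurableTypeR R)) (fun z : R => ((2 * Num.sqrt z)^-1)%:E).
  by apply: measurable_funTS; apply/measurable_EFinP.
have g0 (z : R) : [set` `]0%R, 1%R]] z -> (0 <= ((2 * Num.sqrt z)^-1)%:E)%E.
  by move=> _; rewrite lee_fin invr_ge0 mulr_ge0 ?sqrtr_ge0.
rewrite -ge0_integralZl//.
apply: le_integral_ge0 => //.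
move=> z; rewrite /= in_itv/= => /andP[z0 z1].
rewrite lee_fin ger0_norm; last by rewrite mulr_ge0 ?expR_ge0// invr_ge0 sqrtr_ge0.
rewrite /inv_sqrt invfM mulrACA mulfV ?pnatr_eq0// mul1r mulrC ler_wpM2r ?invr_ge0 ?sqrtr_ge0//.
by rewrite /exp3 ler_expR; lra.
Qed.

(* At [y ^ 2 = 6] the numerator of [m_fun 1] is the integral of
   [(5 - 6 z) sqrt z exp (3 z)], which is at least [sqrt (6 / 5)] times the
   integral of the exact derivative [weight]. *)
Lemma Cu_gt0 (Cu : R) :
  (forall tau y : R, 0 < tau <= 1 -> m_fun tau y <= Cu) -> 0 < Cu.
Proof.
move=> /(_ 1 (Num.sqrt 6)) h; have {h} := h _; rewrite ltr01 lexx => /(_ erefl).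
apply: lt_le_trans; rewrite /m_fun I_int_inv_sqrt I_int_sqrt I_int_pow32 sqr_sqrtr//.
set P := Rintegral _ _ _; set Q := Rintegral _ _ _; set N := Rintegral _ _ _.
have N0 : 0 < N.
  suff : 1 <= 5 * N by lra.
  rewrite -RintegralZl//; last exact: integrable_inv_sqrt.
  rewrite -{1}integral_weight.
  apply: (@le_Rintegral _ _ _ mu _ weight (fun z => 5 * (inv_sqrt z * exp3 z))) => //.
  - exact: integrable_weight.
  - exact: integrableZ integrable_inv_sqrt.
  move=> z; rewrite /= in_itv/= => /andP[z0 z1]; rewrite /weight mulrA ler_wpM2r ?expR_ge0//.
  have [->|zn0] := eqVneq z 0; first by rewrite mul0r mulr_ge0// /inv_sqrt invr_ge0 sqrtr_ge0.
  have zp : 0 < z by rewrite lt_neqAle eq_sym zn0.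
  have s0 : 0 < Num.sqrt z by rewrite sqrtr_gt0.
  have s1 : Num.sqrt z <= 1 by rewrite -sqrtr1 ler_sqrt.
  by rewrite /inv_sqrt ler_pdivlMr//; nra.
have PQ : 0 < 5 * P - 6 * Q.
  pose s : R := Num.sqrt (5 / 6).
  have s0 : 0 < s by rewrite sqrtr_gt0; lra.
  have s2 : s * s = 5 / 6 by rewrite -expr2 sqr_sqrtr//; lra.
  have iP : mu.-integrable `[0, 1] (EFin \o (fun z => 5 * (Num.sqrt z * exp3 z))).
    exact: integrableZ integrable_sqrt.
  have iQ : mu.-integrable `[0, 1] (EFin \o (fun z => 6 * (pow32 z * exp3 z))).
    exact: integrableZ integrable_pow32.
  have iPQ : mu.-integrable `[0, 1]
      (EFin \o (fun z => 5 * (Num.sqrt z * exp3 z) - 6 * (pow32 z * exp3 z))).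
    have h := @integrableB _ (measurableTypeR R) R mu `[0, 1]%classic (measurable_itv _)
      _ _ iP iQ.
    exact: h.
  suff : 1 <= s * (5 * P - 6 * Q) by move=> h; rewrite -(pmulr_rgt0 _ s0) (lt_le_trans ltr01).
  rewrite -(RintegralZl 5 _ integrable_sqrt)// -(RintegralZl 6 _ integrable_pow32)//.
  rewrite -RintegralB// -RintegralZl//.
  rewrite -{1}integral_weight.
  apply: (@le_Rintegral _ _ _ mu _ weight
    (fun z => s * (5 * (Num.sqrt z * exp3 z) - 6 * (pow32 z * exp3 z)))) => //.
  - exact: integrable_weight.
  - exact: integrableZ iPQ.
  move=> z; rewrite /= in_itv/= => /andP[z0 z1].
  rewrite /weight /pow32; have := expR_ge0 (3 * z); rewrite -/(exp3 z) => E0.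
  have := sqr_sqrtr z0; have : 0 <= Num.sqrt z by exact: sqrtr_ge0.
  move: (Num.sqrt z) => w w0 wz.
  rewrite -subr_ge0.
  (* With w = sqrt(z) and s^2 = 5/6, the factors 5 - 6 z = 6 (s^2 - w^2) and s - w change sign
     together, so the difference is nonnegative. The second summand, 0 by [s2], makes the identity
     valid for every [s]. *)
  have -> : s * (5 * (w * exp3 z) - 6 * (z * w * exp3 z)) - z * (5 - 6 * z) * exp3 z
     = 6 * w * (s - w) ^+ 2 * (s + w) * exp3 z
       + (w * s - w ^+ 2) * 6 * (5 / 6 - s * s) * exp3 z by rewrite -wz; field.
  rewrite s2 subrr mulr0 mul0r addr0 mulr_ge0// mulr_ge0 ?addr_ge0 ?(ltW s0)//.
  by rewrite mulr_ge0 ?sqr_ge0// mulr_ge0.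
have -> : 6 * ((P - Q) / N) - P / N = (5 * P - 6 * Q) / N by field; rewrite gt_eqF.
by rewrite divr_gt0.
Qed.

End m_fun_one_sqrt6.

End Cu_positive.

(** * Rates *)

Section coordinate_weight.
Context {R : realType}.
Local Notation mu := (@lebesgue_measure R).

(** The observation serves as intermediate centre: (th - th0)^2 <= 2 (th - y)^2 + 2 (y - th0)^2. *)
Lemma second_moment_at (t y th0 : R) : 0 < t <= 1 ->
  (\int[mu]_th (hsd t th * phi (y - th) * (th - th0) ^+ 2)%:E <=
   ((2 * (8 * ln t^-1 + moment_const) + 2 * (y - th0) ^+ 2) * psi t y)%:E)%E.
Proof.
move=> t01; have /andP[t0 t1] := t01.
have mh : measurable_fun setT (hsd t) by exact: measurable_hsd.
have m1 : measurable_fun setT (fun th : R => (hsd t th * phi (y - th) * (th - y) ^+ 2)%:E).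
  by apply/measurable_EFinP; meas.
have m2 : measurable_fun setT (fun th : R => (hsd t th * phi (y - th))%:E).
  by apply/measurable_EFinP; meas.
have p0 (th : R) : 0 <= hsd t th * phi (y - th) by rewrite mulr_ge0 ?hsd_ge0 ?phi_ge0.
have n1 (th : R) : (0 <= (hsd t th * phi (y - th) * (th - y) ^+ 2)%:E)%E.
  by rewrite lee_fin mulr_ge0 ?sqr_ge0.
have n2 (th : R) : (0 <= (hsd t th * phi (y - th))%:E)%E by rewrite lee_fin.
have k1 : (0 <= (2 : R)%:E)%E by rewrite lee_fin.
have k2 : (0 <= (2 * (y - th0) ^+ 2)%:E)%E by rewrite lee_fin mulr_ge0 ?sqr_ge0.
apply: (@le_trans _ _ (\int[mu]_th (2%:E * (hsd t th * phi (y - th) * (th - y) ^+ 2)%:E +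
   (2 * (y - th0) ^+ 2)%:E * (hsd t th * phi (y - th))%:E))%E).
  apply: le_integral_ge0 => th _; first by rewrite lee_fin mulr_ge0 ?sqr_ge0.
  rewrite -!(EFinM, EFinD) lee_fin.
  rewrite [leRHS](_ : _ = hsd t th * phi (y - th) * (2 * (th - y) ^+ 2 + 2 * (y - th0) ^+ 2)).
    apply: ler_wpM2l => //; have := sqr_ge0 ((th - y) - (y - th0)); lra.
  by ring.
have q1 (th : R) : (0 <= 2%:E * (hsd t th * phi (y - th) * (th - y) ^+ 2)%:E)%E.
  exact: mule_ge0.
have q2 (th : R) : (0 <= (2 * (y - th0) ^+ 2)%:E * (hsd t th * phi (y - th))%:E)%E.
  exact: mule_ge0.
have mm1 := measurable_funeM 2%:E m1.
have mm2 := measurable_funeM (2 * (y - th0) ^+ 2)%:E m2.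
rewrite ge0_integralD// ge0_integralZl// ge0_integralZl// psiE// (mulrDl (2 * (8 * _ + _))) [leRHS]EFinD.
rewrite (EFinM (2 * (y - th0) ^+ 2)) leeD2r// -(mulrA 2) EFinM lee_wpmul2l//.
exact: second_moment.
Qed.

Definition zero_const : R := locked (10 / (psi_lbc0 * phi0)).

Lemma zero_const_ge0 : 0 <= zero_const.
Proof.
rewrite /zero_const -lock divr_ge0// mulr_ge0 ?(ltW phi0_gt0)//.
exact/ltW/psi_lbc0_gt0.
Qed.

(* [l] bounds [ln t^-1]; for a null coordinate the second bound is integrable
   against the standard normal density only on [|y| <= 3 sqrt l]. *)
Definition coord_weight (l T th0 y : R) : R :=
  let q := 2 * (8 * l + moment_const) in
  if th0 == 0 then
    if `|y| <= 3 * Num.sqrt l then zero_const * T * expR (y ^+ 2 / 2)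
    else (q + 2) * (1 + y ^+ 2)
  else q + 2 * (y - th0) ^+ 2.

Variables l T : R.
Hypotheses (l0 : 0 < l) (T0 : 0 <= T).

Let q : R := 2 * (8 * l + moment_const).
Let q0 : 0 <= q.
Proof. by rewrite mulr_ge0// addr_ge0 ?moment_const_ge0// mulr_ge0// ltW. Qed.

Lemma coord_weight_ge0 th0 y : 0 <= coord_weight l T th0 y.
Proof.
have := q0; rewrite /coord_weight -/q => q0'.
case: ifP => _; last by rewrite addr_ge0// mulr_ge0 ?sqr_ge0.
case: ifP => _; first by rewrite mulr_ge0 ?expR_ge0// mulr_ge0 ?zero_const_ge0.
by rewrite mulr_ge0// addr_ge0// sqr_ge0.
Qed.

Lemma measurable_coord_weight th0 : measurable_fun setT (coord_weight l T th0).
Proof.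
rewrite /coord_weight; case: (th0 == 0) => /=; last by meas.
apply: measurable_fun_ifT.
- by apply: measurable_fun_ler; meas.
- by meas.
- by meas.
Qed.

Lemma second_moment_weight t th0 y : 0 < t <= 1 -> t <= T -> ln t^-1 <= l ->
  (\int[mu]_th (hsd t th * phi (y - th) * (th - th0) ^+ 2)%:E <=
   (coord_weight l T th0 y * psi t y)%:E)%E.
Proof.
move=> t01 tT tl; have psi0 := psi_ge0 t y.
have q_le : 2 * (8 * ln t^-1 + moment_const) <= q by rewrite /q ler_wpM2l// lerD2r ler_wpM2l.
have := q0; rewrite /coord_weight -/q => q0'.
case: eqP => [->|_]; last first.
  by apply: le_trans (second_moment_at _ _ t01) _; rewrite lee_fin ler_wpM2r// lerD2r.
case: ifP => _.
  under eq_integral do rewrite subr0.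
  apply: le_trans (second_moment_zero _ t01) _; rewrite lee_fin.
  rewrite ler_wpM2r// ler_wpM2r ?expR_ge0// /zero_const -lock ler_wpM2l//.
  by have := zero_const_ge0; rewrite /zero_const -lock.
apply: le_trans (second_moment_at _ _ t01) _; rewrite lee_fin ler_wpM2r// subr0.
have := mulr_ge0 q0' (sqr_ge0 y); lra.
Qed.

Definition weight_mean (l T th0 : R) : R :=
  let q := 2 * (8 * l + moment_const) in
  if th0 == 0 then 6 * zero_const * T * Num.sqrt l + 8 * gauss8 * (q + 2) * expR (- l)
  else q + 16 * gauss8.

(** At a null coordinate the threshold 3 sqrt(l) gives the tail exp(- 9 l / 4) <= exp(- l). For l =
    ln n this is 1/n, small enough to be summed over all coordinates. *)
Lemma coord_weight_mean th0 :
  (\int[mu]_y (phi (y - th0) * coord_weight l T th0 y)%:E <= (weight_mean l T th0)%:E)%E.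
Proof.
have := q0; rewrite /coord_weight /weight_mean -/q => q0'.
have g0 := gauss8_gt0 (R := R).
case: eqP => [->|_].
  under eq_integral do rewrite subr0.
  apply: le_trans (zero_weight_mean _ _ _) _; rewrite ?addr_ge0//.
  - by rewrite mulr_ge0// zero_const_ge0.
  - by rewrite mulr_gt0// sqrtr_gt0.
  rewrite lee_fin lerD//; first by rewrite le_eqVlt; apply/orP; left; apply/eqP; ring.
  rewrite (_ : 8 * (q + 2) * gauss8 = 8 * gauss8 * (q + 2)); last by ring.
  apply: ler_wpM2l; first by rewrite mulr_ge0 ?addr_ge0// mulr_ge0// ltW.
  by rewrite ler_expR exprMn sqr_sqrtr ?(ltW l0)//; have := l0; lra.
have m1 : measurable_fun setT (fun y : R => (phi (y - th0))%:E).
  by apply/measurable_EFinP; meas.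
have m2 : measurable_fun setT (fun y : R => (phi (y - th0) * (y - th0) ^+ 2)%:E).
  by apply/measurable_EFinP; meas.
have n1 (y : R) : (0 <= (phi (y - th0))%:E)%E by rewrite lee_fin phi_ge0.
have n2 (y : R) : (0 <= (phi (y - th0) * (y - th0) ^+ 2)%:E)%E.
  by rewrite lee_fin mulr_ge0 ?phi_ge0 ?sqr_ge0.
have qE : (0 <= q%:E)%E by rewrite lee_fin.
have k2 : (0 <= (2 : R)%:E)%E by rewrite lee_fin.
rewrite [leLHS](_ : _ = (\int[mu]_y (q%:E * (phi (y - th0))%:E +
    2%:E * (phi (y - th0) * (y - th0) ^+ 2)%:E))%E); last first.
  by apply: eq_integral => y _; rewrite -!(EFinM, EFinD); congr EFin; ring.
have mm1 := measurable_funeM q%:E m1; have mm2 := measurable_funeM 2%:E m2.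
have p1 (y : R) : (0 <= q%:E * (phi (y - th0))%:E)%E by exact: mule_ge0.
have p2 (y : R) : (0 <= 2%:E * (phi (y - th0) * (y - th0) ^+ 2)%:E)%E by exact: mule_ge0.
rewrite ge0_integralD// ge0_integralZl// ge0_integralZl//.
have i1 : (\int[mu]_y (phi (y - th0))%:E = 1)%E.
  exact: integral_phi.
rewrite i1 mule1 (_ : 16 * gauss8 = 2 * (8 * gauss8)); last by ring.
by rewrite [leRHS]EFinD leeD2l// EFinM lee_wpmul2l// gaussian_variance_le.
Qed.

End coordinate_weight.

(** * Explicit rates in terms of u = n / p *)

Section rate_constants.
Context {R : realType}.
Local Notation mu := (@lebesgue_measure R).

Lemma inv_const_ge0 : 0 <= inv_const :> R.
Proof.
have c0 := psi_lbc0_gt0 (R := R); have g0 := gauss8_gt0 (R := R).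
have n0 k : 0 <= k%:R :> R by exact: ler0n.
rewrite /inv_const -lock; apply: addr_ge0; apply: mulr_ge0; try exact: n0.
  by apply: addr_ge0; [exact: ler01|apply: divr_ge0; [exact: n0|exact: ltW]].
by apply: mulr_ge0; [exact: n0|apply: divr_ge0; exact: ltW].
Qed.

Lemma expR_ge_half_sqr (x : R) : 0 <= x -> x ^+ 2 / 2 <= expR x.
Proof.
move=> x0; apply: le_trans (expR_ge1Dxn 1 x0).
by rewrite /= lerDr; lra.
Qed.

Variable A : R.
Hypothesis A0 : 0 < A.

Definition ratio_const : R := inv_const * (6 * A + 2 / 9 * A ^+ 2).

Lemma ratio_const_ge0 : 0 <= ratio_const.
Proof. by rewrite mulr_ge0 ?inv_const_ge0// addr_ge0// mulr_ge0 ?sqr_ge0// ltW. Qed.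

(** The truncation point is b = L / 6 with L = sqrt(ln u). Then t / b <= 6 A / u, the root in the
    bound on [t] cancelling. Moreover exp(8 b^2) = exp(2 ln u / 9) <= sqrt(u) and (ln u)^2 <= 8
    sqrt(u), so the second term is at most (2/9) A^2 / u. Finally ln u >= 36 ensures b >= 1 >= t. *)
Lemma inverse_ratio_rate (u t : R) : 36 <= ln u -> 0 < t <= 1 ->
  t <= A * (u^-1 * Num.sqrt (ln u)) ->
  (\int[mu]_y (phi y * (phi y / psi t y))%:E <= (1 + ratio_const / u)%:E)%E.
Proof.
move=> v36 t01 tu; have /andP[t0 t1] := t01.
have u0 : 0 < u by rewrite ltNge; apply/negP => /ln0 E; rewrite E in v36; lra.
pose v := ln u; have vE : expR v = u by rewrite lnK.
pose L := Num.sqrt v; have L2 : L ^+ 2 = v by rewrite sqr_sqrtr//; rewrite /v; lra.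
have L0 : 0 <= L by exact: sqrtr_ge0.
have L6 : 6 <= L by rewrite -(@ler_pXn2r _ 2) ?nnegrE// L2 /v; lra.
apply: le_trans (@inverse_ratio_mean _ t (L / 6) t01 _) _; first by lra.
rewrite lee_fin lerD2l /ratio_const -[leRHS]mulrA ler_wpM2l ?inv_const_ge0// [leRHS]mulrDl.
rewrite -/v -/L in tu; apply: lerD.
  rewrite ler_pdivrMr; last by lra.
  by apply: le_trans tu _; rewrite le_eqVlt; apply/orP; left; apply/eqP; field; rewrite gt_eqF.
apply: (@le_trans _ _ ((L / 6) ^+ 2 * (A * (u^-1 * L)) ^+ 2 * expR (v / 2))).
  apply: ler_pM; [by rewrite mulr_ge0 ?sqr_ge0|exact: expR_ge0| |].
    apply: ler_wpM2l; first exact: sqr_ge0.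
    by apply: lerXn2r => //; rewrite nnegrE ltW// (lt_le_trans t0).
  by rewrite ler_expR exprMn L2; rewrite -/v in v36; lra.
have e0 := expR_gt0 (v / 2).
have ee : expR (v / 2) * expR (v / 2) = u by rewrite -expRD -vE; congr expR; field.
have v8 : v ^+ 2 / 8 <= expR (v / 2).
  apply: le_trans (expR_ge_half_sqr _); first by rewrite -/v in v36; lra.
  by rewrite -/v in v36; lra.
rewrite [leLHS](_ : _ = (2 / 9 * A ^+ 2 / u ^+ 2) * (v ^+ 2 / 8 * expR (v / 2))); last first.
  by rewrite -L2; field; rewrite gt_eqF.
apply: (@le_trans _ _ ((2 / 9 * A ^+ 2 / u ^+ 2) * u)).
  rewrite ler_wpM2l//; last by rewrite -[leRHS]ee ler_wpM2r// ltW.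
  by rewrite divr_ge0 ?sqr_ge0// mulr_ge0 ?sqr_ge0.
by rewrite le_eqVlt; apply/orP; left; apply/eqP; field; rewrite gt_eqF.
Qed.

(** Exponent of the test per unit of x p, where x = t / t'. In test_const t / (3 L) times n / 2,
    with t' = A (p / n) L / 2, the factor L cancels and 3, 2 and 2 multiply to 12. *)
Definition test_rate : R := test_const * A / 12.

Lemma test_rate_gt0 : 0 < test_rate.
Proof. by rewrite divr_gt0// mulr_gt0// test_const_gt0. Qed.

(** Half of the exponent absorbs the power, by x <= (2 / k) exp(k x / 2) with k = [test_rate]; the
    other half decreases in [x] and is evaluated at [x0]. *)
Lemma test_decay (p : nat) (x x0 : R) : 0 <= x -> x0 <= x ->
  x ^+ p * expR (- (test_rate * x * p%:R)) <= (2 / test_rate * expR (- (test_rate * x0 / 2))) ^+ p.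
Proof.
move=> xp x0x; have k0 := test_rate_gt0.
rewrite mulrC -mulNr expRM_natr -exprMn; apply: lerXn2r; rewrite ?nnegrE.
- by rewrite mulr_ge0 ?expR_ge0.
- by rewrite mulr_ge0 ?expR_ge0// divr_ge0// ltW.
have h : x <= 2 / test_rate * expR (test_rate * x / 2).
  have e := expR_ge1Dx (test_rate * x / 2).
  by rewrite [leRHS]mulrAC ler_pdivlMr//; lra.
apply: (@le_trans _ _ (2 / test_rate * expR (- (test_rate * x / 2)))).
  rewrite [leLHS]mulrC; have e1 := expR_gt0 (- (test_rate * x)).
  apply: le_trans (ler_wpM2r (ltW e1) h) _.
  rewrite -[leLHS]mulrA -expRD le_eqVlt; apply/orP; left; apply/eqP.
  by congr (_ * expR _); field.
apply: ler_wpM2l; first by rewrite divr_ge0// ltW.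
rewrite ler_expR lerN2 ler_pM2r//.
by rewrite ler_wpM2l// ltW.
Qed.

(* The range of [t / t'] beyond which the test kills the prior mass even
   when the prior only has mass [exp (- B p)] near [t']. *)
Definition cutoff (B : R) : R :=
  1 + 2 / test_rate * (ratio_const + 4 + 2 / test_rate + B).

Definition cutoff_const : R :=
  1 + 2 / test_rate * (ratio_const + 5 + 2 / test_rate).

Lemma cutoff_ge1 B : 0 <= B -> 1 <= cutoff B.
Proof.
move=> B0; have k0 := test_rate_gt0; have r0 := ratio_const_ge0.
have : 0 <= 2 / test_rate by rewrite divr_ge0// ltW.
by move=> k; rewrite /cutoff lerDl mulr_ge0// !addr_ge0.
Qed.

Lemma cutoff_le B : 0 <= B -> cutoff B <= (1 + B) * cutoff_const.
Proof.
move=> B0; have k0 := test_rate_gt0; have r0 := ratio_const_ge0.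
have : 0 <= 2 / test_rate by rewrite divr_ge0// ltW.
rewrite /cutoff /cutoff_const; move: (2 / test_rate) (ratio_const) r0 => k r r0 kk.
have := mulr_ge0 (mulr_ge0 kk B0) kk; have := mulr_ge0 (mulr_ge0 kk B0) r0.
have := mulr_ge0 kk B0; nra.
Qed.

(** With k = [test_rate], the exponent k [cutoff B] / 2 contains 2 / k, which beats the factor 2 / k
    <= exp(2 / k), then [B] and [ratio_const], and 4, which exceeds the 3 on the left by the one
    unit of decay that remains. *)
Lemma cutoff_decay B (p : nat) :
  expR ((B + ratio_const + 3) * p%:R) *
    (2 / test_rate * expR (- (test_rate * cutoff B / 2))) ^+ p <= expR (- p%:R).
Proof.
have k0 := test_rate_gt0; set k := 2 / test_rate.
have kk : 0 < k by rewrite divr_gt0.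
rewrite expRM_natr -exprMn -[- p%:R]mulN1r expRM_natr.
apply: lerXn2r; rewrite ?nnegrE ?expR_ge0//.
  by rewrite mulr_ge0 ?expR_ge0// mulr_ge0 ?expR_ge0// ltW.
apply: (@le_trans _ _ (expR (B + ratio_const + 3) *
  (expR k * expR (- (test_rate * cutoff B / 2))))).
  apply: ler_wpM2l; first exact: expR_ge0.
  apply: ler_wpM2r; first exact: expR_ge0.
  by have := expR_ge1Dx k; lra.
rewrite -!expRD ler_expR /cutoff -/k.
have -> : test_rate * (1 + k * (ratio_const + 4 + k + B)) / 2 =
   test_rate / 2 + (ratio_const + 4 + k + B).
  by rewrite /k; field; rewrite gt_eqF.
by lra.
Qed.

End rate_constants.

(** * Nonasymptotic bound on the maximal risk *)

Section max_risk_bound.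
Context {R : realType}.
Local Notation mu := (@lebesgue_measure R).
Local Notation Rn n := (n.-tuple (measurableTypeR R)).

Lemma sum_weight_mean n p (th0 : Rn n) (l T q : R) : ell0 p th0 -> 0 < l -> 0 <= T ->
  q = 2 * (8 * l + moment_const) ->
  \sum_(i < n) weight_mean l T (tnth th0 i) <=
  n%:R * (6 * zero_const * T * Num.sqrt l + 8 * gauss8 * (q + 2) * expR (- l)) +
  p%:R * (q + 16 * gauss8).
Proof.
move=> hth0 l0 T0 qE; have g0 := gauss8_gt0 (R := R).
have q0 : 0 <= q by rewrite qE mulr_ge0// addr_ge0 ?moment_const_ge0// mulr_ge0// ltW.
set a := 6 * _ * _ * _ + _; set b := q + _.
have b0 : 0 <= b by rewrite addr_ge0// mulr_ge0// ltW.
have a0 : 0 <= a.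
  apply: addr_ge0.
    by rewrite mulr_ge0 ?sqrtr_ge0// mulr_ge0// mulr_ge0// zero_const_ge0.
  by rewrite mulr_ge0 ?expR_ge0// mulr_ge0 ?addr_ge0// mulr_ge0// ltW.
apply: (@le_trans _ _ (\sum_(i < n) (a + (if tnth th0 i != 0 then b else 0)))).
  apply: ler_sum => i _; rewrite /weight_mean -qE -/a -/b.
  by case: eqP => _ /=; rewrite ?addr0// lerDr.
rewrite big_split/= sumr_const card_ord mulr_natl lerD2l -big_mkcond/= sumr_const mulr_natl.
rewrite ler_wpMn2l//; move: hth0; rewrite /ell0/= => h; apply: leq_trans h.
by apply/eq_leq/eq_card => i; apply/idP/idP => [/mem_set|/set_mem].
Qed.

Variable A : R.
Hypothesis A0 : 0 < A.

Definition weight_const : R :=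
  (1 + 8 * gauss8) * (16 + 2 * moment_const) + 32 * gauss8 +
  3 * zero_const * A * cutoff_const A.

Lemma weight_const_ge0 : 0 <= weight_const.
Proof.
have g0 := gauss8_gt0 (R := R); have m0 := moment_const_ge0 (R := R).
have z0 := zero_const_ge0 (R := R); have c1 := cutoff_ge1 A0 (lexx 0).
have := cutoff_le A0 (lexx 0); rewrite addr0 mul1r => c2.
have c0 : 0 <= cutoff_const A by rewrite (le_trans _ c2)// (le_trans ler01).
apply: addr_ge0; last by rewrite mulr_ge0// mulr_ge0 ?(ltW A0)// mulr_ge0.
apply: addr_ge0; last by rewrite mulr_ge0// ltW.
by rewrite mulr_ge0 ?addr_ge0 ?mulr_ge0// ltW.
Qed.

Variables (n p : nat) (prior : R -> R) (K B r : R).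
Hypotheses (p_gt0 : (0 < p)%N) (p_le : (2 * p <= n)%N).
Hypotheses (ln_ratio : 36 <= ln (n%:R / p%:R : R)) (ln_n : 1 <= ln (n%:R : R)).
Hypothesis tn_le1 : A * tau_seq n p <= 1.
Hypothesis hprior : prob_density_on n%:R^-1 1 prior.
Hypotheses (K0 : 0 < K) (B0 : 0 <= B) (r0 : 0 < r).
Hypothesis prior_mass : ((K * expR (- B * p%:R))%:E <=
  \int[mu]_(t in `[(A * tau_seq n p / 2)%R, (A * tau_seq n p)%R]) (prior t)%:E)%E.

Let u : R := n%:R / p%:R.
Let L : R := Num.sqrt (ln u).
Let l : R := ln n%:R.
Let t' : R := A * tau_seq n p / 2.
Let T : R := cutoff A B * t'.

Let n_gt0 : (0 < n)%N. Proof. by apply: leq_trans p_le; rewrite muln_gt0. Qed.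

Let L_ge6 : 6 <= L.
Proof.
rewrite -(@ler_pXn2r _ 2) ?nnegrE ?sqrtr_ge0// sqr_sqrtr; have := ln_ratio.
  by rewrite -/u; lra.
by rewrite -/u; lra.
Qed.

Let L_le : L <= Num.sqrt l.
Proof.
have n0 := n_gt0.
rewrite ler_wsqrtr// /l ler_ln ?posrE ?divr_gt0 ?ltr0n// ler_pdivrMr ?ltr0n//.
by rewrite ler_peMr ?ler0n// ler1n.
Qed.

Let t'E : t' = A * (p%:R / n%:R) * L / 2.
Proof. by rewrite /t' /tau_seq -/u -/L mulrA. Qed.

Let t'_gt0 : 0 < t'.
Proof.
have n0 := n_gt0; have L6 := L_ge6; rewrite t'E divr_gt0// mulr_gt0//; last by lra.
by rewrite mulr_gt0// divr_gt0// ltr0n.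
Qed.

Lemma cutoff_test t : T < t ->
  (t / t') ^+ p * expR (- (test_const * t / (3 * L)) * (n%:R - p%:R)) <=
  (2 / test_rate A * expR (- (test_rate A * cutoff A B / 2))) ^+ p.
Proof.
move=> Tt; have t0 := t'_gt0; have n0 := n_gt0; have L6 := L_ge6.
have k0 := test_rate_gt0 A0; have c1 := cutoff_ge1 A0 B0.
have xc : cutoff A B <= t / t' by rewrite ler_pdivlMr// ltW.
have x0 : 0 <= t / t' by rewrite (le_trans _ xc)// (le_trans ler01).
apply: le_trans (test_decay A0 p x0 xc).
rewrite ler_wpM2l ?exprn_ge0// ler_expR mulNr lerN2.
have pn : p%:R <= n%:R / 2 :> R.
  by rewrite ler_pdivlMr// -natrM ler_nat mulnC.
have tn0 : 0 < test_const * t / (3 * L).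
  rewrite divr_gt0//; last by lra.
  by rewrite mulr_gt0 ?test_const_gt0// (le_lt_trans _ Tt)// mulr_ge0 ?(ltW t0)// (le_trans ler01).
apply: (@le_trans _ _ (test_const * t / (3 * L) * (n%:R / 2))); last first.
  by rewrite ler_wpM2l ?(ltW tn0)//; lra.
rewrite le_eqVlt; apply/orP; left; apply/eqP; rewrite t'E /test_rate.
have L0 : L != 0 by rewrite gt_eqF//; lra.
by field; rewrite L0 !gt_eqF ?ltr0n// A0.
Qed.

(** [T] is of order (1 + B) (p / n) L, so the central ranges of the null coordinates add up to n T
    sqrt(ln n), at most of order (1 + B) p ln n. Their tails carry exp(- l) = 1/n and add up to O(ln
    n); the nonzero coordinates contribute O(p ln n). *)
Lemma sum_weight_mean_le (th0 : Rn n) : ell0 p th0 ->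
  \sum_(i < n) weight_mean l T (tnth th0 i) <=
  weight_const * (1 + B) * (p%:R * ln n%:R).
Proof.
move=> hth0; have t0 := t'_gt0; have n0 := n_gt0; have L6 := L_ge6.
have c1 := cutoff_ge1 A0 B0; have c2 := cutoff_le A0 B0.
have l1 : 1 <= l by exact: ln_n.
have l0 : 0 < l by lra.
have T0 : 0 <= T by rewrite mulr_ge0 ?(ltW t0)// (le_trans ler01).
set q := 2 * (8 * l + moment_const).
apply: le_trans (@sum_weight_mean n p th0 l T q hth0 l0 T0 erefl) _.
have g0 := gauss8_gt0 (R := R); have m0 := moment_const_ge0 (R := R).
have z0 := zero_const_ge0 (R := R).
have nn0 : n%:R != 0 :> R by rewrite gt_eqF// ltr0n.
have p1 : 1 <= p%:R :> R by rewrite ler1n.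
have s0 : 0 <= Num.sqrt l by exact: sqrtr_ge0.
have sl : Num.sqrt l * Num.sqrt l = l by rewrite -expr2 sqr_sqrtr// ltW.
have Ll := L_le.
have q_le : q <= (16 + 2 * moment_const) * l.
  by rewrite /q; have := ler_wpM2l m0 l1; lra.
have q0 : 0 <= q by rewrite mulr_ge0// addr_ge0// mulr_ge0// ltW.
rewrite mulrDr.
have e1 : n%:R * (6 * zero_const * T * Num.sqrt l) <=
    3 * zero_const * A * cutoff A B * (p%:R * l).
  rewrite /T t'E [leLHS](_ : _ = 3 * zero_const * A * cutoff A B * (p%:R * (L * Num.sqrt l))).
    apply: ler_wpM2l; first by rewrite mulr_ge0 ?(le_trans ler01 c1)// mulr_ge0 ?(ltW A0)// mulr_ge0.
    by rewrite ler_wpM2l ?ler0n// -[leRHS]sl ler_wpM2r.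
  by field.
have e2 : n%:R * (8 * gauss8 * (q + 2) * expR (- l)) <= 8 * gauss8 * (q + 2) * p%:R.
  rewrite expRN lnK ?posrE ?ltr0n//.
  rewrite [leLHS](_ : _ = 8 * gauss8 * (q + 2) * 1); last by field.
  by rewrite ler_wpM2l// mulr_ge0 ?addr_ge0// mulr_ge0// ltW.
have e3 : 3 * zero_const * A * cutoff A B * (p%:R * l) <=
    3 * zero_const * A * cutoff_const A * (1 + B) * (p%:R * l).
  rewrite ler_wpM2r ?mulr_ge0 ?ler0n ?(ltW l0)// -!mulrA; apply: ler_wpM2l => //.
  apply: ler_wpM2l => //; apply: ler_wpM2l; first exact: ltW.
  by rewrite mulrC in c2.
have e4 : 8 * gauss8 * (q + 2) * p%:R + p%:R * (q + 16 * gauss8) <=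
    ((1 + 8 * gauss8) * (16 + 2 * moment_const) + 32 * gauss8) * (p%:R * l).
  rewrite [leLHS](_ : _ = p%:R * ((1 + 8 * gauss8) * q + 32 * gauss8)); last by ring.
  rewrite [leRHS](_ : _ = p%:R * ((1 + 8 * gauss8) * ((16 + 2 * moment_const) * l) +
    32 * gauss8 * l)); last by ring.
  rewrite ler_wpM2l ?ler0n//; apply: lerD.
    by rewrite ler_wpM2l// addr_ge0// mulr_ge0// ltW.
  by rewrite ler_peMr// mulr_ge0// ltW.
have e5 : ((1 + 8 * gauss8) * (16 + 2 * moment_const) + 32 * gauss8) * (p%:R * l) <=
    ((1 + 8 * gauss8) * (16 + 2 * moment_const) + 32 * gauss8) * (1 + B) * (p%:R * l).
  rewrite ler_wpM2r ?mulr_ge0 ?ler0n ?(ltW l0)// ler_peMr//; last by rewrite lerDl.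
  by rewrite addr_ge0 ?mulr_ge0 ?addr_ge0 ?mulr_ge0// ltW.
rewrite /weight_const -/l.
rewrite [leRHS](_ : _ =
  ((1 + 8 * gauss8) * (16 + 2 * moment_const) + 32 * gauss8) * (1 + B) * (p%:R * l) +
  3 * zero_const * A * cutoff_const A * (1 + B) * (p%:R * l)); last by ring.
move: e1 e2 e3 e4 e5; lra.
Qed.

(** At z = 3 L the tail is exp(- 9 ln u / 4) <= u^-2, and one factor 1/u pays for n / p. *)
Lemma test_tail : (p%:R^-1 : R) * (n%:R * (8 * gauss8 * expR (- (3 * L) ^+ 2 / 4))) <=
  8 * gauss8 * (p%:R / n%:R).
Proof.
have n0 := n_gt0; have g0 := gauss8_gt0 (R := R); have v36 := ln_ratio.
have u0 : 0 < u by rewrite divr_gt0 ?ltr0n.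
have eu : expR (- (3 * L) ^+ 2 / 4) <= u ^- 2.
  have -> : u ^- 2 = expR (- (2 * ln u)).
    by rewrite expRN (expRM_natl 2) lnK.
  rewrite ler_expR exprMn sqr_sqrtr; first by rewrite -/u in v36; lra.
  by rewrite -/u in v36; lra.
apply: (@le_trans _ _ (p%:R^-1 * (n%:R * (8 * gauss8 * u ^- 2)))).
  rewrite ler_wpM2l ?invr_ge0 ?ler0n// ler_wpM2l ?ler0n//.
  by rewrite ler_wpM2l// mulr_ge0// ltW.
rewrite le_eqVlt; apply/orP; left; apply/eqP; rewrite /u.
by field; rewrite !gt_eqF ?ltr0n.
Qed.

(** The prefactors are 2^p <= exp(p) from the nonzero coordinates near t', exp((ratio_const + 1) p)
    from [g], exp(p) from undoing the damping, and exp(B p) / K from 1 / nu: exactly the exponent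
    that [cutoff_decay] overcomes. *)
Lemma prior_tail (nu : R) : 0 < nu -> K * expR (- B * p%:R) <= nu ->
  2 ^+ p * (nu * expR ((ratio_const A + 1) * p%:R)) / nu ^+ 2 * expR p%:R *
    (2 / test_rate A * expR (- (test_rate A * cutoff A B / 2))) ^+ p
  <= K^-1 * expR (- p%:R).
Proof.
move=> nu0 hnu; apply: le_trans (ler_wpM2l _ (cutoff_decay A0 B p)); last first.
  by rewrite invr_ge0 ltW.
rewrite [leRHS]mulrA; apply: ler_wpM2r.
  by rewrite exprn_ge0// mulr_ge0 ?expR_ge0// divr_ge0// ltW// test_rate_gt0.
have e2 : 2 ^+ p <= expR p%:R :> R.
  rewrite -[p%:R]mulr1 expRM_natl lerXn2r// ?nnegrE ?expR_ge0//.
  by have := expR_ge1Dx (1 : R); lra.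
have inu : nu^-1 <= K^-1 * expR (B * p%:R).
  rewrite -[B * _]opprK -mulNr expRN -invfM lef_pV2 ?posrE//.
  by rewrite mulr_gt0 ?expR_gt0.
rewrite [leLHS](_ : _ = 2 ^+ p * (nu^-1 *
    (expR ((ratio_const A + 1) * p%:R) * expR p%:R))); last first.
  by field; rewrite gt_eqF.
apply: (@le_trans _ _ (expR p%:R * (K^-1 * expR (B * p%:R) *
   (expR ((ratio_const A + 1) * p%:R) * expR p%:R)))).
  apply: ler_pM => //; rewrite ?exprn_ge0 ?mulr_ge0 ?expR_ge0 ?invr_ge0 ?(ltW nu0)//.
  by rewrite ler_wpM2r// mulr_ge0 ?expR_ge0.
rewrite le_eqVlt; apply/orP; left; apply/eqP.
rewrite mulrCA -!mulrA; congr (_ * _); rewrite -!expRD; congr expR; ring.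
Qed.

Lemma posterior_risk_le (th0 : Rn n) : ell0 p th0 ->
  (\int[data_law th0]_y
     (posterior prior y [set th : Rn n | (r <= l2dist th th0)%R])%:E <=
   (8 * gauss8 * (p%:R / n%:R) + (1 + K^-1) * expR (- p%:R) +
    weight_const * (1 + B) * (p%:R * ln n%:R) / r ^+ 2)%:E)%E.
Proof.
move=> hth0; have t0 := t'_gt0; have n0 := n_gt0; have L6 := L_ge6.
have c1 := cutoff_ge1 A0 B0; have D0 := ratio_const_ge0 A0.
have nR : 0 < n%:R :> R by rewrite ltr0n.
have pR : 0 < p%:R :> R by rewrite ltr0n.
have t2 : 2 * t' = A * tau_seq n p by rewrite /t'; field.
have mprior : measurable_fun setT (fun t => (prior t)%:E).
  by apply/measurable_EFinP; case: hprior.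
have prior0 (t : R) : (0 <= (prior t)%:E)%E by rewrite lee_fin; case: hprior.
pose nu : R := fine (\int[mu]_(t in `[t', (2 * t')%R]) (prior t)%:E)%E.
have nuE : (\int[mu]_(t in `[t', (2 * t')%R]) (prior t)%:E = nu%:E)%E.
  rewrite fineK// ge0_fin_numE; last exact: integral_ge0.
  apply: (@le_lt_trans _ _ 1%E); last by rewrite ltry.
  case: hprior => _ _ _ <-.
  by apply: ge0_subset_integral.
have hnu : K * expR (- B * p%:R) <= nu by rewrite -lee_fin -nuE t2.
have nu0 : 0 < nu by apply: lt_le_trans hnu; rewrite mulr_gt0// expR_gt0.
have T0 : 0 <= T by rewrite mulr_ge0 ?(ltW t0)// (le_trans ler01).
have l0 : 0 < l by apply: lt_le_trans ln_n.
(* The mean of [inv_den] is at most nu exp(ratio_const p); one more factor exp(p) makes the Markov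
   bound exp(- p). *)
pose g := nu * expR ((ratio_const A + 1) * p%:R).
have g0 : 0 < g by rewrite mulr_gt0// expR_gt0.
have d0 : 0 <= ratio_const A / u by rewrite divr_ge0// divr_ge0// ler0n.
pose X := (2 / test_rate A * expR (- (test_rate A * cutoff A B / 2))) ^+ p.
have X0 : 0 <= X.
  by rewrite exprn_ge0// mulr_ge0 ?expR_ge0// divr_ge0// ltW// test_rate_gt0.
have a0 : 0 < n%:R^-1 :> R by rewrite invr_gt0.
have t'T : t' <= T by rewrite /T ler_peMl ?(ltW t0).
have t'1 : 2 * t' <= 1 by rewrite t2.
have z1 : 1 <= 3 * L by lra.
have hd t : t' <= t <= 2 * t' ->
    (\int[mu]_y (phi y * (phi y / psi t y))%:E <= (1 + ratio_const A / u)%:E)%E.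
  move=> /andP[tt tt2]; apply: inverse_ratio_rate => //.
    by rewrite (lt_le_trans t0 tt) (le_trans tt2).
  by rewrite t2 /tau_seq in tt2; rewrite invf_div.
have hX t : T < t -> t <= 1 ->
    (t / t') ^+ p * expR (- (test_const * t / (3 * L)) * (n%:R - p%:R)) <= X.
  by move=> Tt _; exact: cutoff_test.
have W0 (i : 'I_n) x : 0 <= coord_weight l T (tnth th0 i) x.
  exact: coord_weight_ge0.
have mW (i : 'I_n) : measurable_fun setT (coord_weight l T (tnth th0 i)).
  exact: measurable_coord_weight.
have hW (t : R) (i : 'I_n) (y : R) : n%:R^-1 <= t <= 1 -> t <= T ->
    (\int[mu]_x (hsd t x * phi (y - x) * (x - tnth th0 i) ^+ 2)%:E
     <= (coord_weight l T (tnth th0 i) y * psi t y)%:E)%E.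
  (* The lower end 1/n of the support gives ln(1/t) <= ln n = [l]. *)
  move=> /andP[nt t1] tT; have tp : 0 < t by exact: lt_le_trans nt.
  apply: second_moment_weight => //; first by rewrite tp.
  rewrite /l ler_ln ?posrE ?invr_gt0//.
  by rewrite -[leRHS]invrK lef_pV2 ?posrE// invr_gt0.
have he (i : 'I_n) : (\int[mu]_x (phi (x - tnth th0 i) *
    coord_weight l T (tnth th0 i) x)%:E <= (weight_mean l T (tnth th0 i))%:E)%E.
  exact: coord_weight_mean.
apply: le_trans (@risk_le R n p th0 prior n%:R^-1 t' T r nu g (3 * L) (ratio_const A / u) X
  (fun i => coord_weight l T (tnth th0 i)) p_gt0 hth0 a0 hprior t0 t'T t'1 r0 nu0 nuE
  g0 z1 d0 hd hX W0 mW hW (fun i => weight_mean l T (tnth th0 i)) X0 he) _.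
rewrite lee_fin.
have e1 := sum_weight_mean_le hth0; have e3 := test_tail; have e4 := prior_tail nu0 hnu.
have e2 : g^-1 * (nu * expR (n%:R * (ratio_const A / u))) = expR (- p%:R).
  have -> : - p%:R = n%:R * (ratio_const A / u) - (ratio_const A + 1) * p%:R :> R.
    by rewrite /u; field; rewrite !gt_eqF.
  rewrite /g expRD expRN; field.
  by rewrite !gt_eqF// expR_gt0.
have e1' : r ^- 2 * (\sum_(i < n) weight_mean l T (tnth th0 i)) <=
    weight_const * (1 + B) * (p%:R * ln n%:R) / r ^+ 2.
  by rewrite mulrC ler_wpM2r// invr_ge0 sqr_ge0.
rewrite e2 mulrDl mul1r; rewrite -/g -/X in e4.
by move: e1' e3 e4; lra.
Qed.

Lemma max_risk_le :
  (max_risk n p prior r <=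
   (8 * gauss8 * (p%:R / n%:R) + (1 + K^-1) * expR (- p%:R) +
    weight_const * (1 + B) * (p%:R * ln n%:R) / r ^+ 2)%:E)%E.
Proof. by apply: ge_ereal_sup => _ [th0 h <-]; exact: posterior_risk_le. Qed.

End max_risk_bound.

(** * Passage to the limit *)

Section asymptotics.
Context {R : realType}.
Local Notation mu := (@lebesgue_measure R).
Local Notation Rn n := (n.-tuple (measurableTypeR R)).

(** The zero vector lies in every [ell0], so the supremum runs over a nonempty set of nonnegative
    values. *)
Lemma max_risk_ge0 n p a (prior : R -> R) r : 0 < a -> prob_density_on a 1 prior ->
  (0 <= @max_risk R n p prior r)%E.
Proof.
move=> a0 hprior; pose z : Rn n := [tuple (0 : measurableTypeR R) | _ < n].
apply: (@le_trans _ _ (\int[data_law z]_y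
    (posterior prior y [set th : Rn n | (r <= l2dist th z)%R])%:E)%E).
  by apply: integral_ge0 => y _; rewrite lee_fin (posterior_ge0 a0 hprior).
apply: ereal_sup_ubound; exists z => //.
rewrite /ell0/= (leq_trans _ (leq0n p))// leqn0; apply/eqP/eq_card0 => i.
by apply/negbTE/negP => /set_mem /=; rewrite tnth_mktuple eqxx.
Qed.

Variables (A K C : R) (p : nat -> nat) (prior : nat -> R -> R) (B M r : nat -> R).
Hypotheses (A0 : 0 < A) (K0 : 0 < K).
Hypotheses (p_gt0 : forall n, (0 < p n)%N)
  (p_infty : (p n)%:R @[n --> \oo] --> (+oo : set_system R))
  (p_sparse : (p n)%:R / n%:R @[n --> \oo] --> (0 : R)).
Hypothesis hprior : forall n, (1 < n)%N -> prob_density_on n%:R^-1 1 (prior n).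
Hypothesis M_infty : M n @[n --> \oo] --> (+oo : set_system R).

Lemma sparsity_le (eps : R) : 0 < eps ->
  \forall n \near \oo, (p n)%:R / n%:R <= eps :> R.
Proof. by move=> e0; exact: (cvgr_le _ p_sparse _ e0). Qed.

Lemma ln_ratio_ge (b : R) : \forall n \near \oo, b <= ln (n%:R / (p n)%:R) :> R.
Proof.
near=> n.
have n0 : (0 < n)%N by near: n; exact: nbhs_infty_gt.
have h : (p n)%:R / n%:R <= expR (- b) :> R.
  by near: n; apply: sparsity_le; exact: expR_gt0.
rewrite -[b]expRK ler_ln ?posrE ?expR_gt0 ?divr_gt0 ?ltr0n//.
rewrite -[expR b]invrK -expRN -[leRHS]invrK invf_div lef_pV2 ?posrE ?expR_gt0//.
by rewrite divr_gt0 ?ltr0n.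
Unshelve. all: by end_near.
Qed.

Lemma ln_ge (b : R) : \forall n \near \oo, b <= ln n%:R :> R.
Proof.
near=> n.
have n0 : (0 < n)%N by near: n; exact: nbhs_infty_gt.
have h : b <= ln (n%:R / (p n)%:R) by near: n; exact: ln_ratio_ge.
apply: le_trans h _; rewrite ler_ln ?posrE ?divr_gt0 ?ltr0n// ler_pdivrMr ?ltr0n//.
by rewrite ler_peMr// ler1n.
Unshelve. all: by end_near.
Qed.

(** With w = p / n and v = ln(1/w) <= 1/w, the square A^2 w^2 v is at most A^2 w. *)
Lemma tau_seq_le1 : \forall n \near \oo, A * tau_seq n (p n) <= 1.
Proof.
near=> n.
have n0 : (0 < n)%N by near: n; exact: nbhs_infty_gt.
have h : (p n)%:R / n%:R <= A ^- 2 :> R.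
  by near: n; apply: sparsity_le; rewrite invr_gt0 exprn_gt0.
have v1 : 1 <= ln (n%:R / (p n)%:R) :> R by near: n; exact: ln_ratio_ge.
have pn0 : 0 < (p n)%:R / n%:R :> R by rewrite divr_gt0 ?ltr0n.
set v := ln _ in v1; have vu : v <= ((p n)%:R / n%:R)^-1.
  rewrite invf_div; have := expR_ge1Dx v.
  by rewrite lnK ?posrE ?divr_gt0 ?ltr0n//; lra.
rewrite -(@ler_pXn2r _ 2) ?nnegrE ?expr1n//; last first.
  by rewrite mulr_ge0 ?(ltW A0)// /tau_seq mulr_ge0 ?sqrtr_ge0// ltW.
rewrite /tau_seq -/v; move: ((p n)%:R / n%:R) pn0 h vu => w w0 h vu.
rewrite !exprMn sqr_sqrtr; last by lra.
have {}vu : w * v <= 1 by rewrite -ler_pdivlMl// mulr1.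
rewrite -[leRHS](_ : A ^+ 2 * A ^- 2 = 1); last by rewrite mulfV// gt_eqF// exprn_gt0.
apply: ler_wpM2l; first exact: sqr_ge0.
apply: (le_trans _ h). rewrite expr2 -mulrA ler_piMr// ltW//.
Unshelve. all: by end_near.
Qed.

Hypothesis B_ge0 : forall n, 0 <= B n.
Hypothesis prior_mass : \forall n \near \oo, ((K * expR (- B n * (p n)%:R))%:E <=
  \int[mu]_(t in `[(A * tau_seq n (p n) / 2)%R, (A * tau_seq n (p n))%R]) (prior n t)%:E)%E.
Hypothesis hr : forall n, 1 <= ln n%:R :> R -> 0 < M n ->
  0 < r n /\ (1 + B n) * ((p n)%:R * ln n%:R) / r n ^+ 2 <= C / M n ^+ 2.

(** [hr] turns the last term of [max_risk_le] into a multiple of M_n^-2; the other two vanish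
    because p_n / n tends to 0 and p_n to infinity. *)
Lemma max_risk_cvg0 :
  @max_risk R n (p n) (prior n) (r n) @[n --> \oo] --> (0 : \bar R)%E.
Proof.
pose bound n : R := 8 * gauss8 * ((p n)%:R / n%:R) + (1 + K^-1) * expR (- (p n)%:R) +
  weight_const A * C * ((M n)^-1 * (M n)^-1).
apply: (@squeeze_cvge _ _ _ _ (cst 0%E) _ (fun n => (bound n)%:E)).
- near=> n.
  have n1 : (1 < n)%N by near: n; exact: nbhs_infty_gt.
  have a0 : 0 < n%:R^-1 :> R by rewrite invr_gt0 ltr0n ltnW.
  rewrite /cst (max_risk_ge0 _ _ _ a0 (hprior n1))/=.
  have M0 : 0 < M n by near: n; exact: cvgry_gt.
  have l1 : 1 <= ln n%:R :> R by near: n; exact: ln_ge.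
  have [r0 rle] := hr l1 M0.
  have p2 : (2 * p n <= n)%N.
    rewrite -(ler_nat R) natrM mulrC -ler_pdivlMr// -ler_pdivrMl ?ltr0n ?(ltnW n1)//.
    by rewrite mulrC; near: n; exact: sparsity_le.
  have v36 : 36 <= ln (n%:R / (p n)%:R) :> R by near: n; exact: ln_ratio_ge.
  have t1 : A * tau_seq n (p n) <= 1 by near: n; exact: tau_seq_le1.
  have mass : ((K * expR (- B n * (p n)%:R))%:E <=
    \int[mu]_(t in `[(A * tau_seq n (p n) / 2)%R, (A * tau_seq n (p n))%R]) (prior n t)%:E)%E.
    by near: n; exact: prior_mass.
  apply: le_trans (max_risk_le A0 (p_gt0 n) p2 v36 l1 t1 (hprior n1) K0 (B_ge0 n) r0 mass) _.
  rewrite lee_fin lerD2l -invfM -expr2.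
  rewrite [leLHS](_ : _ = weight_const A * ((1 + B n) * ((p n)%:R * ln n%:R) / r n ^+ 2)).
    by rewrite -[leRHS]mulrA ler_wpM2l// weight_const_ge0.
  by rewrite !mulrA.
- exact: cvg_cst.
- apply: cvg_EFin; first exact: nearW.
  rewrite -[0](_ : 8 * gauss8 * 0 + (1 + K^-1) * 0 + weight_const A * C * (0 * 0) = 0 :> R);
    last by ring.
  have Mi : (M n)^-1 @[n --> \oo] --> (0 : R).
    by apply/gtr0_cvgV0 => //; exact: cvgry_gt.
  apply: cvgD; [apply: cvgD|].
  + by apply: cvgM => //; exact: cvg_cst.
  + apply: cvgM; first exact: cvg_cst.
    by apply: (@cvg_comp _ _ _ (fun n => (p n)%:R : R) (fun x : R => expR (- x)) _ _ _ p_infty);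
      exact: cvgr_expR.
  + by apply: cvgM; [exact: cvg_cst|exact: cvgM].
Unshelve. all: by end_near.
Qed.

End asymptotics.

Theorem theorem3p7 (R : realType) (Cu : R) (p : nat -> nat)
    (prior : nat -> R -> R)
    (hCu : forall tau y : R, 0 < tau <= 1 -> m_fun tau y <= Cu)
    (p_gt0 : forall n, (0 < p n)%N)
    (p_infty : (p n)%:R @[n --> \oo] --> (+oo : set_system R))
    (p_sparse : (p n)%:R / n%:R @[n --> \oo] --> (0 : R))
    (* for n = 1 the interval [1/n, 1] is a point and supports no density *)
    (hprior : forall n, (1 < n)%N -> prob_density_on n%:R^-1 1 (prior n)) :
  ((exists c K : R, [/\ c <= Cu / 2, 0 < K &
      \forall n \near \oo,
        ((K * expR (- c * (p n)%:R))%:E <=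
         \int[lebesgue_measure]_(tau in
             `[(t_seq Cu n (p n) / 2)%R, t_seq Cu n (p n)])
           (prior n tau)%:E)%E]) ->
   forall M : nat -> R, M n @[n --> \oo] --> (+oo : set_system R) ->
     @max_risk R n (p n) (prior n) (M n * Num.sqrt ((p n)%:R * ln n%:R))
       @[n --> \oo] --> (0 : \bar R)%E)
  /\
  ((exists K : R, 0 < K /\
      \forall n \near \oo,
        ((K * t_seq Cu n (p n))%:E <=
         \int[lebesgue_measure]_(tau in
             `[(t_seq Cu n (p n) / 2)%R, t_seq Cu n (p n)])
           (prior n tau)%:E)%E) ->
   forall M : nat -> R, M n @[n --> \oo] --> (+oo : set_system R) ->
     @max_risk R n (p n) (prior n) (M n * Num.sqrt (p n)%:R * ln n%:R)
       @[n --> \oo] --> (0 : \bar R)%E).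
Proof.
have A0 : 0 < Cu * pi `^ (3 / 2) by rewrite mulr_gt0 ?(Cu_gt0 hCu)// powR_gt0// pi_gt0.
split=> [[c [K [_ K0 mass]]] M M_infty|[K [K0 mass]] M M_infty].
(* [c] may be negative; its positive part only lowers the mass required. *)
- pose B (n : nat) : R := Num.max c 0.
  have B0 n : 0 <= B n by rewrite /B le_max lexx orbT.
  apply: (max_risk_cvg0 (C := 1 + Num.max c 0) A0 K0 p_gt0 p_infty p_sparse hprior
    M_infty B0).
    near=> n; apply: (@le_trans _ _ (K * expR (- c * (p n)%:R))%:E); last by near: n.
    rewrite lee_fin ler_wpM2l ?(ltW K0)// ler_expR ler_wpM2r ?ler0n// lerN2.
    by rewrite /B le_max lexx.
  move=> n l1 M0; have pl : 0 < (p n)%:R * ln n%:R :> R.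
    by rewrite mulr_gt0 ?ltr0n// (lt_le_trans ltr01).
  split; first by rewrite mulr_gt0// sqrtr_gt0.
  rewrite exprMn sqr_sqrtr ?(ltW pl)// /B le_eqVlt; apply/orP; left; apply/eqP.
  by field; rewrite !gt_eqF ?ltr0n// (lt_le_trans ltr01).
(* exp(- p ln n) = n^-p <= 1/n, and t_n >= 1/n as soon as Cu pi^(3/2) p_n >= 1 and ln(n / p_n) >=
   1. *)
- pose B (n : nat) : R := ln n%:R.
  have B0 n : 0 <= B n.
    by case: n => [|n]; [rewrite /B ln0|rewrite /B ln_ge0// ler1n].
  (* The squared radius is M_n^2 p_n (ln n)^2, and 1 + ln n <= 2 ln n. *)
  apply: (max_risk_cvg0 (C := 2) A0 K0 p_gt0 p_infty p_sparse hprior M_infty B0).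
    near=> n.
    have n0 : (0 < n)%N by near: n; exact: nbhs_infty_gt.
    have nR : 0 < n%:R :> R by rewrite ltr0n.
    have h : ((K * t_seq Cu n (p n))%:E <=
         \int[lebesgue_measure]_(tau in
             `[(t_seq Cu n (p n) / 2)%R, t_seq Cu n (p n)])
           (prior n tau)%:E)%E by near: n.
    apply: le_trans h; rewrite lee_fin ler_wpM2l ?(ltW K0)//.
    have v1 : 1 <= ln (n%:R / (p n)%:R) :> R by near: n; exact: ln_ratio_ge.
    have pA : (Cu * pi `^ (3 / 2))^-1 <= (p n)%:R by near: n; exact: cvgry_ge.
    apply: (@le_trans _ _ n%:R^-1).
      rewrite mulNr expRN lef_pV2 ?posrE ?expR_gt0// expRM_natr lnK ?posrE//.
      by rewrite ler_eXnr// ler1n.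
    rewrite /t_seq /tau_seq; move: (Cu * _) A0 pA => A A0 pA.
    set s := Num.sqrt _; rewrite (_ : A * _ = n%:R^-1 * (A * (p n)%:R * s)); last by ring.
    have s1 : 1 <= s by rewrite /s -[leLHS]sqrtr1 ler_wsqrtr.
    have Ap : 1 <= A * (p n)%:R by rewrite -ler_pdivrMl// mulr1.
    by rewrite ler_peMr ?invr_ge0 ?ler0n// mulr_ege1.
  move=> n l1 M0; have l0 : 0 < ln n%:R :> R by exact: lt_le_trans l1.
  have p0 : 0 < (p n)%:R :> R by rewrite ltr0n.
  split; first by rewrite mulr_gt0// mulr_gt0// sqrtr_gt0.
  rewrite !exprMn sqr_sqrtr ?ler0n// /B.
  rewrite [leLHS](_ : _ = ((1 + ln n%:R) / ln n%:R) / M n ^+ 2); last first.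
    by field; rewrite !gt_eqF.
  by rewrite ler_wpM2r ?invr_ge0 ?sqr_ge0// ler_pdivrMr//; lra.
Unshelve. all: by end_near.
Qed.
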